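(* Let $n\ge1$, let $\Delta_1,\ldots,\Delta_n\subset\mathbb{R}^{2n}$ be full-dimensional normal lattice polytopes (with respect to the lattice $\mathbb{Z}^{2n}$), and for each $i$ let $h_{\Delta_i}$ be a Hermitian metric on $W_{\Delta_i}$ for which the characters $\chi^m$, $m\in\Delta_i\cap\mathbb{Z}^{2n}$, are orthogonal. For positive integers $e_1,\ldots,e_n$, let $\mathbb{E}_{e_1\Delta_1,\ldots,e_n\Delta_n}$ denote the expected total multivolume of the amoeba of the common zero locus in $(\mathbb{C}^{\times})^{2n}$ of independent random Laurent polynomials $f_1,\ldots,f_n$, where $f_i\in W_{e_i\Delta_i}$ is chosen according to the Gaussian probability measure associated with the metric $h_{e_i\Delta_i}$ induced by $h_{\Delta_i}$. Then, for all positive integers $d_1,d_2,\ldots,d_n$, $$\mathbb{E}_{d_1\Delta_1,\ldots,d_n\Delta_n}=(d_1d_2\cdots d_n)\,\mathbb{E}_{\Delta_1,\ldots,\Delta_n}.$$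
   Context: Polytopes and sections: a lattice polytope $\Delta\subset\mathbb{R}^{2n}$ (convex hull of finitely many points of $M=\mathbb{Z}^{2n}$) is normal if $(k\Delta)\cap M+(l\Delta)\cap M=((k+l)\Delta)\cap M$ for all positive integers $k,l$. Here $d\Delta$ denotes the Minkowski sum of $\Delta$ with itself $d$ times. For $m=(a_1,\ldots,a_{2n})\in M$, the character $\chi^m:(\mathbb{C}^{\times})^{2n}\to\mathbb{C}^{\times}$ is $\chi^m(t)=t_1^{a_1}\cdots t_{2n}^{a_{2n}}$. Let $X_\Delta$ be the projective toric variety of $\Delta$, i.e. the Zariski closure of the image of $(\mathbb{C}^{\times})^{2n}$ in $\mathbb{P}(\mathbb{C}^{\Delta\cap M})$ under $t\mapsto(\chi^m(t))_{m\in\Delta\cap M}$, let $i:X_\Delta\to\mathbb{P}(\mathbb{C}^{\Delta\cap M})$ be the inclusion, and $W_\Delta=H^0(X_\Delta,i^*\mathcal{O}(1))$. The space $W_\Delta$ is identified with the complex span of the characters $\chi^m$, $m\in\Delta\cap M$, i.e. Laurent polynomials with exponents in $\Delta$; likewise $W_{d\Delta}$ is the space of sections of $(i^*\mathcal{O}(1))^{\otimes d}$, identified with the span of $\chi^m$, $m\in d\Delta\cap M$. Induced metric: let $h_\Delta$ be a Hermitian metric (inner product) on $W_\Delta$ with the characters orthogonal, and let $K_\Delta(x,y)=\sum_{m\in\Delta\cap M}\|\chi^m\|_{h_\Delta}^{-2}\,\chi^m(x)\overline{\chi^m(y)}$ be its reproducing kernel on $(\mathbb{C}^{\times})^{2n}$.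 The induced metric $h_{d\Delta}$ on $W_{d\Delta}$ is the one given by the Aronszajn multiplication formula, i.e. the inner product whose reproducing kernel is $K_\Delta^d$. Explicitly, writing $K_\Delta(x,y)^d=\sum_{m\in d\Delta\cap M}c_m^{(d)}\chi^m(x)\overline{\chi^m(y)}$ (where all $c_m^{(d)}>0$ by normality), the characters $\chi^m$, $m\in d\Delta\cap M$, are orthogonal for $h_{d\Delta}$ with $\|\chi^m\|^2_{h_{d\Delta}}=1/c_m^{(d)}$. Gaussian measure: on $W_{d\Delta}$ (with $d\ge1$), the Gaussian probability measure is $\frac{1}{\nu}e^{-\|f\|^2}\,df$, where $\|\cdot\|$ is the norm of $h_{d\Delta}$, $df$ is Lebesgue measure and $\nu$ is the normalizing constant. The $n$-tuple $(f_1,\ldots,f_n)$ is chosen according to the product measure. Amoeba and multivolume: let $\mathrm{Log}:(\mathbb{C}^{\times})^{2n}\to\mathbb{R}^{2n}$, $\mathrm{Log}(z_1,\ldots,z_{2n})=(\log|z_1|,\ldots,\log|z_{2n}|)$. The amoeba of an algebraic subvariety $V\subset(\mathbb{C}^{\times})^{2n}$ is $\mathcal{A}(V)=\mathrm{Log}(V)$. For $V$ of complex dimension $n$, the multivolume measure on $\mathcal{A}(V)$ is $d\mathrm{MultiVol}=\mathrm{Log}_*(\mathrm{Log}^*(d\mathrm{Vol}))$, with $d\mathrm{Vol}$ the Lebesgue measure of $\mathbb{R}^{2n}$ restricted to $\mathcal{A}(V)$ and $\mathrm{Log}$ restricted to $V$; the total multivolume is $$\mathrm{MultiVol}(\mathcal{A}(V))=\int_{\mathbb{R}^{2n}}\#\{z\in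 V:\mathrm{Log}(z)=x\}\,dx .$$ *)

(* Defs.v *)
From HB Require Import structures.
From mathcomp Require Import all_boot all_order all_algebra finmap.
From mathcomp Require Import sesquilinear complex.
From mathcomp Require Import all_classical all_reals all_analysis.
From mathcomp Require Import zify.

Set Implicit Arguments.
Unset Strict Implicit.
Unset Printing Implicit Defensive.
Import Order.TTheory GRing.Theory Num.Theory Num.Def.
Import numFieldNormedType.Exports.

Local Open Scope classical_set_scope.
Local Open Scope ring_scope.
Local Open Scope complex_scope.

Section Polytopes.
Context {R : realType} {N : nat}.
Implicit Types (S A : set 'rV[R]_N) (m : 'rV[int]_N).

Definition real_point m : 'rV[R]_N := map_mx intr m.

Definition affine_hull S : set 'rV[R]_N :=
  [set v | exists k (w : 'I_k -> R) (p : 'I_k -> 'rV[R]_N),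
    [/\ forall i, S (p i), \sum_i w i = 1 & v = \sum_i w i *: p i]].

Definition convex_hull S : set 'rV[R]_N :=
  [set v | exists k (w : 'I_k -> R) (p : 'I_k -> 'rV[R]_N),
    [/\ forall i, S (p i), forall i, 0 <= w i, \sum_i w i = 1
      & v = \sum_i w i *: p i]].

Definition lattice_polytope A : Prop :=
  exists s : seq 'rV[int]_N, A = convex_hull [set real_point m | m in [set` s]].

Definition full_dimensional A : Prop := affine_hull A = setT.

(* The Minkowski sum of d copies of A. *)
Definition dilate (d : nat) A : set 'rV[R]_N :=
  [set v | exists p : 'I_d -> 'rV[R]_N, (forall i, A (p i)) /\ v = \sum_i p i].

Definition lattice_set A : set 'rV[int]_N := [set m | A (real_point m)].

Definition normal_polytope A : Prop := forall k l, (0 < k)%N -> (0 < l)%N ->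
  [set a + b | a in lattice_set (dilate k A) & b in lattice_set (dilate l A)]
  = lattice_set (dilate (k + l) A).

(* [fset_set] is only meaningful on finite sets; see
   [finite_lattice_set_dilate] below. *)
Definition lattice_points A : {fset 'rV[int]_N} := fset_set (lattice_set A).

Lemma finite_lattice_set_dilate d A :
  lattice_polytope A -> finite_set (lattice_set (dilate d A)).
Proof.
move=> [s ->].
pose b := (\max_(m <- s) \max_(j < N) absz (m ord0 j))%N.
pose K := (d * b)%N.
have bP v j : convex_hull [set real_point m | m in [set` s]] v ->
    `|v 0 j| <= b%:R.
  move=> [k [w [p [pS w0 w1 ->]]]]; rewrite summxE.
  rewrite (le_trans (ler_norm_sum _ _ _))//.
  have -> : b%:R = \sum_i w i * b%:R :> R by rewrite -mulr_suml w1 mul1r.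
  apply: ler_sum => i _; rewrite mxE normrM (ger0_norm (w0 i)).
  apply: ler_wpM2l => //; have [m /= ms <-] := pS i.
  rewrite mxE -intr_norm.
  suff: (`|m ord0 j|%N <= b)%N by rewrite -lez_nat abszE -(ler_int R).
  apply: (@leq_trans (\max_(j < N) absz (m ord0 j))%N).
    exact: (leq_bigmax (F := fun j : 'I_N => absz (m ord0 j))).
  exact: (@leq_bigmax_seq _ s xpredT (fun m => \max_(j < N) absz (m ord0 j))%N).
pose g (f : {ffun 'I_N -> 'I_(K.*2.+1)}) : 'rV[int]_N :=
  \row_j ((f j)%:Z - K%:Z).
apply: (sub_finite_set (B := g @` setT)); last first.
  by apply: finite_image; exact: finite_finset.
move=> m [p [pA mE]].
have mK j : (absz (m ord0 j) <= K)%N.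
  rewrite -lez_nat abszE -(ler_int R) intr_norm (_ : K%:Z%:~R = K%:R)//.
  have -> : (m ord0 j)%:~R = real_point m ord0 j :> R by rewrite mxE.
  rewrite mE summxE (le_trans (ler_norm_sum _ _ _))//.
  apply: (@le_trans _ _ (\sum_(i < d) b%:R)); first by apply: ler_sum => i _; exact: bP.
  by rewrite sumr_const card_ord -mulrnA mulnC.
exists [ffun j => inord (absz (m ord0 j + K%:Z))] => //.
by apply/rowP => j; rewrite !mxE ffunE inordK; have := mK j;
   move: (m ord0 j) => x; clearbody K; rewrite -?addnn; lia.
Qed.

Lemma in_lattice_points d A (m : 'rV[int]_N) : lattice_polytope A ->
  (m \in lattice_points (dilate d A)) <-> lattice_set (dilate d A) m.
Proof.
by move=> Al; rewrite in_fset_set ?inE//; exact: finite_lattice_set_dilate.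
Qed.

Lemma dilate1 A : dilate 1 A = A.
Proof.
apply/seteqP; split=> [v [p [pA ->]]|v Av]; first by rewrite big_ord1.
by exists (fun=> v); rewrite big_ord1.
Qed.

Lemma in_lattice_points1 A (m : 'rV[int]_N) : lattice_polytope A ->
  (m \in lattice_points A) <-> lattice_set A m.
Proof. by move=> Al; rewrite -{1 2}(dilate1 A); exact: in_lattice_points. Qed.

End Polytopes.

Section LaurentPolynomials.
Context {R : realType} {N : nat}.
Implicit Types (A : set 'rV[R]_N) (z : 'rV[R[i]]_N).

Definition torus : set 'rV[R[i]]_N := [set z | forall j, z 0 j != 0].

Definition chi (m : 'rV[int]_N) z : R[i] := \prod_j (z 0 j) ^ (m 0 j).

(* W_A = H^0(X_A, O(1)) is identified with the complex span of the characters
   with exponents in A; an element is its family of coefficients. *)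
Definition W A : Type := {ffun lattice_points A -> R[i]}.
HB.instance Definition _ A := GRing.Lmodule.on (W A).

Definition character A (m : lattice_points A) : W A :=
  [ffun m' => (m' == m)%:R].

Definition laurent_eval A (f : W A) z : R[i] := \sum_m f m * chi (val m) z.

Definition characters_orthogonal A (h : W A -> W A -> R[i]) : Prop :=
  forall m m', m != m' -> h (character m) (character m') = 0.

(* The reproducing kernel of an inner product h for which the characters are
   orthogonal. *)
Definition reproducing_kernel A (h : W A -> W A -> R[i]) x y : R[i] :=
  \sum_m (h (character m) (character m))^-1
    * chi (val m) x * (chi (val m) y)^*.

(* The coefficient of chi^m(x) * (chi^m(y))^* in (reproducing_kernel h x y)^d;
   see [kernel_powE]. *)
Definition kernel_pow_coef A (h : W A -> W A -> R[i]) d (m : 'rV[int]_N) :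
    R[i] :=
  \sum_(s : {ffun 'I_d -> lattice_points A} | \sum_i val (s i) == m)
    \prod_i (h (character (s i)) (character (s i)))^-1.

(* The inner product on W_{dA} whose reproducing kernel is the d-th power of that
   of h: characters are orthogonal, of squared norm 1 / c_m. That this is the
   Aronszajn product is [induced_metric_reproducing]. *)
Definition induced_metric A (h : W A -> W A -> R[i]) d
    (f g : W (dilate d A)) : R[i] :=
  \sum_m (kernel_pow_coef h d (val m))^-1 * f m * (g m)^*.

Lemma lattice_points_sum d A (s : 'I_d -> lattice_points A) :
  lattice_polytope A -> \sum_i val (s i) \in lattice_points (dilate d A).
Proof.
move=> Al; apply/in_lattice_points => //; exists (fun i => real_point (val (s i))).
split=> [i|]; last first.
  by rewrite /real_point raddf_sum.
exact/in_lattice_points1/valP.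
Qed.

Lemma chi_sum d (m : 'I_d -> 'rV[int]_N) (z : 'rV[R[i]]_N) : torus z ->
  chi (\sum_i m i) z = \prod_i chi (m i) z.
Proof.
move=> zT; rewrite /chi exchange_big /=; apply: eq_bigr => j _.
rewrite summxE; elim/big_rec2: _ => [|i y x _ <-]; first by rewrite expr0z.
by rewrite expfzDr// zT.
Qed.

Lemma kernel_powE d A (h : W A -> W A -> R[i]) x y :
  lattice_polytope A -> torus x -> torus y ->
  reproducing_kernel h x y ^+ d =
  \sum_(m : lattice_points (dilate d A))
    kernel_pow_coef h d (val m) * chi (val m) x * (chi (val m) y)^*.
Proof.
move=> Al xT yT; rewrite -[X in _ ^+ X](card_ord d) -prodr_const bigA_distr_bigA /=.
pose q (s : {ffun 'I_d -> lattice_points A}) : lattice_points (dilate d A) :=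
  [` lattice_points_sum s Al]%fset.
rewrite (partition_big q xpredT)//=; apply: eq_bigr => m _.
rewrite /kernel_pow_coef !mulr_suml.
under eq_bigl do rewrite -val_eqE /=.
apply: eq_bigr => s /eqP <-; rewrite !chi_sum// !big_split /= rmorph_prod.
by [].
Qed.

Lemma kernel_pow_coef_gt0 d A (h : {dot W A for conjC}) m :
  lattice_polytope A -> normal_polytope A -> (0 < d)%N ->
  lattice_set (dilate d A) m -> 0 < kernel_pow_coef h d m.
Proof.
move=> Al An d0 mA.
have h0 (m' : lattice_points A) : 0 < (h (character m') (character m'))^-1.
  rewrite invr_gt0 dnorm_gt0; apply/negP => /eqP/ffunP/(_ m').
  by rewrite !ffunE eqxx => /eqP; rewrite oner_eq0.
have [s sE] : exists s : 'I_d -> lattice_points A, \sum_i val (s i) = m.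
  elim: d d0 m mA => // -[_ _ m|d IH _ m].
    rewrite dilate1 => mA.
    have mP : m \in lattice_points A.
      exact/in_lattice_points1.
    by exists (fun=> [` mP]%fset); rewrite big_ord1.
  rewrite -[d.+2]addn1 -An// => -[a /(IH isT)[s sa] [b + <-]].
  rewrite dilate1 => bA.
  have bP : b \in lattice_points A.
    exact/in_lattice_points1.
  exists (fun i : 'I_(d.+1 + 1) => if fintype.split i is inl j then s j else [` bP]%fset).
  rewrite big_split_ord big_ord1 /= -sa; congr (_ + _).
    apply: eq_bigr => i _.
    by case: splitP => [j /= /val_inj ->//|j /= ij]; have := ltn_ord i; rewrite ij; lia.
  by case: splitP => [j /= ij|//]; have := ltn_ord j; rewrite -ij; lia.
rewrite /kernel_pow_coef (bigD1 (finfun s)) /=; last first.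
  by apply/eqP; rewrite -sE; apply: eq_bigr => i _; rewrite ffunE.
by apply: ltr_wpDr; [apply: sumr_ge0 => t _; apply: prodr_ge0 => i _; exact/ltW|
  exact: prodr_gt0].
Qed.

Lemma induced_metric_reproducing d A (h : {dot W A for conjC}) y :
  lattice_polytope A -> normal_polytope A -> (0 < d)%N -> torus y ->
  exists k : W (dilate d A),
    (forall x, torus x -> laurent_eval k x = reproducing_kernel h x y ^+ d) /\
    (forall f, laurent_eval f y = induced_metric h f k).
Proof.
move=> Al An d0 yT.
exists [ffun m => kernel_pow_coef h d (val m) * (chi (val m) y)^*]; split.
  move=> x xT; rewrite kernel_powE//; apply: eq_bigr => m _.
  by rewrite ffunE mulrAC.
move=> f; apply: eq_bigr => m _; rewrite ffunE.
have c0 : 0 < kernel_pow_coef h d (val m).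
  by apply: kernel_pow_coef_gt0 => //; apply/in_lattice_points => //; exact: valP.
rewrite rmorphM /= conjCK (CrealP (gtr0_real c0)) mulrACA.
by rewrite mulVf ?mul1r// gt_eqF.
Qed.

End LaurentPolynomials.

Section ProductMeasure.
Context {R : realType}.

(* The library has products of measures for pairs only. *)
Definition cylinders n (d : 'I_n -> measure_display)
    (T : forall i, measurableType (d i)) : set (set (forall i, T i)) :=
  [set C | exists i (B : set (T i)), measurable B /\ C = [set x | B (x i)]].
Arguments cylinders {n d} T.

Definition prod_type n (d : 'I_n -> measure_display)
    (T : forall i, measurableType (d i)) :=
  g_sigma_algebraType (cylinders T).
Arguments prod_type {n d} T.

Definition prod_cons n (T : 'I_n.+1 -> Type) (x : T ord0)
    (f : forall j, T (lift ord0 j)) : forall i, T i := fun i =>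
  match unliftP ord0 i with
  | UnliftSome j e => eq_rect_r T (f j) e
  | UnliftNone e => eq_rect_r T x e
  end.

Lemma prod_cons0 n (T : 'I_n.+1 -> Type) (x : T ord0)
    (f : forall j, T (lift ord0 j)) : prod_cons x f ord0 = x.
Proof.
rewrite /prod_cons; case: unliftP => [j e|e].
  by exfalso; move: e; apply/eqP; rewrite neq_lift.
by rewrite (Prop_irrelevance e erefl).
Qed.

Lemma prod_consS n (T : 'I_n.+1 -> Type) (x : T ord0)
    (f : forall j, T (lift ord0 j)) j : prod_cons x f (lift ord0 j) = f j.
Proof.
rewrite /prod_cons; case: unliftP => [k e|e]; last first.
  by exfalso; move: e; apply/eqP; rewrite eq_sym neq_lift.
have kj := lift_inj e; rewrite -kj in e *.
by rewrite (Prop_irrelevance e erefl).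
Qed.

(* The library's binary product [\x] iterated; it is defined on arbitrary set
   functions, so no measure structure is needed here. Its value on boxes is
   given by [prod_measure_box]. *)
Fixpoint prod_measure n : forall (d : 'I_n -> measure_display)
    (T : forall i, measurableType (d i)),
    (forall i, set (T i) -> \bar R) -> set (prod_type T) -> \bar R :=
  match n with
  | 0 => fun d T mu => \d_(point : prod_type T)
  | n'.+1 => fun d T mu =>
      pushforward
        (mu ord0 \x @prod_measure n' _ (fun j => T (lift ord0 j))
                      (fun j => mu (lift ord0 j)))%E
        (fun x : T ord0 * prod_type (fun j => T (lift ord0 j)) =>
           prod_cons x.1 x.2 : prod_type T)
  end.

Lemma prod_measure0 n (d : 'I_n -> measure_display)
    (T : forall i, measurableType (d i))
    (mu : forall i, {measure set (T i) -> \bar R}) :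
  prod_measure mu set0 = 0%E.
Proof.
elim: n => [|n IH] in d T mu *; first exact: measure0.
rewrite /= /pushforward preimage_set0 /product_measure1.
by apply: integral0_eq => x _ /=; rewrite xsection0; exact: IH.
Qed.

Lemma prod_measure_box n (d : 'I_n -> measure_display)
    (T : forall i, measurableType (d i))
    (mu : forall i, {measure set (T i) -> \bar R}) (B : forall i, set (T i)) :
  (forall i, measurable (B i)) ->
  prod_measure mu [set x | forall i, B i (x i)] = (\big[*%E/1%E]_i mu i (B i))%E.
Proof.
elim: n => [|n IH] in d T mu B * => mB /=.
  by rewrite big_ord0 diracE mem_set// => -[].
have {}IH := IH _ _ (fun j => mu (lift ord0 j)) _ (fun j => mB (lift ord0 j)).
rewrite big_ord_recl -IH muleC /pushforward /product_measure1.
rewrite -integral_cst// [RHS]integral_mkcond.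
congr (integral _ _ _); apply/funext => x /=; rewrite patchE.
case: ifPn => [/set_mem|/negP] xB.
  congr (prod_measure _ _); apply/seteqP; split=> f.
    by move=> /xsectionP /= fB i; have := fB (lift ord0 i); rewrite prod_consS.
  move=> fB; apply/xsectionP => i /=.
  by case: (unliftP ord0 i) => [j ->|->]; rewrite ?prod_consS ?prod_cons0.
rewrite [X in prod_measure _ X](_ : _ = set0); first exact: prod_measure0.
apply/seteqP; split=> // f /xsectionP /= fB; apply: xB; apply/mem_set.
by have := fB ord0; rewrite prod_cons0.
Qed.

Definition euclidean (N : nat) := prod_type (fun _ : 'I_N => R).

Definition lebesgue_euclidean (N : nat) : set (euclidean N) -> \bar R :=
  prod_measure (fun _ => @lebesgue_measure R).

End ProductMeasure.
Arguments cylinders {n d} T.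
Arguments prod_type {n d} T.
Arguments euclidean R N : clear implicits.
Arguments lebesgue_euclidean {R N}.

Section GaussianMeasure.
Context {R : realType} {N : nat}.
Implicit Types (A : set 'rV[R]_N).

Definition coef_type A :=
  prod_type (fun _ : 'I_#|{: lattice_points A}| => (R * R)%type).

Definition of_coef A (x : coef_type A) : W A :=
  [ffun m => (x (enum_rank m)).1 +i* (x (enum_rank m)).2].

HB.instance Definition _ A := isPointed.Build (W A) 0.

Section W_measurable.
Variable A : set 'rV[R]_N.

Definition W_measurable : set (set (W A)) :=
  [set B | measurable (@of_coef A @^-1` B)].

Let W_measurable0 : W_measurable set0.
Proof. by rewrite /W_measurable /= preimage_set0. Qed.

Let W_measurableC B : W_measurable B -> W_measurable (~` B).
Proof. by rewrite /W_measurable /= preimage_setC; exact: measurableC. Qed.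

Let W_measurable_bigcup (F : (set (W A))^nat) :
  (forall i, W_measurable (F i)) -> W_measurable (\bigcup_i F i).
Proof.
by rewrite /W_measurable /= preimage_bigcup => mF; exact: bigcupT_measurable.
Qed.

HB.instance Definition _ := @isMeasurable.Build default_measure_display (W A)
  W_measurable W_measurable0 W_measurableC W_measurable_bigcup.

End W_measurable.

(* Lebesgue measure in the real and imaginary parts of the coefficients. Any
   other normalization of it cancels out in [gaussian]. *)
Definition lebesgue_W A : set (W A) -> \bar R :=
  pushforward
    (prod_measure (fun _ => @lebesgue_measure R \x @lebesgue_measure R)%E)
    (@of_coef A).

Local Open Scope ereal_scope.

Definition gaussian_density A (h : W A -> W A -> R[i]) (f : W A) : R :=
  expR (- complex.Re (h f f))%R.

Definition gaussian A (h : W A -> W A -> R[i]) (B : set (W A)) : \bar R :=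
  (\int[@lebesgue_W A]_f (gaussian_density h f)%:E)^-1 *
  \int[@lebesgue_W A]_(f in B) (gaussian_density h f)%:E.

End GaussianMeasure.

Section ExpectedMultivolume.
Context {R : realType} {n N : nat}.

Definition Log (z : 'rV[R[i]]_N) : euclidean R N :=
  fun j => ln (complex.Re `|z 0 j|).

(* The total multivolume of the amoeba Log(V): [counting] is the cardinality,
   with value +oo on infinite fibres. *)
Definition multivolume (V : set 'rV[R[i]]_N) : \bar R :=
  (\int[lebesgue_euclidean]_x counting (V `&` [set z | Log z = x]))%E.

Definition zero_locus (A : 'I_n -> set 'rV[R]_N)
    (f : prod_type (fun i => W (A i))) : set 'rV[R[i]]_N :=
  [set z | torus z /\ forall i, laurent_eval (f i) z = 0].

(* E_{e_1 A_1, ..., e_n A_n}; W_{A_i} itself corresponds to e_i = 1. *)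
Definition expected_multivolume (A : 'I_n -> set 'rV[R]_N)
    (h : forall i, W (A i) -> W (A i) -> R[i]) (e : 'I_n -> nat) : \bar R :=
  (\int[prod_measure (fun i => gaussian (@induced_metric _ _ _ (h i) (e i)))]_f
     multivolume (zero_locus f))%E.

End ExpectedMultivolume.

(* Main.v *)
Require Import Defs.
From HB Require Import structures.
From mathcomp Require Import all_boot all_order all_algebra finmap.
From mathcomp Require Import sesquilinear complex.
From mathcomp Require Import all_classical all_reals all_analysis.
From mathcomp Require Import measurable_realfun zify ring lra.

(** By Tonelli the expected multivolume is the integral over [x] of the expected
    number of zeros in the fibre of Log over [x], a torus parametrized by the half-open unit cube.
    Up to a nonvanishing phase, [f_i] restricted to this torus is
    [sum_m a_m sqrt(w_m) cis(q_m.t)] with standard complex Gaussians [a_m],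
    [sum w = 1] and [sum w q = 0]; its law is invariant under translations of [t].
    Counting the zeros through dyadic cells, monotone convergence and stationarity
    reduce their expected number to the limit of [eps^-N] times the probability of
    a zero in a cube of side [eps].  An orthogonal change of the [a_m] turns the
    first-order part of the system into [eta + eps t B' xi] with independent Gaussian
    vectors [eta] and [xi], where [B' B'^T] is the covariance of the weights [w]; after
    rescaling [eta], dominated convergence gives a limit that depends on [B'] only, and
    multiplying the covariance of [f_i] by [d_i] multiplies it by [d_1 ... d_n].
    Finally the weights of the [d]-th power of the kernel are the law of a sum of [d]
    independent copies of the exponent, so their covariance is [d] times that of
    the weights of the kernel. *)

Set Implicit Arguments.
Unset Strict Implicit.
Unset Printing Implicit Defensive.
Import Order.TTheory GRing.Theory Num.Theory Num.Def.
Import numFieldNormedType.Exports.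

Local Open Scope classical_set_scope.
Local Open Scope ring_scope.
Local Open Scope complex_scope.

(** * Products of sigma-finite measures *)

(** The limit constant is never evaluated, so no formula for the density of zeros with its Jacobian
    determinant is needed; what matters is that the systems attached to $d$ and to $(1,\dots,1)$
    share it. Each complex equation is two real ones, each contributing a factor $\sqrt{d_i}$. Full
    dimension enters as positive definiteness of the covariances, which supplies Cholesky factors;
    normality enters as positivity of the kernel coefficients. The obstacle in the local limit is
    that, after rescaling, the Gaussian weight of $\eta$ tends to 1 and loses integrability:
    domination must come from the event itself, where a zero in the cube bounds $\eta$ by the other
    coordinates. *)

(* Both carry the property they need as an argument, so that the measure
   structure can be inferred from the term. *)
Definition sigma_finite_measure_of d (T : measurableType d) (R : realType)
  (m : {measure set T -> \bar R}) (_ : sigma_finite setT m) : set T -> \bar R := m.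

Definition image_measure d d' (T : measurableType d) (T' : measurableType d')
  (R : realType) (m : {measure set T -> \bar R}) (f : T -> T')
  (_ : measurable_fun setT f) : set T' -> \bar R := pushforward m f.

Section MeasureInstances.
Context d d' (T : measurableType d) (T' : measurableType d') (R : realType).
Variable m : {measure set T -> \bar R}.

HB.instance Definition _ (sf : sigma_finite setT m) :=
  Measure.copy (sigma_finite_measure_of sf) (m : set T -> \bar R).
HB.instance Definition _ (sf : sigma_finite setT m) :=
  Measure_isSigmaFinite.Build _ _ _ (sigma_finite_measure_of sf) sf.

HB.instance Definition _ (f : T -> T') (mf : measurable_fun setT f) :=
  Measure.copy (image_measure m mf)
    (measure_function_pushforward__canonical__measure_function_Measure m mf).

End MeasureInstances.

Section ProdMeasurable.
Context n (d : 'I_n -> measure_display) (T : forall i, measurableType (d i)).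

Lemma measurable_proj i : measurable_fun setT (fun x : prod_type T => x i).
Proof.
move=> _ B mB; rewrite setTI; apply: sub_sigma_algebra.
by exists i, B.
Qed.

Lemma measurable_comp_proj i d' (S : measurableType d') (g : T i -> S) :
  measurable_fun setT g -> measurable_fun setT (fun x : prod_type T => g (x i)).
Proof. by move=> mg; apply: measurableT_comp => //; exact: measurable_proj. Qed.

Lemma measurable_coord d' (S : measurableType d') (f : S -> prod_type T) i :
  measurable_fun setT f -> measurable_fun setT (fun s => f s i).
Proof.
move=> mf; pose g (x : prod_type T) := x i.
have mg : measurable_fun setT g by exact: measurable_proj.
exact: (measurableT_comp mg mf).
Qed.

Lemma measurable_prodP d' (S : measurableType d') (f : S -> prod_type T) :
  (forall i, measurable_fun setT (fun s => f s i)) -> measurable_fun setT f.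
Proof.
move=> mf; apply: (@measurability _ _ S (prod_type T) setT f (cylinders T)) => //.
move=> _ [_ [i [B [mB ->]]] <-].
exact: mf.
Qed.

Definition box (B : forall i, set (T i)) : set (prod_type T) :=
  [set x | forall i, B i (x i)].

Lemma measurable_box (B : forall i, set (T i)) :
  (forall i, measurable (B i)) -> measurable (box B).
Proof.
move=> mB; rewrite (_ : box B = \bigcap_(i in setT) ((fun x : prod_type T => x i) @^-1` B i)).
  apply: fin_bigcap_measurable; first exact: finite_finset.
  by move=> i _; rewrite -[X in measurable X]setTI; exact: measurable_proj.
by apply/seteqP; split=> x /= h i => [_|]; exact: h.
Qed.

End ProdMeasurable.

Section ProdMeasurableCons.
Context n (d : 'I_n.+1 -> measure_display) (T : forall i, measurableType (d i)).

Lemma measurable_prod_cons : measurable_fun setT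
  (fun x : T ord0 * prod_type (fun j => T (lift ord0 j)) =>
     prod_cons x.1 x.2 : prod_type T).
Proof.
apply: measurable_prodP => i; case: (unliftP ord0 i) => [j ->|->].
  rewrite (_ : (fun s => _) = (fun s => s.2 j)); last first.
    by apply/funext => s; rewrite prod_consS.
  pose g (x : prod_type (fun j => T (lift ord0 j))) := x j.
  have mg : measurable_fun setT g by exact: measurable_proj.
  exact: (measurableT_comp mg measurable_snd).
rewrite (_ : (fun s => _) = fst); first exact: measurable_fst.
by apply/funext => s; rewrite prod_cons0.
Qed.

End ProdMeasurableCons.

Section ProdMeasureStructure.
Context {R : realType}.
Local Open Scope ereal_scope.

(** The factors' exhaustions increase, so a point lies in the box whose index is the largest of the
    finitely many indices at which its coordinates are captured. *)
Lemma box_exhaustion n (d : 'I_n -> measure_display)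
    (T : forall i, measurableType (d i))
    (mu : forall i, {sigma_finite_measure set (T i) -> \bar R}) :
  exists F : nat -> forall i, set (T i),
    [/\ forall k i, measurable (F k i), forall k i, mu i (F k i) < +oo
      & \bigcup_k box (F k) = setT].
Proof.
have HF : forall i, exists F : (set (T i))^nat,
    [/\ setT = \bigcup_k F k, nondecreasing_seq F
       & forall k, measurable (F k) /\ mu i (F k) < +oo].
  by move=> i; have /sigma_finiteP := sigma_finiteT (mu i).
pose F i := sval (cid (HF i)); have FP i := svalP (cid (HF i)).
exists (fun k i => F i k); split=> [k i|k i|].
- by have [_ _ /(_ k)[]] := FP i.
- by have [_ _ /(_ k)[]] := FP i.
- apply/seteqP; split=> // x _.
  have /choice[k kP] : forall i, exists k, F i k (x i).
    move=> i; have [FT _ _] := FP i.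
    have : [set: T i] (x i) by [].
    by rewrite FT => -[k _ ?]; exists k.
  exists (\max_i k i)%N => // i; have [_ /(_ (k i) (\max_i k i)%N) ndF _] := FP i.
  have /subsetPset : (F i (k i) <= F i (\max_i k i)%N)%O.
    by apply: ndF; exact: leq_bigmax.
  by apply; exact: kP.
Qed.

Lemma emeasurable_prod d (T : measurableType d) (I : Type) (r : seq I)
    (f : I -> T -> \bar R) : (forall i, measurable_fun setT (f i)) ->
  measurable_fun setT (fun x => \big[*%E/1%E]_(i <- r) f i x).
Proof.
move=> mf; elim: r => [|i r IH].
  by under eq_fun do rewrite big_nil; exact: measurable_cst.
by under eq_fun do rewrite big_cons; exact: emeasurable_funM.
Qed.

Lemma prode_ge0 (I : Type) (r : seq I) (f : I -> \bar R) :
  (forall i, 0 <= f i) -> 0 <= \big[*%E/1%E]_(i <- r) f i.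
Proof. by move=> f0; elim/big_rec: _ => // i x _; exact: mule_ge0. Qed.

Lemma lte_prod_pinfty (I : Type) (r : seq I) (f : I -> \bar R) :
  (forall i, 0 <= f i) -> (forall i, f i < +oo) -> \big[*%E/1%E]_(i <- r) f i < +oo.
Proof.
move=> f0 foo; suff : 0 <= \big[*%E/1%E]_(i <- r) f i < +oo by case/andP.
elim/big_rec: _ => [|i x _ /andP[x0 xoo]]; first by rewrite lee01 ltry.
by rewrite mule_ge0// lte_mul_pinfty// ge0_fin_numE.
Qed.

(** [prod_measure] is a bare set function, and one step of its recursion is a measure only once the
    tail is known to be a sigma-finite measure. Hence the induction carries the measure structure
    and recovers sigma-finiteness from boxes of finite measure at each step. *)
Lemma prod_measure_sigma_finite n (d : 'I_n -> measure_display)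
    (T : forall i, measurableType (d i))
    (mu : forall i, {sigma_finite_measure set (T i) -> \bar R}) :
  exists m : {sigma_finite_measure set (prod_type T) -> \bar R},
    (m : set (prod_type T) -> \bar R) = prod_measure mu.
Proof.
suff [m mE] : exists m : {measure set (prod_type T) -> \bar R},
    (m : set (prod_type T) -> \bar R) = prod_measure mu.
  have [F [mF Foo FT]] := box_exhaustion mu.
  have sf : sigma_finite setT m.
    exists (fun k => box (F k)) => [|k]; first exact/esym.
    split; first exact: measurable_box.
    rewrite mE prod_measure_box//; apply: lte_prod_pinfty => i //.
    exact: Foo.
  by exists (sigma_finite_measure_of sf).
elim: n => [|n IH] in d T mu *.
  by exists (dirac point : {measure set (prod_type T) -> \bar R}).
have [m mE] := IH _ _ (fun j => mu (lift ord0 j)).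
have [m' m'E] : exists m' : {sigma_finite_measure set (prod_type (fun j => T (lift ord0 j))) -> \bar R},
    (m' : set _ -> \bar R) = m.
  have [F [mF Foo FT]] := box_exhaustion (fun j => mu (lift ord0 j)).
  have sf : sigma_finite setT m.
    exists (fun k => box (F k)) => [|k]; first exact/esym.
    split; first exact: measurable_box.
    rewrite mE prod_measure_box//; apply: lte_prod_pinfty => i //.
    exact: Foo.
  by exists (sigma_finite_measure_of sf).
have mc := @measurable_prod_cons _ _ T.
exists (image_measure (mu ord0 \x m') mc).
rewrite /= -mE -m'E; reflexivity.
Qed.

Section ImageIntegral.
Context d d' (T : measurableType d) (T' : measurableType d').

Lemma ge0_integral_image (m : {measure set T -> \bar R})
    (m' : {measure set T' -> \bar R}) (f : T -> T') (g : T' -> \bar R) :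
  measurable_fun setT f -> (forall A, measurable A -> m' A = m (f @^-1` A)) ->
  measurable_fun setT g -> (forall y, 0 <= g y) ->
  \int[m']_y g y = \int[m]_x g (f x).
Proof.
move=> mf mE mg g0.
rewrite (eq_measure_integral (image_measure m mf)) => [|A mA _]; last exact: mE.
rewrite ge0_integral_pushforward// => y _; exact: g0.
Qed.

End ImageIntegral.

Section ProdMeasureTheory.
Context n (d : 'I_n -> measure_display) (T : forall i, measurableType (d i)).
Variable mu : forall i, {sigma_finite_measure set (T i) -> \bar R}.

(** Unlike the cylinders that define the sigma-algebra, boxes are stable under intersection, as
    uniqueness of measures requires. *)
Lemma measurable_boxes : @measurable _ (prod_type T) =
  <<s [set C | exists2 B : forall i, set (T i), (forall i, measurable (B i)) & C = box B] >>.
Proof.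
apply/seteqP; split.
  apply: smallest_sub; first exact: smallest_sigma_algebra.
  move=> _ [i [B [mB ->]]]; apply: sub_sigma_algebra.
  exists (dfwith (fun j => setT) i B) => [j|].
    by case: dfwithP.
  apply/seteqP; split=> x /= => [xB j|/(_ i)]; first by case: dfwithP.
  by rewrite dfwithin.
apply: smallest_sub; first exact: sigma_algebra_measurable.
by move=> _ [B mB ->]; exact: measurable_box.
Qed.

(** The tool by which image measures are identified below: the values on boxes suffice. *)
Lemma prod_measure_unique (m : {measure set (prod_type T) -> \bar R}) :
  (forall B, (forall i, measurable (B i)) ->
    m (box B) = \big[*%E/1%E]_i mu i (B i)) ->
  forall A, measurable A -> m A = prod_measure mu A.
Proof.
move=> mB A mA; have [p pE] := prod_measure_sigma_finite mu.
rewrite -pE.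
have [F [mF Foo FT]] := box_exhaustion mu.
apply: (measure_unique _ (fun k => box (F k)) measurable_boxes) => //.
- move=> _ _ [B mB' ->] [C mC ->]; exists (fun i => B i `&` C i).
    by move=> i; exact: measurableI.
  by apply/seteqP; split=> x => [[xB xC] i//|xBC]; split=> i; have [] := xBC i.
- by move=> k; exists (F k).
- by move=> _ [B mB' ->]; rewrite mB// -prod_measure_box// -pE.
- by move=> k; rewrite mB//; apply: lte_prod_pinfty.
Qed.

End ProdMeasureTheory.

Lemma prod_measure_image n (d d' : 'I_n -> measure_display)
    (T : forall i, measurableType (d i)) (T' : forall i, measurableType (d' i))
    (mu : forall i, {sigma_finite_measure set (T i) -> \bar R})
    (mu' : forall i, {sigma_finite_measure set (T' i) -> \bar R})
    (phi : forall i, T i -> T' i) :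
  (forall i, measurable_fun setT (phi i)) ->
  (forall i B, measurable B -> mu' i B = mu i (phi i @^-1` B)) ->
  forall A : set (prod_type T'), measurable A ->
  prod_measure mu' A =
  prod_measure mu ((fun (x : prod_type T) i => phi i (x i)) @^-1` A).
Proof.
move=> mphi muE A mA; have [p pE] := prod_measure_sigma_finite mu.
have mphi' : measurable_fun setT
    ((fun (x : prod_type T) i => phi i (x i)) : prod_type T -> prod_type T').
  apply: measurable_prodP => i.
  exact: measurable_comp_proj.
rewrite [RHS](_ : _ = image_measure p mphi' A); last by rewrite -pE.
apply/esym; apply: prod_measure_unique => // B mB.
transitivity (prod_measure mu (box (fun i => phi i @^-1` B i))).
  by rewrite -pE.
rewrite prod_measure_box => [|i].
  by apply: eq_bigr => i _; rewrite muE.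
by rewrite -[X in measurable X]setTI; exact: mphi.
Qed.

Lemma ge0_integral_prod n (d : 'I_n -> measure_display)
    (T : forall i, measurableType (d i))
    (mu : forall i, {sigma_finite_measure set (T i) -> \bar R})
    (g : forall i, T i -> \bar R) :
  (forall i, measurable_fun setT (g i)) -> (forall i x, 0 <= g i x) ->
  \int[prod_measure mu]_x \big[*%E/1%E]_i g i (x i) =
  \big[*%E/1%E]_i \int[mu i]_x g i x.
Proof.
elim: n => [|n IH] in d T mu g * => mg g0.
  under eq_integral do rewrite big_ord0.
  rewrite /= integral_dirac// ?big_ord0 ?diracT ?mul1e//.
have [p pE] := prod_measure_sigma_finite (fun j => mu (lift ord0 j)).
have mc := @measurable_prod_cons _ _ T.
have -> : prod_measure mu = image_measure (mu ord0 \x p) mc.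
  by rewrite /= -pE; reflexivity.
have mG m (d' : 'I_m -> measure_display) (T' : forall i, measurableType (d' i))
    (h : forall i, T' i -> \bar R) : (forall i, measurable_fun setT (h i)) ->
    measurable_fun setT (fun x : prod_type T' => \big[*%E/1%E]_i h i (x i)).
  move=> mh; apply: emeasurable_prod => i.
  exact: measurable_comp_proj.
rewrite ge0_integral_pushforward//; last 2 first.
- exact: mG.
- by move=> x _; apply: prode_ge0.
pose G (x : prod_type (fun j => T (lift ord0 j))) :=
  \big[*%E/1%E]_j g (lift ord0 j) (x j).
rewrite preimage_setT (eq_integral (fun z => g ord0 z.1 * G z.2)); last first.
  move=> x _; rewrite /= big_ord_recl prod_cons0; congr (_ * _).
  by apply: eq_bigr => i _; rewrite prod_consS.
have mGG : measurable_fun setT G.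
  exact: (mG _ _ _ (fun j => g (lift ord0 j))).
have G0 x : 0 <= G x by rewrite /G; apply: prode_ge0.
rewrite fubini_tonelli1; last 2 first.
- apply: emeasurable_funM.
    by apply: measurableT_comp; [exact: mg|exact: measurable_fst].
  by apply: measurableT_comp; [exact: mGG|exact: measurable_snd].
- by move=> x; rewrite mule_ge0.
rewrite /fubini_F /=; under eq_integral do rewrite ge0_integralZl//.
rewrite ge0_integralZr//; last by apply: integral_ge0.
rewrite big_ord_recl; congr (_ * _).
by rewrite -IH// -pE.
Qed.
End ProdMeasureStructure.

Definition density_measure d (T : measurableType d) (R : realType)
  (m : {measure set T -> \bar R}) (f : T -> R) (_ : measurable_fun setT f)
  (_ : forall x, 0 <= f x) : set T -> \bar R :=
  fun A => (\int[m]_(x in A) (f x)%:E)%E.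

Section DensityMeasure.
Context d (T : measurableType d) (R : realType).
Variables (m : {measure set T -> \bar R}) (f : T -> R).
Hypotheses (mf : measurable_fun setT f) (f0 : forall x, 0 <= f x).

Let density0 : density_measure m mf f0 set0 = 0%E.
Proof. by rewrite /density_measure integral_set0. Qed.

Let density_ge0 A : (0 <= density_measure m mf f0 A)%E.
Proof. by apply: integral_ge0 => x _; rewrite lee_fin. Qed.

Let density_sigma_additive : semi_sigma_additive (density_measure m mf f0).
Proof.
move=> F mF tF mUF; rewrite /density_measure ge0_integral_bigcup//=; last 2 first.
- by apply: measurable_funTS; exact/measurable_EFinP.
- by move=> x _; rewrite lee_fin.
by apply: is_cvg_ereal_nneg_natsum_cond => n _ _; exact: density_ge0.
Qed.

HB.instance Definition _ := isMeasure.Build _ _ _ (density_measure m mf f0)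
  density0 density_ge0 density_sigma_additive.

Lemma density_measureE A : measurable A ->
  density_measure m mf f0 A = (\int[m]_x (\1_A x * f x)%:E)%E.
Proof.
move=> mA; rewrite /density_measure integral_mkcond; apply: eq_integral => x _.
by rewrite patchE indicE; case: ifPn => _; rewrite ?mul1r ?mul0r.
Qed.

End DensityMeasure.

Definition prod_sfm (R : realType) n (d : 'I_n -> measure_display)
    (T : forall i, measurableType (d i))
    (mu : forall i, {sigma_finite_measure set (T i) -> \bar R}) :
    {sigma_finite_measure set (prod_type T) -> \bar R} :=
  sval (cid (prod_measure_sigma_finite mu)).

Lemma prod_sfmE (R : realType) n (d : 'I_n -> measure_display)
    (T : forall i, measurableType (d i))
    (mu : forall i, {sigma_finite_measure set (T i) -> \bar R}) :
  (prod_sfm mu : set (prod_type T) -> \bar R) = prod_measure mu.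
Proof. exact: svalP (cid (prod_measure_sigma_finite mu)). Qed.

Lemma EFin_prod (R : realType) (I : Type) (r : seq I) (f : I -> R) :
  (\prod_(i <- r) f i)%:E = (\big[*%E/1%E]_(i <- r) (f i)%:E)%E.
Proof. by elim/big_rec2: _ => // i x y _ <-. Qed.

(** * Changes of variables for Lebesgue measure *)

Section LebesgueLine.
Context {R : realType}.
Notation mu := (@lebesgue_measure R).

(** The image of Lebesgue measure, multiplied by $a$, gives half-open intervals their length, so
    uniqueness applies. *)
Lemma lebesgue_measure_affine (a b : R) (A : set R) : 0 < a -> measurable A ->
  mu A = (a%:E * mu ((fun x => a * x + b)%R @^-1` A))%E.
Proof.
move=> a0 mA.
have mf : measurable_fun setT ((fun x => a * x + b) : R -> measurableTypeR R).
  by apply: measurable_funD => //; exact: measurable_funM.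
have a0' : 0 <= a by exact: ltW.
pose m' : {measure set (measurableTypeR R) -> \bar R} := mscale (NngNum a0') (image_measure mu mf).
rewrite (_ : _ * _ = m' A)%E//.
apply: (@lebesgue_measure_unique R m') => // X [[u v] _ <-] /=.
rewrite /m' /mscale /= /image_measure /pushforward.
rewrite (_ : _ @^-1` _ = `](u - b) / a, (v - b) / a]%classic); last first.
  apply/seteqP; split=> x /=; rewrite !in_itv /= => /andP[xu xv]; apply/andP; split.
  - by rewrite ltr_pdivrMr// ltrBlDr mulrC.
  - by rewrite ler_pdivlMr// lerBrDr mulrC.
  - by rewrite -ltrBlDr mulrC -ltr_pdivrMr.
  - by rewrite -lerBrDr mulrC -ler_pdivlMr.
rewrite !lebesgue_measure_itv /= !lte_fin ltr_pM2r ?invr_gt0// ltrD2r.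
case: ifPn => _; last by rewrite mule0.
by rewrite -!EFinB -EFinM -mulrBl mulrCA divff ?gt_eqF// mulr1; congr EFin; lra.
Qed.

Lemma lebesgue_measure_shift (b : R) (A : set R) : measurable A ->
  mu A = mu ((fun x => x + b)%R @^-1` A).
Proof.
move=> mA; rewrite (@lebesgue_measure_affine 1 b)// mul1e.
by under [in LHS]eq_fun do rewrite mul1r.
Qed.

Lemma lebesgue_measure_reflect (b : R) (A : set R) : measurable A ->
  mu A = mu ((fun x => b - x)%R @^-1` A).
Proof.
move=> mA; rewrite -[LHS]lebesgue_measureN// /pushforward.
rewrite (@lebesgue_measure_shift (- b)).
  congr (mu _); apply/seteqP; split=> x /=; rewrite opprD opprK addrC //.
have mN : measurable_fun setT (fun x : R => - x) by exact: measurable_funN.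
by rewrite -[X in measurable X]setTI; exact: mN.
Qed.

End LebesgueLine.

Definition lebE (R : realType) K : {sigma_finite_measure set (euclidean R K) -> \bar R} :=
  prod_sfm (fun _ => @lebesgue_measure R).
Arguments lebE {R K}.

Section LebesgueEuclidean.
Context {R : realType} {K : nat}.
Notation E := (euclidean R K).
Implicit Types (A : set E) (v : E).
Local Open Scope ereal_scope.

Lemma lebEE : (lebE : set E -> \bar R) = lebesgue_euclidean.
Proof. by rewrite /lebE prod_sfmE. Qed.

Lemma measurable_coordE d (S : measurableType d) (f : S -> E) (i : 'I_K) :
  measurable_fun setT f -> measurable_fun setT (fun s => f s i : R).
Proof. exact: (@measurable_coord K _ (fun=> R)). Qed.

Lemma measurable_shiftE v : measurable_fun setT ((fun x i => x i + v i)%R : E -> E).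
Proof.
apply: measurable_prodP => i.
by apply: measurable_funD => //; exact: measurable_proj.
Qed.

Lemma measurable_reflectE v : measurable_fun setT ((fun x i => v i - x i)%R : E -> E).
Proof.
apply: measurable_prodP => i.
by apply: measurable_funB => //; exact: measurable_proj.
Qed.

Lemma lebE_shift v A : measurable A -> lebE A = lebE ((fun x i => x i + v i)%R @^-1` A).
Proof.
move=> mA; rewrite !lebEE.
apply: (@prod_measure_image R K _ _ _ _ (fun=> @lebesgue_measure R)
  (fun=> @lebesgue_measure R) (fun i x => x + v i)%R) => // [i|i B mB].
  exact: measurable_funD.
exact: lebesgue_measure_shift.
Qed.

Lemma lebE_reflect v A : measurable A -> lebE A = lebE ((fun x i => v i - x i)%R @^-1` A).
Proof.
move=> mA; rewrite !lebEE.
apply: (@prod_measure_image R K _ _ _ _ (fun=> @lebesgue_measure R)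
  (fun=> @lebesgue_measure R) (fun i x => v i - x)%R) => // [i|i B mB].
  exact: measurable_funB.
exact: lebesgue_measure_reflect.
Qed.

Lemma measurable_scaleE v : measurable_fun setT ((fun x i => v i * x i)%R : E -> E).
Proof.
apply: measurable_prodP => i.
by apply: measurable_funM => //; exact: measurable_proj.
Qed.

Lemma lebE_scale v A : (forall i, 0 < v i)%R -> measurable A ->
  lebE A = (\prod_i v i)%:E * lebE ((fun x i => v i * x i)%R @^-1` A).
Proof.
move=> v0 mA; rewrite {1}lebEE.
have p0 : (0 <= \prod_i v i)%R by apply: prodr_ge0 => i _; exact: ltW.
pose m : {measure set E -> \bar R} :=
  mscale (NngNum p0) (image_measure lebE (measurable_scaleE v)).
rewrite [RHS](_ : _ = m A)//; apply/esym.
apply: (@prod_measure_unique R K _ _ (fun=> @lebesgue_measure R) m) => // B mB.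
rewrite /= /m /mscale /= /image_measure /pushforward.
transitivity ((\prod_i v i)%:E * prod_measure (fun _ => @lebesgue_measure R)
    (box (fun i : 'I_K => ((fun x => v i * x) @^-1` B i)%R))).
  by rewrite -/(@lebesgue_euclidean R K) -lebEE.
rewrite prod_measure_box => [|i]; last first.
  have mM : measurable_fun setT (fun x : R => v i * x)%R by exact: measurable_funM.
  by rewrite -[X in measurable X]setTI; apply: mM => //; exact: mB.
rewrite EFin_prod -big_split /=; apply: eq_bigr => i _.
rewrite [RHS](@lebesgue_measure_affine _ (v i) 0)//; last exact: mB.
by under [in RHS]eq_fun do rewrite addr0.
Qed.

Lemma ge0_integral_shiftE v (f : E -> \bar R) : measurable_fun setT f ->
  (forall x, 0 <= f x) ->
  \int[lebE]_x f x = \int[lebE]_x f (fun i => x i + v i)%R.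
Proof.
move=> mf f0; apply: (ge0_integral_image (measurable_shiftE v)) => //.
by move=> A mA; exact: lebE_shift.
Qed.

Lemma ge0_integral_scaleE v (f : E -> \bar R) : (forall i, 0 < v i)%R ->
  measurable_fun setT f -> (forall x, 0 <= f x) ->
  \int[lebE]_x f x = (\prod_i v i)%:E * \int[lebE]_x f (fun i => v i * x i)%R.
Proof.
move=> v0 mf f0.
have p0 : (0 <= \prod_i v i)%R by apply: prodr_ge0 => i _; exact: ltW.
rewrite -[RHS](ge0_integral_mscale _ _ (NngNum p0))//; last first.
  exact: (measurableT_comp mf (measurable_scaleE v)).
apply: (ge0_integral_image (measurable_scaleE v)) => //.
by move=> A mA; exact: lebE_scale.
Qed.

End LebesgueEuclidean.

(** * The standard Gaussian measure *)

Lemma ge0_integral_lebE_prod (R : realType) K (g : 'I_K -> R -> \bar R) :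
  (forall i, measurable_fun setT (g i)) -> (forall i x, (0 <= g i x)%E) ->
  (\int[lebE]_(x in [set: euclidean R K]) \big[*%E/1]_i g i (x i) =
  \big[*%E/1]_i \int[@lebesgue_measure R]_x g i x)%E.
Proof.
move=> mg g0; rewrite -(@ge0_integral_prod R K _ _ (fun=> @lebesgue_measure R))//.
by rewrite -/(@lebesgue_euclidean R K) -lebEE.
Qed.

Section Gaussian.
Context {R : realType}.
Local Open Scope ereal_scope.

(** Variance $1/2$, so that a pair of coordinates has the density $e^{-|z|^2}/\pi$ of a standard
    complex Gaussian. *)
Definition gauss_density (x : R) : R := (gauss_fun x / Num.sqrt pi)%R.

Lemma gauss_density_ge0 x : (0 <= gauss_density x)%R.
Proof. by rewrite /gauss_density divr_ge0// gauss_fun_ge0. Qed.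

Lemma measurable_gauss_density : measurable_fun setT gauss_density.
Proof. by apply: measurable_funM => //; exact: measurable_gauss_fun. Qed.

Lemma integral_gauss_density : \int[@lebesgue_measure R]_x (gauss_density x)%:E = 1.
Proof.
under eq_integral do rewrite /gauss_density EFinM.
rewrite ge0_integralZr//.
- by rewrite integralT_gauss -EFinM divff// gt_eqF// sqrtr_gt0 pi_gt0.
- have mg : measurable_fun setT (fun x : R => (gauss_fun x)%:E).
    by apply/measurable_EFinP; exact: measurable_gauss_fun.
  exact: mg.
- by move=> x _; rewrite lee_fin gauss_fun_ge0.
Qed.

Definition gauss1 := density_measure (@lebesgue_measure R) measurable_gauss_density
  gauss_density_ge0.
HB.instance Definition _ := Measure.on gauss1.

Let gauss1T : gauss1 setT = 1.
Proof. exact: integral_gauss_density. Qed.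

HB.instance Definition _ := Measure_isProbability.Build _ _ R gauss1 gauss1T.

Section Flat.
Variable K : nat.
Notation E := (euclidean R K).

Definition gaussE : {sigma_finite_measure set E -> \bar R} :=
  prod_sfm (fun _ => gauss1).

Lemma gaussEE : (gaussE : set E -> \bar R) = prod_measure (fun=> gauss1).
Proof. by rewrite /gaussE prod_sfmE. Qed.

Lemma gaussE_box (B : 'I_K -> set R) : (forall i, measurable (B i)) ->
  gaussE (box B : set E) = \prod_i gauss1 (B i).
Proof. by move=> mB; rewrite gaussEE prod_measure_box. Qed.

Lemma gaussE_setT : gaussE setT = 1.
Proof.
rewrite (_ : setT = box (fun=> setT) :> set E); last by apply/seteqP; split.
by rewrite gaussE_box// big1// => i _; exact: probability_setT.
Qed.

Definition densE (x : E) : R := \prod_i gauss_density (x i).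

Lemma densE_ge0 x : (0 <= densE x)%R.
Proof. by apply: prodr_ge0 => i _; exact: gauss_density_ge0. Qed.

Lemma measurable_densE : measurable_fun setT densE.
Proof.
apply: measurable_prod => i _.
by apply: measurableT_comp; [exact: measurable_gauss_density|exact: measurable_proj].
Qed.

Lemma densE_expR x : densE x = (Num.sqrt pi ^- K * expR (- \sum_i x i ^+ 2))%R.
Proof.
rewrite /densE /gauss_density big_split /= prodr_const card_ord mulrC; congr (_ * _)%R.
  by rewrite exprVn.
by rewrite -sumrN expR_sum.
Qed.

Lemma gaussE_dens (A : set E) : measurable A ->
  gaussE A = \int[lebE]_x (\1_A x * densE x)%:E.
Proof.
move=> mA; rewrite -(density_measureE _ measurable_densE densE_ge0)// gaussEE.
apply/esym.
apply: (@prod_measure_unique R K _ _ (fun=> gauss1)) => // B mB.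
rewrite [LHS](_ : _ = density_measure lebE measurable_densE densE_ge0 (box B))//.
rewrite density_measureE; last exact: measurable_box.
rewrite (eq_integral (fun x : E => \prod_i (\1_(B i) (x i) * gauss_density (x i))%:E)); last first.
  move=> x _; rewrite /densE -EFin_prod [in RHS]big_split /=; congr EFin; congr (_ * _)%R.
  rewrite indicE; have [xB|xB] := boolP (x \in box B).
    rewrite big1// => i _; rewrite indicE mem_set//.
    by move/set_mem : xB; exact.
  apply/eqP; rewrite eq_sym prodf_seq_eq0; apply: contraR xB => /hasPn xB.
  apply/mem_set => i; have := xB i (mem_index_enum _) => /=.
  by rewrite indicE; case: (boolP (x i \in B i)) => [/set_mem//|_]; rewrite eqxx.
rewrite (ge0_integral_lebE_prod (g := fun i x => (\1_(B i) x * gauss_density x)%:E)).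
- apply: eq_bigr => i _; 
  by rewrite /gauss1 [RHS]density_measureE; [exact: eq_integral|exact: mB].
- move=> i; apply/measurable_EFinP; apply: measurable_funM.
    by apply: measurable_indic; exact: mB.
  exact: measurable_gauss_density.
- by move=> i x; rewrite lee_fin mulr_ge0// gauss_density_ge0.
Qed.

Lemma integral_densE : \int[lebE]_x (densE x)%:E = 1.
Proof.
rewrite -gaussE_setT gaussE_dens//; apply: eq_integral => x _.
by rewrite indicT mul1r.
Qed.

End Flat.
Arguments gaussE {K}.

Section Orthogonal.
Variable K : nat.
Notation E := (euclidean R K).
Variables (O O' : E -> E).
Hypotheses (OD : forall x y i, O (fun j => x j + y j)%R i = (O x i + O y i)%R)
  (OK : cancel O' O) (mO : measurable_fun setT O)
  (Onorm : forall x, (\sum_i O x i ^+ 2 = \sum_i x i ^+ 2)%R).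

Let nu := image_measure lebE mO.

Let nuE A : nu A = lebE (O @^-1` A).
Proof. by []. Qed.

Lemma densE_orthogonal x : densE (O x) = densE x.
Proof. by rewrite !densE_expR Onorm. Qed.

Let nu_shift v A : measurable A -> nu A = nu ((fun x i => x i + v i)%R @^-1` A).
Proof.
move=> mA; rewrite !nuE (lebE_shift (O' v)); last first.
  by rewrite -[X in measurable X]setTI; exact: mO.
congr (lebE _); apply/seteqP.
have E1 x : O (fun i => x i + O' v i)%R = (fun i => O x i + v i)%R.
  by apply/funext => i; rewrite OD OK.
by split=> x /=; rewrite E1.
Qed.

(** Balls centred at the origin are their own preimages under [O] and sit in cubes, hence have
    finite measure. Tonelli for [nu] depends on this. *)
Let nu_sigma_finite : sigma_finite setT nu.
Proof.
pose B k := [set x : E | \sum_i x i ^+ 2 <= k%:R]%R.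
have mB k : measurable (B k).
  rewrite -[X in measurable X]setTI.
  have mf : measurable_fun setT (fun x : E => \sum_i x i ^+ 2)%R.
    apply: measurable_sum => i; apply: measurable_funX; exact: measurable_proj.
  rewrite (_ : B k = (fun x : E => \sum_i x i ^+ 2)%R @^-1` `]-oo, k%:R]%classic).
    exact: mf.
  by apply/seteqP; split=> x; rewrite /B /= in_itv.
exists B.
  apply/seteqP; split=> // x _.
  exists (Num.truncn (\sum_i x i ^+ 2)%R).+1 => //; rewrite /B /=.
  by apply/ltW; rewrite truncnS_gt.
move=> k; split=> //; rewrite nuE.
rewrite (_ : O @^-1` B k = B k); last by apply/seteqP; split=> x; rewrite /B /= Onorm.
pose c : set R := `[(- k%:R)%R, k%:R%R]%classic.
pose C : set E := box (fun=> c).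
have : lebE (B k) <= lebE C.
  apply: le_measure; rewrite ?inE//; first by apply: measurable_box => i; exact: measurable_itv.
  move=> x xk i; rewrite /c /= in_itv /= -ler_norml.
  have xik : (x i ^+ 2 <= k%:R)%R.
    apply: le_trans xk; rewrite (bigD1 i)//= lerDl sumr_ge0// => j _.
    exact: sqr_ge0.
  clear C c; case: k xk xik => [|k] xk xik.
    have : (x i ^+ 2 == 0)%R by rewrite eq_le xik sqr_ge0.
    by rewrite sqrf_eq0 => /eqP ->; rewrite normr0.
  rewrite -(@ler_pXn2r _ 2)// ?nnegrE// real_normK ?num_real// (le_trans xik)//.
  by rewrite -natrX ler_nat expnS expn1 leq_pmulr.
move/le_lt_trans; apply.
rewrite lebEE /lebesgue_euclidean prod_measure_box => [|i]; last exact: measurable_itv.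
apply: lte_prod_pinfty => i //; rewrite [X in X < _](lebesgue_measure_itv `[(- k%:R)%R, k%:R%R])/=.
by case: ifP => _; rewrite ltry.
Qed.

Let nus := sigma_finite_measure_of nu_sigma_finite.

(** No determinant is involved. With $\nu$ the image of Lebesgue measure and $g$ the Gaussian
    density, $\iint 1_A(x) g(x+y)\,d\nu(x)\,dy$ equals $\nu(A)$ when $y$ is integrated first.
    Translation invariance of $\nu$ rewrites it as $\iint 1_A(x-y) g(x)\,d\nu(x)\,dy$, which is the
    Lebesgue measure of $A$ times $\int g\,d\nu$, and the last integral is 1 because [O] preserves
    the norm. *)
Lemma lebE_orthogonal A : measurable A -> lebE (O @^-1` A) = lebE A.
Proof.
move=> mA; rewrite -nuE.
have mdens := @measurable_densE K.
have mA1 : measurable_fun setT (\1_A : E -> R) by exact: measurable_indic.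
have dens0 := @densE_ge0 K.
pose f (z : E * E) := (\1_A z.1 * densE (fun i => z.2 i + z.1 i)%R)%:E.
have mpl : measurable_fun setT ((fun z : E * E => fun i => z.2 i + z.1 i)%R : E * E -> E).
  apply: measurable_prodP => i; apply: measurable_funD.
    exact: (measurable_coordE (f := snd) i measurable_snd).
  exact: (measurable_coordE (f := fst) i measurable_fst).
have mf : measurable_fun setT f.
  apply/measurable_EFinP; apply: measurable_funM.
    by apply: measurableT_comp; [exact: measurable_indic|exact: measurable_fst].
  exact: (measurableT_comp mdens mpl).
have f0 z : 0 <= f z by rewrite lee_fin mulr_ge0.
have := fubini_tonelli (m1 := nus) (m2 := lebE) f mf f0.
rewrite /fubini_F /fubini_G /=.
under eq_integral => x _.
  under eq_integral do rewrite /f /= EFinM.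
  rewrite ge0_integralZl//; last 2 first.
  - by apply/measurable_EFinP; exact: (measurableT_comp mdens (measurable_shiftE x)).
  - by move=> y _; rewrite lee_fin.
  rewrite -(ge0_integral_shiftE x (f := fun y => (densE y)%:E))//; last exact/measurable_EFinP.
  rewrite integral_densE mule1; over.
rewrite integral_indic// setIT => H; apply: (etrans H).
transitivity (\int[lebE]_y \int[nus]_x (\1_A (fun i => x i - y i) * densE x)%:E).
  apply: eq_integral => y _.
  rewrite (ge0_integral_image (m := nus) (m' := nus) (measurable_shiftE y)
    (g := fun x => (\1_A (fun i => x i - y i)%R * densE x)%:E))//.
  - apply: eq_integral => x _; rewrite /f /=; congr EFin; congr (_ * _)%R.
      by congr (\1_A _); apply: funext => i; rewrite addrK.
    by congr densE; apply: funext => i; rewrite addrC.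
  - exact: nu_shift.
  - apply/measurable_EFinP; apply: measurable_funM => //.
    exact: (measurableT_comp mA1 (measurable_shiftE (fun i => - y i)%R)).
  - by move=> x; rewrite lee_fin mulr_ge0.
pose g (z : E * E) := (\1_A (fun i => z.1 i - z.2 i)%R * densE z.1)%:E.
have mmi : measurable_fun setT ((fun z : E * E => fun i => z.1 i - z.2 i)%R : E * E -> E).
  apply: measurable_prodP => i; apply: measurable_funB.
    exact: (measurable_coordE (f := fst) i measurable_fst).
  exact: (measurable_coordE (f := snd) i measurable_snd).
have mg : measurable_fun setT g.
  apply/measurable_EFinP; apply: measurable_funM.
    exact: (measurableT_comp mA1 mmi).
  exact: (measurableT_comp mdens measurable_fst).
have g0 z : 0 <= g z by rewrite lee_fin mulr_ge0.
rewrite -(fubini_tonelli (m1 := nus) (m2 := lebE) g mg g0) /fubini_F /=.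
transitivity (\int[nus]_x (lebE A * (densE x)%:E)).
  apply: eq_integral => x _; under eq_integral do rewrite /g /= EFinM.
  have mr := measurable_reflectE x.
  rewrite ge0_integralZr//; last 2 first.
  - by apply/measurable_EFinP; exact: (measurableT_comp mA1 mr).
  - by rewrite lee_fin.
  congr (_ * _); rewrite [RHS](lebE_reflect x)//.
  have mAr : measurable ((fun z i => x i - z i)%R @^-1` A : set E).
    by rewrite -[X in measurable X]setTI; exact: mr.
  by rewrite -[X in lebE X]setIT -integral_indic.
rewrite ge0_integralZl//; last 2 first.
- exact/measurable_EFinP.
- by move=> x _; rewrite lee_fin.
rewrite (ge0_integral_image (m := lebE) (m' := nus) mO (g := fun x => (densE x)%:E))//.
- by under eq_integral do rewrite densE_orthogonal; rewrite integral_densE mule1.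
- exact/measurable_EFinP.
Qed.

Lemma gaussE_orthogonal (A : set E) : measurable A -> gaussE (O @^-1` A) = gaussE A.
Proof.
move=> mA.
have mOA : measurable (O @^-1` A) by rewrite -[X in measurable X]setTI; exact: mO.
rewrite !gaussE_dens//.
rewrite [RHS](ge0_integral_image (m := lebE) (m' := lebE) mO).
- by apply: eq_integral => x _; rewrite densE_orthogonal.
- by move=> B mB; apply/esym/lebE_orthogonal.
- apply/measurable_EFinP; apply: measurable_funM => //; exact: measurable_densE.
- by move=> y; rewrite lee_fin mulr_ge0// densE_ge0.
Qed.

End Orthogonal.
End Gaussian.

(** * Counting the points of a subset of the unit cube *)

Lemma continuous_bigsum (T : topologicalType) (R : realType) (I : Type) (r : seq I)
    (f : I -> T -> R) : (forall i, continuous (f i)) ->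
  continuous (fun t => \sum_(i <- r) f i t).
Proof.
move=> cf t; elim: r => [|i r IH].
  by under eq_fun do rewrite big_nil; exact: cvg_cst.
under eq_fun do rewrite big_cons.
by apply: cvgD => //; exact: cf.
Qed.

(** Clamping fixes [t] and does not increase the distance to it. *)
Lemma clamp_near (R : realType) (a b t e q : R) : 0 < e -> a <= t <= b ->
  t - e < q < t + e -> `|t - Num.max a (Num.min b q)| < e.
Proof.
move=> e0 /andP[at_ tb] /andP[tq qt]; rewrite ltr_norml.
by case: (leP b q) => h1; [case: (leP a b)|case: (leP a q)] => h2; apply/andP; split; lra.
Qed.

Section ZeroEvent.
Context {R : realType} {N J : nat} d (P : measurableType d).
Variable F : P -> 'rV[R]_N -> 'I_J -> R.
Hypotheses (mF : forall t j, measurable_fun setT (fun p => F p t j))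
  (cF : forall p j, continuous (fun t => F p t j)).

Let g p t := \sum_j `|F p t j|.

Let mg t : measurable_fun setT (fun p => g p t).
Proof.
by apply: measurable_sum => j; apply: measurableT_comp => //; exact: mF.
Qed.

Let cg p : continuous (g p).
Proof.
apply: continuous_bigsum => j t.
exact: (continuous_comp (f := fun t => F p t j) (@cF p j t) (@norm_continuous _ _ _)).
Qed.

Let g0 p t : (g p t = 0) <-> (forall j, F p t j = 0).
Proof.
split=> [/eqP|F0]; last by rewrite /g big1// => j _; rewrite F0 normr0.
rewrite psumr_eq0// => /allP h j; apply/eqP; rewrite -normr_eq0.
exact: h (mem_index_enum _).
Qed.

(* By compactness the zero set meets a closed box iff the function is
   arbitrarily small on the countable set of its clamped rational points. *)
Lemma measurable_zero_closed (a b : 'I_N -> R) : measurable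
  [set p | exists t : 'rV[R]_N, (forall j, a j <= t 0 j <= b j) /\ forall j, F p t j = 0].
Proof.
have [ab|/existsNP[j0 ab]] := pselect (forall j, a j <= b j); last first.
  rewrite (_ : mkset _ = set0)//; apply/seteqP; split=> // p [t [tab _]].
  by apply: ab; have /andP[] := tab j0; exact: le_trans.
pose clamp (q : 'rV[rat]_N) : 'rV[R]_N :=
  \row_j Num.max (a j) (Num.min (b j) (ratr (q 0 j))).
have clampP q j : a j <= clamp q 0 j <= b j.
  by rewrite mxE le_max lexx /= ge_max ab ge_min lexx.
rewrite (_ : mkset _ = \bigcap_(m : nat) \bigcup_(q : 'rV[rat]_N)
    [set p | g p (clamp q) < m.+1%:R^-1]); last first.
  apply/seteqP; split=> p.
    move=> [t [tab /g0 gt0]] m _.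
    have m0 : 0 < m.+1%:R^-1 :> R by rewrite invr_gt0.
    have /cvgrPdist_lt/(_ _ m0)/nbhs_ballP[e /= e0 be] := @cg p t.
    have /choice[q qP] : forall j, exists q : rat, ratr q \in `]t 0 j - e, t 0 j + e[.
      by move=> j; apply: rat_in_itvoo; rewrite ltrBlDr -addrA ltrDl addr_gt0.
    exists (\row_j q j) => //=.
    suff /be : ball t e (clamp (\row_j q j)).
      by rewrite gt0 sub0r normrN; apply: le_lt_trans; exact: ler_norm.
    split=> // i j; rewrite ord1 !mxE /ball /=.
    by apply: clamp_near => //; have := qP j; rewrite in_itv.
  move=> pS; have [t tab tmin] : exists2 t : 'rV[R]_N,
      t \in [set v : 'rV[R]_N | forall j, `[a j, b j]%classic (v ord0 j)]
      & forall t', t' \in [set v : 'rV[R]_N | forall j, `[a j, b j]%classic (v ord0 j)] -> g p t <= g p t'.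
    apply: EVT_min_rV.
    - by exists (clamp 0) => j /=; rewrite in_itv /=; exact: clampP.
    - by apply: (@rV_compact R N (fun j => `[a j, b j]%classic)) => j; exact: segment_compact.
    - by apply: continuous_subspaceT; exact: cg.
  exists t; split.
    by move=> j; move/set_mem : tab => /(_ j) /=; rewrite in_itv.
  apply/g0/eqP; rewrite eq_le sumr_ge0// andbT leNgt; apply/negP => gt0.
  (* With this index $1/(m+1)$ is at most the positive minimum [g p t]. *)
  have [q _ /=] := pS (Num.truncn (g p t)^-1) I; apply/negP; rewrite -leNgt.
  apply: (@le_trans _ _ (g p t)).
    rewrite -[leRHS]invrK lef_pV2 ?posrE ?invr_gt0//.
    by apply/ltW; rewrite truncnS_gt.
  by apply: tmin; apply/mem_set => j /=; rewrite in_itv /=; exact: clampP.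
apply: bigcapT_measurable => m; apply: countable_bigcupT_measurable.
  exact: countableP.
move=> q; have := @mg (clamp q) measurableT `]-oo, m.+1%:R^-1[%classic (measurable_itv _).
by rewrite setTI; congr measurable; apply/seteqP; split=> p /=; rewrite in_itv.
Qed.

(** The half-open cell is the union of the closed boxes $\prod_j [a_j, b_j - 1/(m+1)]$; a point
    belongs to one of them because finitely many gaps $b_j - t_j$ have a positive lower bound. *)
Lemma measurable_zero_cell (a b : 'I_N -> R) : measurable
  [set p | exists t : 'rV[R]_N, (forall j, a j <= t 0 j < b j) /\ forall j, F p t j = 0].
Proof.
rewrite (_ : mkset _ = \bigcup_m [set p | exists t : 'rV[R]_N,
    (forall j, a j <= t 0 j <= b j - m.+1%:R^-1) /\ forall j, F p t j = 0]).
  by apply: bigcupT_measurable => m; exact: measurable_zero_closed.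
apply/seteqP; split=> p.
  move=> [t [tab tF]]; pose k j := Num.truncn (b j - t 0 j)^-1.
  exists (\max_j k j)%N => //; exists t; split=> // j.
  have /andP[at_ tb] := tab j; rewrite at_ /= lerBrDl -lerBrDr.
  rewrite -[leRHS]invrK lef_pV2 ?posrE ?invr_gt0 ?subr_gt0//.
  apply/ltW; apply: (lt_le_trans (truncnS_gt _)); rewrite ler_nat ltnS.
  exact: (leq_bigmax (F := k)).
move=> [m _ [t [tab tF]]]; exists t; split=> // j.
have /andP[-> /le_lt_trans] := tab j; apply.
by rewrite ltrBlDr ltrDl invr_gt0.
Qed.

End ZeroEvent.

Section Cells.
Context {R : realType} {N : nat}.
Implicit Types (t : 'rV[R]_N) (Z : set 'rV[R]_N).

(** The bound equals $2^k$; its successor form lets [inord] apply. *)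
Definition cell_type k := {ffun 'I_N -> 'I_(2 ^ k).-1.+1}.

Definition cell k (c : cell_type k) : set 'rV[R]_N :=
  [set t | forall j, (c j)%:R / 2 ^+ k <= t 0 j < (c j).+1%:R / 2 ^+ k].

Definition cell_index k t : cell_type k :=
  [ffun j => inord (Num.truncn (2 ^+ k * t 0 j))].

Definition unit_cube : set 'rV[R]_N := [set t | forall j, 0 <= t 0 j < 1].

Lemma cell_indexE k t j : unit_cube t ->
  cell_index k t j = Num.truncn (2 ^+ k * t 0 j) :> nat.
Proof.
move=> /(_ j)/andP[t0 t1]; rewrite ffunE inordK// prednK ?expn_gt0//.
rewrite -(ltr_nat R) natrX (@le_lt_trans _ _ (2 ^+ k * t 0 j))//.
  by rewrite truncn_le mulr_ge0.
by rewrite gtr_pMr// exprn_gt0.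
Qed.

Lemma cell_indexP k t c : unit_cube t -> cell c t <-> cell_index k t = c.
Proof.
move=> tu; have k0 : 0 < 2 ^+ k :> R by rewrite exprn_gt0.
have t0 j : 0 <= 2 ^+ k * t 0 j by rewrite mulr_ge0//; have /andP[] := tu j.
split=> [tc|<- j].
  apply/ffunP => j; apply: ord_inj; rewrite cell_indexE//.
  apply: truncn_def; have /andP[h1 h2] := tc j.
  by rewrite mulrC -ler_pdivrMr// h1 -ltr_pdivlMr.
rewrite cell_indexE//; have /andP[h1 h2] := truncn_itv (t0 j).
by rewrite ler_pdivrMr// ltr_pdivlMr// [t 0 j * _]mulrC h1 h2.
Qed.

Lemma cell_sub k (c : cell_type k) t : cell c t -> unit_cube t.
Proof.
have k0 : 0 < 2 ^+ k :> R by rewrite exprn_gt0.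
move=> tc j; have /andP[h1 h2] := tc j; rewrite (le_trans _ h1) ?divr_ge0//=.
apply: (lt_le_trans h2); rewrite ler_pdivrMr// mul1r -natrX ler_nat.
by rewrite -[X in (_ <= X)%N](@prednK (2 ^ k)) ?expn_gt0//.
Qed.

Definition occupied k Z : {set cell_type k} :=
  [set c | `[< exists2 t, Z t & cell_index k t = c >]].

Let truncn_double (x : R) : 0 <= x -> (Num.truncn (2 * x))./2 = Num.truncn x.
Proof.
move=> x0; have /andP[h1 h2] := truncn_itv x0.
have x20 : 0 <= 2 * x by rewrite mulr_ge0.
have /andP[h3 h4] := truncn_itv x20.
set m := Num.truncn x in h1 h2 *; set m2 := Num.truncn (2 * x) in h3 h4 *.
have : (m.*2 < m2.+1)%N.
  by rewrite -(ltr_nat R) -muln2 natrM; apply: le_lt_trans h4; lra.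
have : (m2 < m.+1.*2)%N.
  by rewrite -(ltr_nat R) -muln2 natrM; apply: le_lt_trans h3 _; lra.
lia.
Qed.

(** Halving the indices maps the occupied cells of level $k+1$ onto those of level $k$. *)
Lemma card_occupiedS k Z : Z `<=` unit_cube ->
  (#|occupied k Z| <= #|occupied k.+1 Z|)%N.
Proof.
move=> Zu.
pose f (c : cell_type k.+1) : cell_type k := [ffun j => inord (c j)./2].
suff -> : occupied k Z = f @: occupied k.+1 Z.
  exact: leq_imset_card.
have fE t : Z t -> f (cell_index k.+1 t) = cell_index k t.
  move=> Zt; apply/ffunP => j; rewrite !ffunE; congr inord.
  rewrite -[X in X./2]/(nat_of_ord _) inordK; last first.
    by have := ltn_ord (cell_index k.+1 t j); rewrite cell_indexE//; exact: Zu.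
  rewrite exprS -mulrA truncn_double// mulr_ge0//.
  by have /andP[] := Zu _ Zt j.
apply/setP => c; rewrite inE; apply/asboolP/imsetP => [[t Zt <-]|[c' + ->]].
  by exists (cell_index k.+1 t); rewrite ?fE// inE; apply/asboolP; exists t.
by rewrite inE => /asboolP[t Zt <-]; exists t => //; rewrite fE.
Qed.

(** Points of one cell differ by at most its side in each coordinate, so a side $2^{-k}$ smaller
    than the gap in one coordinate separates them. *)
Lemma cell_index_inj t t' : t != t' -> exists k0, forall k, (k0 <= k)%N ->
  unit_cube t -> unit_cube t' -> cell_index k t != cell_index k t'.
Proof.
move=> tt'; have [j tj] : exists j, t 0 j != t' 0 j.
  apply: contrapT => /forallNP h; move/eqP : tt'; apply; apply/rowP => j.
  by have := h j; move/negP; rewrite negbK => /eqP.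
have e0 : 0 < `|t 0 j - t' 0 j| by rewrite normr_gt0 subr_eq0.
exists (Num.truncn `|t 0 j - t' 0 j|^-1).+1 => k kk tu t'u.
apply/eqP => E; have k0 : 0 < 2 ^+ k :> R by rewrite exprn_gt0.
have : `|t 0 j - t' 0 j|^-1 < 2 ^+ k.
  apply: (lt_le_trans (truncnS_gt _)); rewrite -natrX ler_nat.
  by rewrite (leq_trans kk)// ltnW// ltn_expl.
rewrite -[X in _ < X]invrK ltf_pV2 ?posrE ?invr_gt0//; apply/negP; rewrite -leNgt.
have /cell_indexP/(_ j) := erefl (cell_index k t); move=> /(_ tu)/andP[a1 a2].
have /cell_indexP/(_ j) := esym E; move=> /(_ t'u)/andP[b1 b2].
rewrite -[(cell_index k t j).+1%:R]natr1 mulrDl mul1r in a2 b2.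
by rewrite ler_norml; apply/andP; split; lra.
Qed.

Lemma card_occupied_ge (B : {fset 'rV[R]_N}) Z : Z `<=` unit_cube ->
  [set` B] `<=` Z -> exists k0, forall k, (k0 <= k)%N ->
  (#|` B| <= #|occupied k Z|)%N.
Proof.
move=> Zu BZ.
have /choice[K KP] : forall p : 'rV[R]_N * 'rV[R]_N, exists k0, p.1 != p.2 ->
    forall k, (k0 <= k)%N -> unit_cube p.1 -> unit_cube p.2 ->
    cell_index k p.1 != cell_index k p.2.
  move=> [t t']; have [->|/cell_index_inj[k0 k0P]] := eqVneq t t'.
    by exists 0%N.
  by exists k0.
exists (\max_(t <- B) \max_(t' <- B) K (t, t'))%N => k kk.
have inj : {in B &, injective (cell_index k)}.
  move=> t t' tB t'B; apply: contra_eq => tt'.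
  apply: (KP (t, t')) => //=; [|exact/Zu/BZ|exact/Zu/BZ].
  apply: leq_trans kk.
  apply: (@leq_trans (\max_(t' <- B) K (t, t'))%N).
    exact: (leq_bigmax_seq (F := fun t' => K (t, t'))).
  exact: (leq_bigmax_seq (F := fun t => \max_(t' <- B) K (t, t'))%N).
rewrite -(size_map (cell_index k)) -(card_uniqP _); last first.
  by rewrite map_inj_in_uniq ?fset_uniq.
apply/subset_leq_card/fintype.subsetP => c /mapP[t tB ->].
by rewrite inE; apply/asboolP; exists t => //; exact: BZ.
Qed.

Lemma card_occupied_le Z k : finite_set Z -> (#|occupied k Z| <= #|` fset_set Z|)%N.
Proof.
move=> Zf; rewrite -(size_map (cell_index k)).
apply: (@leq_trans #|[seq cell_index k i | i <- fset_set Z]|); last exact: card_size.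
apply/subset_leq_card/fintype.subsetP => c.
rewrite inE => /asboolP[t Zt <-]; apply: map_f.
by rewrite in_fset_set// inE.
Qed.

(** Each occupied cell contains a point, and every finite subset is eventually separated. For
    infinite [Z] the second fact, applied to arbitrarily large finite subsets, makes the limit
    infinite. *)
Lemma counting_occupied Z : Z `<=` unit_cube ->
  counting Z = limn (fun k => #|occupied k Z|%:R%:E : \bar R).
Proof.
move=> Zu; pose u k : \bar R := #|occupied k Z|%:R%:E.
have ndu : nondecreasing_seq u.
  by apply/nondecreasing_seqP => k; rewrite lee_fin ler_nat card_occupiedS.
have cu : cvgn u by exact: ereal_nondecreasing_is_cvgn.
have lb (B : {fset 'rV[R]_N}) : [set` B] `<=` Z -> (#|` B|%:R%:E <= limn u)%E.
  move=> /(card_occupied_ge Zu)[k0 k0P]; apply: lime_ge => //.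
  by exists k0 => // k /= kk; rewrite lee_fin ler_nat k0P.
rewrite /counting; case: asboolP => [Zf|Zi].
  apply/eqP; rewrite eq_le lb//=; last by rewrite fset_setK.
  by apply: lime_le => //; apply: nearW => k; rewrite lee_fin ler_nat card_occupied_le.
apply/esym/eqyP => A A0; have [B BZ BA] := infinite_set_fset (Num.truncn A).+1 Zi.
apply: le_trans (lb B BZ); rewrite lee_fin.
by apply: (le_trans (ltW (truncnS_gt A))); rewrite ler_nat.
Qed.

End Cells.

(** * Null sets detected by translation along a curve *)

Section NullCurve.
Context {R : realType} {K : nat}.
Notation E := (euclidean R K).
Local Open Scope ereal_scope.

(** Tonelli on $[0,1]\times E$ for the indicator of $x + c(t) \in S$: for fixed $t$ the slice has
    the measure of $S$, for fixed $x$ it is countable and thus null. *)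
Lemma lebE_null_curve (S : set E) (c : R -> E) :
  measurable S -> measurable_fun setT c ->
  (forall x : E, countable [set t | S (fun i => x i + c t i)%R]) -> lebE S = 0.
Proof.
move=> mS mc cS.
pose I01 : set R := `[0%R, 1%R]%classic.
pose f (z : R * E) : \bar R := (\1_I01 z.1 * \1_S (fun i => z.2 i + c z.1 i)%R)%:E.
have mS1 : measurable_fun setT (\1_S : E -> R) by exact: measurable_indic.
have mpl : measurable_fun setT ((fun z : R * E => fun i => z.2 i + c z.1 i)%R : R * E -> E).
  apply: measurable_prodP => i; apply: measurable_funD.
    exact: (measurable_coordE (f := snd) i measurable_snd).
  have m1 : measurable_fun setT (fun z : R * E => c z.1).
    exact: (measurableT_comp mc measurable_fst).
  exact: (measurable_coordE i m1).
have mf : measurable_fun setT f.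
  apply/measurable_EFinP; apply: measurable_funM.
    have mI : measurable_fun setT (\1_I01 : R -> R) by apply: measurable_indic; exact: measurable_itv.
    exact: (measurableT_comp mI measurable_fst).
  exact: (measurableT_comp mS1 mpl).
have f0 z : 0 <= f z by rewrite lee_fin mulr_ge0.
have := fubini_tonelli (m1 := @lebesgue_measure R) (m2 := lebE) f mf f0.
rewrite /fubini_F /fubini_G /=.
rewrite [X in _ = X](_ : _ = 0); last first.
  apply: integral0_eq => x _; apply/eqP; rewrite eq_le integral_ge0// andbT.
  have <- := countable_lebesgue_measure0 (cS x).
  have mSx : measurable [set t | S (fun i => x i + c t i)%R].
    have mx : measurable_fun setT ((fun t i => x i + c t i)%R : R -> E).
      apply: measurable_prodP => i; apply: measurable_funD => //.
      exact: (measurable_coordE i mc).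
    have := mx measurableT S mS; by rewrite setTI.
  rewrite -[X in _ <= _ X]setIT -integral_indic//.
  apply: ge0_le_integral => //.
  - have mfx : measurable_fun setT (fun t : R => f (t, x)).
      exact: (measurableT_comp mf (measurable_pair2 x)).
    exact: mfx.
  - have mi : measurable_fun setT
        (fun t : R => (\1_[set t | S (fun i => x i + c t i)%R] t)%:E : \bar R).
      by apply/measurable_EFinP; exact: measurable_indic.
    exact: mi.
  - by move=> t _; rewrite /f lee_fin indicE /= ler_piMl// lern1 leq_b1.
rewrite (eq_integral (fun t : measurableTypeR R => lebE S * (\1_I01 t)%:E)); last first.
  move=> t _; rewrite /f; under eq_integral do rewrite /= EFinM.
  rewrite ge0_integralZl//; last first.
    by apply/measurable_EFinP; exact: (measurableT_comp mS1 (measurable_shiftE (c t))).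
  rewrite muleC; congr (_ * _); rewrite [RHS](lebE_shift (c t))//.
  have mSt : measurable ((fun z i => z i + c t i)%R @^-1` S : set E).
    by rewrite -[X in measurable X]setTI; exact: measurable_shiftE.
  by rewrite -[X in lebE X]setIT -integral_indic.
rewrite ge0_integralZl//; last first.
  by apply/measurable_EFinP; apply: measurable_indic; exact: measurable_itv.
rewrite integral_indic ?setIT//; last exact: measurable_itv.
by rewrite [X in _ * X](lebesgue_measure_itv `[0%R, 1%R])/= lte_fin ltr01 oppr0 adde0 mule1.
Qed.

End NullCurve.

(** * Stability of zeros of affine maps under perturbation *)

HB.instance Definition _ (R : realType) m n :=
  Complete.copy 'M[R]_(m, n) 'M[R]_(m, n).

Section RowNorm.
Context {R : realType} {N : nat}.
Implicit Types (v t : 'rV[R]_N).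

Lemma rV_norm_le v (r : R) : 0 <= r -> (forall j, `|v 0 j| <= r) -> `|v| <= r.
Proof.
move=> r0 vr; rewrite /normr /= mx_normrE; apply/bigmax_leP; split=> // -[i j] _ /=.
by rewrite ord1.
Qed.

Lemma rV_norm_coord v j : `|v 0 j| <= `|v|.
Proof.
rewrite [leRHS]/normr /= mx_normrE.
by apply: (le_trans _ (le_bigmax _ _ (0, j))).
Qed.

Lemma rV_norm_mulmx v (B : 'M[R]_N) : `|v *m B| <= (\sum_i \sum_j `|B i j|) * `|v|.
Proof.
apply: rV_norm_le => [|j].
  by rewrite mulr_ge0// sumr_ge0// => i _; rewrite sumr_ge0.
rewrite mxE (le_trans (ler_norm_sum _ _ _))// mulr_suml ler_sum// => i _.
rewrite normrM mulrC ler_pM// ?rV_norm_coord//.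
by rewrite (bigD1 j)//= lerDl sumr_ge0.
Qed.

(** A zero of the perturbed map is a fixed point of $t \mapsto t_0 - \mathrm{Err}(t) A^{-1}$, which
    is a contraction of a small closed ball around $t_0$ inside the cube. *)
Lemma zero_persist (A : 'M[R]_N) (eta t0 : 'rV[R]_N) :
  A \in unitmx -> eta + t0 *m A = 0 -> (forall j, 0 < t0 0 j < 1) ->
  exists2 c, 0 < c & forall Err : 'rV[R]_N -> 'rV[R]_N, Err 0 = 0 ->
    (forall t t', `|t| <= 1 -> `|t'| <= 1 -> `|Err t - Err t'| <= c * `|t - t'|) ->
    exists2 t : 'rV[R]_N, (forall j, 0 <= t 0 j < 1) & eta + t *m A + Err t = 0.
Proof.
move=> uA et0 t01.
have [del del0 delP] : exists2 del : R, 0 < del & forall t, `|t - t0| <= del ->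
    forall j, 0 <= t 0 j < 1.
  (* Distance from [t0] to the faces; it is halved at the upper faces because the cube is open
     there. *)
  pose del := \big[Num.min/1]_(j < N) (Num.min (t0 0 j) ((1 - t0 0 j) / 2)).
  exists del.
    rewrite /del; elim/big_ind: _ => // [x y x0 y0|j _]; first by rewrite lt_min x0.
    by rewrite lt_min; have /andP[-> h] := t01 j; rewrite divr_gt0// subr_gt0.
  move=> t tt0 j; have /andP[h1 h2] := t01 j.
  have : `|t 0 j - t0 0 j| <= Num.min (t0 0 j) ((1 - t0 0 j) / 2).
    have := rV_norm_coord (t - t0) j; rewrite !mxE => /le_trans; apply.
    apply: (le_trans tt0); rewrite /del.
    exact: bigmin_le.
  rewrite le_min !ler_norml => /andP[/andP[? ?] /andP[? ?]].
  by apply/andP; split; lra.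
pose M := 1 + \sum_i \sum_j `|invmx A i j|.
have M1 : 1 <= M by rewrite lerDl sumr_ge0// => i _; rewrite sumr_ge0.
have M0 : 0 < M by apply: lt_le_trans M1.
have MP v : `|v *m invmx A| <= M * `|v|.
  by apply: (le_trans (rV_norm_mulmx _ _)); rewrite ler_wpM2r// lerDr.
(* [M] bounds the norm of the inverse of [A]. The factor $1/2$ makes the map a contraction, the
   factor [del] keeps it inside the ball. *)
pose c := Num.min (2^-1) del / M.
have c0 : 0 < c by rewrite divr_gt0// lt_min del0 invr_gt0 ltr0n.
have Mc : M * c = Num.min (2^-1) del by rewrite mulrC divfK// gt_eqF.
exists c => // Err E0 El.
have t0E : t0 = - eta *m invmx A.
  by rewrite -[LHS](mulmxK uA); congr (_ *m _); apply/eqP; rewrite -addr_eq0 addrC et0.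
pose U : set 'rV[R]_N := [set t | `|t - t0| <= del].
have U1 t : U t -> `|t| <= 1.
  move=> Ut; apply: rV_norm_le => // j.
  by have /andP[h1 h2] := delP _ Ut j; rewrite ger0_norm// ltW.
pose T t : 'rV[R]_N := t0 - Err t *m invmx A.
have TU : {homo T : t / U t >-> U t}.
  move=> t Ut; rewrite /U /= /T addrC addKr normrN (le_trans (MP _))//.
  have := El t 0 (U1 _ Ut); rewrite normr0 E0 !subr0 => /(_ ler01) h.
  apply: (@le_trans _ _ (M * c * `|t|)); first by rewrite -mulrA ler_pM2l.
  rewrite Mc (@le_trans _ _ (Num.min (2^-1) del))// ?ge_min ?lexx ?orbT//.
  by rewrite ler_piMr ?U1// le_min invr_ge0 ler0n ltW.
pose Tf : {fun U >-> U} := HB.pack_for {fun U >-> U} T (isFun.Build _ _ U U T TU).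
have ctr : is_contraction Tf.
  have h2 : 0 <= 2^-1 :> R by rewrite invr_ge0.
  exists (NngNum h2); split => /=; first by rewrite invf_lt1// ltr1n.
  move=> [t t'] /= [Ut Ut']; rewrite /self_sub /=.
  have -> : T t - T t' = (Err t' - Err t) *m invmx A.
    by rewrite /T mulmxBl opprB addrC addrA subrK.
  rewrite (le_trans (MP _))//.
  apply: (@le_trans _ _ (M * c * `|t - t'|)).
    by rewrite -mulrA ler_pM2l// [in leRHS]distrC El// U1.
  by rewrite Mc ler_wpM2r// ge_min lexx.
have clU : closed U.
  rewrite (_ : U = (fun t : 'rV[R]_N => `|t - t0|) @^-1` [set x | x <= del])//.
  apply: (@preimage_closed _ _ (fun t : 'rV[R]_N => `|t - t0|) [set x | x <= del]); last exact: closed_le.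
  move=> t _.
  apply: (continuous_comp (f := fun t => t - t0)); last exact: norm_continuous.
  apply: (@continuousD _ _ _ idfun (cst (- t0))); first exact: cvg_id.
  exact: cst_continuous.
have [|p Up pT] := banach_fixed_point ctr clU.
  by exists t0; rewrite /U /= subrr normr0 ltW.
exists p; first exact: delP.
by rewrite {1}pT /Tf /= /T mulmxBl mulmxKV// addrA subrK.
Qed.

(** By compactness $|\eta + tA|$ has a positive minimum on the closed cube, and an error of half
    that size cannot cancel it. *)
Lemma zero_absent (A : 'M[R]_N) (eta : 'rV[R]_N) :
  (forall t : 'rV[R]_N, (forall j, 0 <= t 0 j <= 1) -> eta + t *m A != 0) ->
  exists2 c, 0 < c & forall Err : 'rV[R]_N -> 'rV[R]_N,
    (forall t : 'rV[R]_N, (forall j, 0 <= t 0 j <= 1) -> `|Err t| <= c) ->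
    forall t : 'rV[R]_N, (forall j, 0 <= t 0 j <= 1) -> eta + t *m A + Err t != 0.
Proof.
move=> nz.
have [t0 t01 tmin] : exists2 t0 : 'rV[R]_N,
    t0 \in [set v : 'rV[R]_N | forall j, `[0 : R, 1]%classic (v ord0 j)]
      & forall t, t \in [set v : 'rV[R]_N | forall j, `[0 : R, 1]%classic (v ord0 j)] ->
    `|eta + t0 *m A| <= `|eta + t *m A|.
  apply: EVT_min_rV.
  - by exists 0 => j /=; rewrite mxE in_itv /= lexx ler01.
  - by apply: (@rV_compact R N (fun=> `[0 : R, 1]%classic)) => j; exact: segment_compact.
  - apply: continuous_subspaceT => t.
    apply: (continuous_comp (f := fun t => eta + t *m A) (g := normr)); last exact: norm_continuous.
    apply: (@continuousD _ _ _ (cst eta) (fun t : 'rV[R]_N => t *m A)).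
      exact: cst_continuous.
    pose f := mulmxr A : {linear 'rV[R]_N -> 'rV[R]_N}.
    have bf : bounded_near f (nbhs (0 : 'rV[R]_N)).
      apply/bounded_funP => r; exists ((\sum_i \sum_j `|A i j|) * r) => x xr.
      apply: (le_trans (rV_norm_mulmx _ _)); apply: ler_wpM2l => //.
      by rewrite sumr_ge0// => i _; rewrite sumr_ge0.
    exact: (linear_bounded_continuous f).1 bf t.
have m0 : 0 < `|eta + t0 *m A|.
  rewrite normr_gt0 nz// => j; have /set_mem/(_ j) := t01.
  by rewrite /= in_itv.
exists (`|eta + t0 *m A| / 2); first by rewrite divr_gt0.
move=> Err El t tI; apply/eqP => /eqP; rewrite addr_eq0 => /eqP h.
have : `|eta + t0 *m A| <= `|eta + t0 *m A| / 2.
  apply: (@le_trans _ _ `|eta + t *m A|).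
    by apply: tmin; apply/mem_set => j /=; rewrite in_itv /= tI.
  by rewrite h normrN El.
by rewrite leNgt ltr_pdivrMr// ltr_pMr// ltr1n.
Qed.

End RowNorm.

Section Hyperplane.
Context {R : realType} {N : nat}.

Lemma finite_polynomial_zeros (p : {poly R}) : p != 0 -> finite_set [set t | p.[t] = 0].
Proof.
move=> p0; apply: contrapT => /(infinite_set_fset (size p))[B Bp].
apply/negP; rewrite -ltnNge; apply: max_poly_roots => //.
  by apply/allP => t tB; apply/eqP; exact: (Bp t).
exact: fset_uniq.
Qed.

(** The moment curve $(t, t^2, \dots, t^N)$ meets a hyperplane at the roots of a nonzero
    polynomial. *)
Lemma curve_hyperplane (l : 'cV[R]_N) (b : R) : l != 0 ->
  finite_set [set t : R | \sum_(j < N) t ^+ j.+1 * l j 0 + b = 0].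
Proof.
move=> l0; pose p : {poly R} := \poly_(i < N.+1) (if i is j.+1 then
   (if insub j is Some j' then l j' 0 else 0) else b).
have p0 : p != 0.
  apply: contra_neq l0 => p0; apply/colP => j; rewrite !mxE.
  have := congr1 (fun q : {poly R} => q`_j.+1) p0.
  by rewrite coef_poly coef0 ltnS ltn_ord (valK j).
apply: sub_finite_set (finite_polynomial_zeros p0) => t /= <-.
rewrite horner_poly big_ord_recl /= expr0 mulr1 addrC; congr (_ + _).
apply: eq_bigr => j _; rewrite /bump /= add1n (valK j) mulrC.
by [].
Qed.

End Hyperplane.

(** * Local limit of the probability of a zero in a small cube *)

Section KernelVectors.
Context {R : realType} {N : nat}.

Lemma det0_kernel (A : 'M[R]_N) : \det A = 0 ->
  exists2 l : 'cV[R]_N, l != 0 & A *m l = 0.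
Proof.
move=> A0; have /det0P[v v0 vA] : \det A^T == 0 by rewrite det_tr A0.
exists v^T; first by rewrite trmx_eq0.
by apply: trmx_inj; rewrite trmx_mul trmxK vA trmx0.
Qed.

(** Replacing row [l] by zero makes the matrix singular. Against such a [v], the product [t *m A]
    sees only the coordinate [t 0 l], which is known when [t] lies on a face of the cube. *)
Lemma rows_but_one_kernel (A : 'M[R]_N) (l : 'I_N) :
  exists2 v : 'cV[R]_N, v != 0 & forall i, i != l -> (A *m v) i 0 = 0.
Proof.
pose A' := \matrix_(i, j) (if i == l then 0 else A i j) : 'M[R]_N.
have : \det A' = 0.
  apply/eqP/det0P; exists (delta_mx 0 l).
    apply/eqP => /matrixP/(_ 0 l)/eqP; rewrite !mxE !eqxx /=.
    by rewrite oner_eq0.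
  by rewrite -rowE; apply/rowP => j; rewrite !mxE eqxx.
move=> /det0_kernel[v v0 Av]; exists v => // i il.
have := congr1 (fun M : 'cV[R]_N => M i 0) Av; rewrite !mxE => h; rewrite -[RHS]h.
by apply: eq_bigr => j _; rewrite mxE (negbTE il).
Qed.

End KernelVectors.

Lemma measurable_det d (T : measurableType d) (R : realType) N (A : T -> 'M[R]_N) :
  (forall i j, measurable_fun setT (fun x => A x i j)) ->
  measurable_fun setT (fun x => \det (A x)).
Proof.
move=> mA; rewrite /determinant; apply: measurable_sum => s.
apply: measurable_funM => //; apply: measurable_prod => i _; exact: mA.
Qed.

Lemma measurable_bigsum d (T : measurableType d) (R : realType) (I : Type)
    (r : seq I) (P : pred I) (f : I -> T -> R) :
  (forall i, measurable_fun setT (f i)) ->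
  measurable_fun setT (fun x => \sum_(i <- r | P i) f i x).
Proof.
move=> mf; rewrite (_ : (fun x => _) =
    fun x => \sum_(i <- r) if P i then f i x else 0); last first.
  by apply: funext => x; rewrite big_mkcond.
by apply: measurable_sum => i; case: (P i).
Qed.

Section LinearModel.
Context {R : realType} {N K : nat}.
Notation E := (euclidean R K).
Variables (iota : 'I_N -> 'I_K) (B : 'I_N -> 'I_K -> 'I_N -> R).
Hypothesis iota_inj : injective iota.

(** The coordinates [iota j] give the value of the linear model at the origin, the remaining ones
    its derivative; the two groups are independent under the Gaussian measure. *)
Definition rest k := [forall j, iota j != k].

Definition etaV (x : E) : 'rV[R]_N := \row_j x (iota j).

Definition linM (x : E) : 'M[R]_N := \matrix_(l, j) \sum_(k | rest k) x k * B j k l.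

Definition Flin (x : E) (t : 'rV[R]_N) j := (etaV x + t *m linM x) 0 j.

Definition cone_event : set E :=
  [set x | exists t : 'rV[R]_N, (forall j, 0 <= t 0 j < 1) /\ forall j, Flin x t j = 0].

(** The Gaussian density with the factor of the coordinates [iota j] replaced by its value at 0:
    integrating it against [lebE] means Lebesgue measure in those coordinates and Gaussian measure
    in the others, up to the constant. *)
Definition rest_density (x : E) : R :=
  Num.sqrt pi ^- K * expR (- \sum_(k | rest k) x k ^+ 2).

Definition local_const : \bar R :=
  (\int[lebE]_x (\1_cone_event x * rest_density x)%:E)%E.

Lemma measurable_rest_density : measurable_fun setT rest_density.
Proof.
apply: measurable_funM => //; apply: measurableT_comp => //.
apply: measurable_funN; apply: measurable_bigsum => k.
by apply: measurable_funX; exact: measurable_proj.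
Qed.

Lemma FlinE x t j : Flin x t j = x (iota j) + \sum_l t 0 l * linM x l j.
Proof. by rewrite /Flin !mxE. Qed.

Lemma measurable_linM l j : measurable_fun setT (fun x => linM x l j).
Proof.
rewrite (_ : (fun x => _) = fun x : E => \sum_(k | rest k) x k * B j k l); last first.
  by apply: funext => x; rewrite mxE.
apply: measurable_bigsum => k; apply: measurable_funM => //; exact: measurable_proj.
Qed.

Lemma measurable_Flin t j : measurable_fun setT (fun x => Flin x t j).
Proof.
rewrite (_ : (fun x => _) = fun x => x (iota j) + \sum_l t 0 l * linM x l j); last first.
  by apply: funext => x; rewrite FlinE.
apply: measurable_funD; first exact: measurable_proj.
apply: measurable_sum => l; apply: measurable_funM => //; exact: measurable_linM.
Qed.

Lemma continuous_Flin x j : continuous (fun t => Flin x t j).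
Proof.
under eq_fun do rewrite FlinE.
move=> t; apply: (@continuousD _ _ _ (cst (x (iota j)))).
  exact: cst_continuous.
move: t; apply: continuous_bigsum => l t; apply: (@continuousM _ _ (fun t : 'rV[R]_N => t 0 l) (cst _)).
  exact: coord_continuous.
exact: cst_continuous.
Qed.

Lemma measurable_cone_event : measurable cone_event.
Proof.
exact: (measurable_zero_cell measurable_Flin continuous_Flin (fun=> 0) (fun=> 1)).
Qed.

(* Off this null set the indicator of the linearised event is stable under
   small perturbations of the equations. *)
Definition degenerate : set E :=
  [set x | exists t : 'rV[R]_N, [/\ (forall j, 0 <= t 0 j <= 1),
     (forall j, Flin x t j = 0)
   & \det (linM x) = 0 \/ exists l, t 0 l = 0 \/ t 0 l = 1]].

Lemma measurable_degenerate : measurable degenerate.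
Proof.
(* A zero on a face is a zero in a box collapsed in the direction [l], so closed-box events describe
   it. *)
pose Z a b := [set x | exists t : 'rV[R]_N,
  (forall j, a j <= t 0 j <= b j) /\ forall j, Flin x t j = 0].
have mZ a b : measurable (Z a b).
  exact: (measurable_zero_closed measurable_Flin continuous_Flin).
rewrite (_ : degenerate = (Z (fun=> 0) (fun=> 1) `&` [set x | \det (linM x) = 0]) `|`
  \bigcup_(l in [set: 'I_N]) (Z (fun=> 0) (fun j => (j != l)%:R) `|` Z (fun j => (j == l)%:R) (fun=> 1))).
  apply: measurableU.
    apply: measurableI => //.
    have md := measurable_det measurable_linM.
    by have := md measurableT [set 0] (measurable_set1 0); rewrite setTI.
  apply: fin_bigcup_measurable; first exact: finite_finset.
  by move=> l _; exact: measurableU.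
apply/seteqP; split=> x.
  move=> [t [t01 Ft [d0|[l tl]]]]; first by left; split=> //; exists t.
  right; exists l => //; case: tl => tl; [left|right]; exists t; split=> // j.
    by have /andP[-> t1] := t01 j; case: eqVneq => [->|//]; rewrite tl lexx.
  by have /andP[t0 ->] := t01 j; case: eqVneq => [->|_]; rewrite ?tl ?lexx ?t0.
case=> [[[t [t01 Ft] d0]]|[l _ [] [t [tab Ft]]]].
- by exists t; split=> //; left.
- exists t; split=> //.
    move=> j; have /andP[-> h] := tab j; rewrite (le_trans h)// lern1.
    by case: (_ != _).
  right; exists l; left; have := tab l; rewrite eqxx /= => h.
  by apply/eqP; rewrite eq_le andbC.
- exists t; split=> //.
    by move=> j; have /andP[h ->] := tab j; rewrite (le_trans _ h) ?ler0n.
  right; exists l; right; have := tab l; rewrite eqxx /= => h.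
  by apply/eqP; rewrite eq_le andbC.
Qed.

(** Translation along the moment curve in the coordinates [iota j] leaves [linM] unchanged.
    Degeneracy then forces the curve parameter to be a root of one of finitely many nonzero
    polynomials. *)
Lemma degenerate_null : lebE degenerate = 0%E.
Proof.
pose c (t : R) : E := fun k => \sum_(j | iota j == k) t ^+ j.+1.
apply: (lebE_null_curve (c := c)); first exact: measurable_degenerate.
  by apply: measurable_prodP => k; apply: measurable_bigsum => j; exact: measurable_funX.
move=> x; pose A := linM x.
have linc t : linM (fun k => x k + c t k) = A.
  apply/matrixP => l j; rewrite !mxE; apply: eq_bigr => k /forallP rk.
  by rewrite /c big_pred0 ?addr0// => i; apply/negbTE.
have etac t j : etaV (fun k => x k + c t k) 0 j = x (iota j) + t ^+ j.+1.
  rewrite mxE /c (big_pred1 j)// => i; by rewrite (inj_eq iota_inj).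
pose S (v : 'cV[R]_N) (b : R) := [set t : R | \sum_(j < N) t ^+ j.+1 * v j 0 + b = 0].
(* Pairing the equations with a column [v] gives one polynomial equation in the parameter, where the
   zero [th] enters only through [th *m (A *m v)]. A kernel vector, or a column from
   [rows_but_one_kernel], removes this unknown. *)
have key t th (v : 'cV[R]_N) : (forall j, Flin (fun k => x k + c t k) th j = 0) ->
    \sum_(j < N) t ^+ j.+1 * v j 0 + ((\sum_j x (iota j) * v j 0) + (th *m (A *m v)) 0 0) = 0.
  move=> F0; have : ((etaV (fun k => x k + c t k) + th *m A) *m v) 0 0 = 0.
    rewrite (_ : _ + _ = 0) ?mul0mx ?mxE//; apply/rowP => j.
    by rewrite -(linc t) [LHS]F0 mxE.
  rewrite mulmxDl mxE -mulmxA => h; rewrite -[RHS]h addrA; congr (_ + _).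
  rewrite mxE -big_split /=; apply: eq_bigr => j _.
  by rewrite etac mulrDl addrC.
have /choice[w wP] : forall l, exists v : 'cV[R]_N,
    v != 0 /\ forall i, i != l -> (A *m v) i 0 = 0.
  by move=> l; have [v v0 vA] := rows_but_one_kernel A l; exists v.
have wE l (th : 'rV[R]_N) : (th *m (A *m w l)) 0 0 = th 0 l * (A *m w l) l 0.
  have [_ wl] := wP l; rewrite mxE (bigD1 l)//= big1 ?addr0// => i il.
  by rewrite wl// mulr0.
have [w0 w0n w0P] : exists2 v : 'cV[R]_N, v != 0 \/ \det A != 0 & \det A = 0 -> A *m v = 0.
  have [/det0_kernel[v v0 vA]|dA] := eqVneq (\det A) 0; first by exists v; [left|].
  by exists 0; [right|rewrite mulmx0].
pose U := [set t | \det A = 0 /\ S w0 (\sum_j x (iota j) * w0 j 0) t] `|`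
  \bigcup_(l in [set: 'I_N]) (S (w l) (\sum_j x (iota j) * w l j 0)
     `|` S (w l) (\sum_j x (iota j) * w l j 0 + (A *m w l) l 0)).
apply: finite_set_countable; apply: (@sub_finite_set _ _ U).
  move=> t [th [th01 F0 H]]; rewrite linc in H; case: H => [d0|[l tl]].
    left; split=> //; have := key _ _ w0 F0.
    by rewrite w0P// mulmx0 mxE addr0.
  right; exists l => //; have := key _ _ (w l) F0; rewrite wE.
  by case: tl => ->; rewrite ?mul0r ?mul1r ?addr0; [left|right].
rewrite finite_setU; split.
  have [d0|d0] := eqVneq (\det A) 0; last first.
    by rewrite (_ : mkset _ = set0)//; apply/seteqP; split=> // t [/eqP]; rewrite (negbTE d0).
  apply: (@sub_finite_set _ _ (S w0 (\sum_j x (iota j) * w0 j 0))); first by move=> t [].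
  by apply: curve_hyperplane; case: w0n => //; rewrite d0 eqxx.
apply: bigcup_finite; first exact: finite_finset.
move=> l _; have [wl _] := wP l.
by rewrite finite_setU; split; exact: curve_hyperplane.
Qed.

End LinearModel.

Section LocalLimit.
Context {R : realType} {N K : nat}.
Notation E := (euclidean R K).
Variables (iota : 'I_N -> 'I_K) (B : 'I_N -> 'I_K -> 'I_N -> R).
Hypothesis iota_inj : injective iota.
Variables (G : 'I_N -> 'I_K -> 'rV[R]_N -> R) (D : 'I_N -> 'I_K -> 'I_N -> R)
  (r : 'I_N -> 'I_K -> 'rV[R]_N -> R) (L : R) (s : 'I_N -> R).
Hypotheses (L0 : 0 <= L) (s0 : forall j, 0 < s j)
  (GE : forall j k t, G j k t = (k == iota j)%:R + \sum_l t 0 l * D j k l + r j k t)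
  (r0 : forall j k, r j k 0 = 0)
  (rL : forall j k (rho : R) t t', `|t| <= rho -> `|t'| <= rho ->
     `|r j k t - r j k t'| <= L * rho * `|t - t'|)
  (DB : forall j k l, rest iota k -> D j k l = s j * B j k l)
  (cG : forall j k, continuous (G j k)).

Let rest := rest iota.

(** A field linear in the Gaussian coordinates. In this section, equation [j] reads only the
    coordinate [iota j] at the origin, its derivative along the other coordinates is [s j] times
    [B], and the remainder is of second order in the Lipschitz sense. *)
Definition field (x : E) (t : 'rV[R]_N) j := \sum_k x k * G j k t.

Lemma measurable_field t j : measurable_fun setT (fun x => field x t j).
Proof.
apply: measurable_sum => k; apply: measurable_funM => //; exact: measurable_proj.
Qed.

Lemma continuous_field x j : continuous (fun t => field x t j).
Proof.
apply: continuous_bigsum => k t.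
by apply: (@continuousM _ _ (cst (x k)) (G j k)); [exact: cst_continuous|exact: cG].
Qed.

Definition small_event (e : R) : set E :=
  [set x | exists t : 'rV[R]_N, (forall j, 0 <= t 0 j < 1) /\
     forall j, field x (e *: t) j = 0].

Lemma measurable_small_event e : measurable (small_event e).
Proof.
apply: (measurable_zero_cell (F := fun x t j => field x (e *: t) j)).
  by move=> t j; exact: measurable_field.
move=> x j t.
apply: (continuous_comp (f := fun t : 'rV[R]_N => e *: t) (g := fun u => field x u j)).
  exact: scaler_continuous.
exact: continuous_field.
Qed.

(** The blow-up of the coordinates [iota j] by $e s_j$; on the other coordinates the product is
    empty and equals 1. *)
Let vv (e : R) : E := fun k => \prod_(j | iota j == k) (e * s j).

Let vv_iota e j : vv e (iota j) = e * s j.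
Proof. by rewrite /vv (big_pred1 j)// => i; rewrite (inj_eq iota_inj). Qed.

Let vv_rest e k : rest k -> vv e k = 1.
Proof. by move=> /forallP rk; rewrite /vv big_pred0// => j; apply/negbTE. Qed.

Let vv_gt0 e k : 0 < e -> 0 < vv e k.
Proof. by move=> e0; apply: prodr_gt0 => j _; rewrite mulr_gt0. Qed.

(** The Jacobian of the blow-up. *)
Let prod_vv e : \prod_k vv e k = e ^+ N * \prod_j s j.
Proof.
transitivity (\prod_j (e * s j)); last by rewrite big_split /= prodr_const card_ord.
by rewrite [RHS](partition_big iota xpredT).
Qed.

Let not_rest k : ~~ rest k -> exists j, k = iota j.
Proof. by move=> /forallPn[j]; rewrite negbK => /eqP <-; exists j. Qed.

(** The coefficient of [x k] in the deviation from the linear model after blow-up. For [k] in the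
    image of [iota] even the first-order part is an error, because [vv] supplies one more factor
    [e]. *)
Let errk e j k (t : 'rV[R]_N) := (if rest k then r j k (e *: t)
  else vv e k * (e * (\sum_l t 0 l * D j k l) + r j k (e *: t))) / (e * s j).

Let Err e (x : E) (t : 'rV[R]_N) : 'rV[R]_N := \row_j \sum_k x k * errk e j k t.

Let field_scale e (x : E) t j : 0 < e ->
  field (fun k => vv e k * x k) (e *: t) j =
  e * s j * (etaV iota x + t *m linM iota B x + Err e x t) 0 j.
Proof.
move=> e0; have es0 : e * s j != 0 by rewrite gt_eqF// mulr_gt0.
pose T1 k := vv e k * x k * (k == iota j)%:R.
pose T2 k := if rest k then e * s j * (x k * \sum_l t 0 l * B j k l) else 0.
rewrite /field.
rewrite (eq_bigr (fun k => T1 k + (T2 k + e * s j * (x k * errk e j k t)))); last first.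
  move=> k _; rewrite GE /T1 /T2 /errk.
  have -> : \sum_l (e *: t) 0 l * D j k l = e * \sum_l t 0 l * D j k l.
    by rewrite mulr_sumr; apply: eq_bigr => l _; rewrite mxE mulrA.
  case: ifPn => rk.
    rewrite vv_rest//.
    have -> : \sum_l t 0 l * D j k l = s j * \sum_l t 0 l * B j k l.
      by rewrite mulr_sumr; apply: eq_bigr => l _; rewrite DB// mulrCA.
    rewrite [e * s j * (x k * (_ / _))]mulrCA [e * s j * (_ / _)]mulrC divfK//.
    ring.
  rewrite [e * s j * (x k * (_ / _))]mulrCA [e * s j * (_ / _)]mulrC divfK//.
  ring.
rewrite !big_split /= -!mulr_sumr.
have -> : \sum_k T1 k = e * s j * x (iota j).
  rewrite (bigD1 (iota j))//= big1 => [|k /negbTE kj]; last by rewrite /T1 kj mulr0.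
  by rewrite /T1 eqxx mulr1 addr0 vv_iota.
have -> : \sum_k T2 k = e * s j * \sum_l t 0 l * linM iota B x l j.
  rewrite /T2 -big_mkcond /= -mulr_sumr; congr (_ * _).
  under [RHS]eq_bigr do rewrite mxE mulr_sumr.
  rewrite exchange_big /=; apply: eq_bigr => k _; rewrite mulr_sumr.
  by apply: eq_bigr => l _; rewrite mulrCA.
by rewrite -!mulrDr !mxE addrA.
Qed.

Let Err0 e x : Err e x 0 = 0.
Proof.
apply/rowP => j; rewrite !mxE big1// => k _; rewrite /errk scaler0 !r0.
rewrite big1 => [|l _]; last by rewrite mxE mul0r.
by rewrite mulr0 addr0 mulr0 if_same mul0r mulr0.
Qed.

Let Sm := \sum_j s j.
Let si := \sum_j (s j)^-1.
Let Dm := \sum_j \sum_k \sum_l `|D j k l|.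
(** [si] pays for the division by [s j], [L] is the remainder on the rest coordinates, and [Sm]
    times [Dm + L] covers the blown-up ones. *)
Let C0 := si * (L + Sm * (Dm + L)).

Let Sm0 : 0 <= Sm. Proof. by apply: sumr_ge0 => j _; exact/ltW. Qed.
Let si0 : 0 <= si. Proof. by apply: sumr_ge0 => j _; rewrite invr_ge0 ltW. Qed.
Let Dm0 : 0 <= Dm.
Proof. by apply: sumr_ge0 => j _; apply: sumr_ge0 => k _; exact: sumr_ge0. Qed.
Let C00 : 0 <= C0.
Proof. by rewrite mulr_ge0// addr_ge0// mulr_ge0// addr_ge0. Qed.

Let sSm j : s j <= Sm.
Proof. by rewrite /Sm (bigD1 j)//= lerDl sumr_ge0// => i _; exact/ltW. Qed.
Let ssi j : (s j)^-1 <= si.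
Proof. by rewrite /si (bigD1 j)//= lerDl sumr_ge0// => i _; rewrite invr_ge0 ltW. Qed.

Let sumD j k (t t' : 'rV[R]_N) :
  `|\sum_l t 0 l * D j k l - \sum_l t' 0 l * D j k l| <= Dm * `|t - t'|.
Proof.
rewrite -sumrB (le_trans (ler_norm_sum _ _ _))//.
apply: (@le_trans _ _ (\sum_l `|D j k l| * `|t - t'|)).
  apply: ler_sum => l _; rewrite -mulrBl normrM mulrC ler_wpM2l//.
  by have := rV_norm_coord (t - t') l; rewrite !mxE.
rewrite -mulr_suml ler_wpM2r//; apply: (@le_trans _ _ (\sum_k \sum_l `|D j k l|)).
  by rewrite [leRHS](bigD1 k)//= lerDl sumr_ge0// => i _; rewrite sumr_ge0.
rewrite /Dm [leRHS](bigD1 j)//= lerDl.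
by rewrite sumr_ge0// => i _; rewrite sumr_ge0// => i' _; rewrite sumr_ge0.
Qed.

(** Every numerator in [errk] is of order $e^2$, so one factor [e] survives the division by $e
    s_j$. *)
Let errk_lip e j k t t' : 0 < e <= 1 -> `|t| <= 1 -> `|t'| <= 1 ->
  `|errk e j k t - errk e j k t'| <= C0 * e * `|t - t'|.
Proof.
move=> /andP[e0 e1] t1 t'1.
have es0 : 0 < e * s j by rewrite mulr_gt0.
have rl : `|r j k (e *: t) - r j k (e *: t')| <= L * e * (e * `|t - t'|).
  have -> : e * `|t - t'| = `|e *: t - e *: t'| by rewrite -scalerBr normrZ gtr0_norm.
  by apply: rL; rewrite normrZ gtr0_norm// ger_pMr.
rewrite /errk -mulrBl normrM normfV (gtr0_norm es0) ler_pdivrMr//.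
have nn : 0 <= `|t - t'| by [].
have step : e * (L + Sm * (Dm + L)) * e * `|t - t'| <= C0 * e * `|t - t'| * (e * s j).
  have -> : C0 * e * `|t - t'| * (e * s j) =
      (si * s j) * (e * (L + Sm * (Dm + L)) * e * `|t - t'|) by rewrite /C0; ring.
  apply: ler_peMl; last by rewrite -ler_pdivrMr ?s0// mul1r ssi.
  by rewrite !mulr_ge0// ?addr_ge0// ?mulr_ge0 ?addr_ge0// ltW.
apply: le_trans step; case: ifPn => rk.
  apply: (le_trans rl).
  have -> : L * e * (e * `|t - t'|) = (e * e * `|t - t'|) * L by ring.
  have -> : e * (L + Sm * (Dm + L)) * e * `|t - t'| =
     (e * e * `|t - t'|) * (L + Sm * (Dm + L)) by ring.
  by rewrite ler_wpM2l ?lerDl ?mulr_ge0 ?addr_ge0// ltW.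
have [j' kj'] := not_rest rk; rewrite kj' vv_iota -kj' -mulrBr normrM.
rewrite gtr0_norm ?mulr_gt0// opprD addrACA -mulrBr.
have h : `|e * (\sum_l t 0 l * D j k l - \sum_l t' 0 l * D j k l) +
    (r j k (e *: t) - r j k (e *: t'))| <= e * (Dm + L) * `|t - t'|.
  apply: (le_trans (ler_normD _ _)); rewrite normrM gtr0_norm// mulrDr mulrDl.
  apply: lerD; first by rewrite -mulrA ler_pM2l// sumD.
  apply: (le_trans rl); have -> : L * e * (e * `|t - t'|) = e * (e * L * `|t - t'|) by ring.
  by rewrite -[leRHS]mulrA ler_pM2l// ler_wpM2r// ler_piMl.
apply: (le_trans (ler_wpM2l _ h)); first by rewrite mulr_ge0// ltW.
have -> : e * s j' * (e * (Dm + L) * `|t - t'|) = (e * e * `|t - t'|) * (s j' * (Dm + L)) by ring.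
have -> : e * (L + Sm * (Dm + L)) * e * `|t - t'| =
   (e * e * `|t - t'|) * (L + Sm * (Dm + L)) by ring.
rewrite ler_wpM2l ?mulr_ge0// ?(ltW e0)//.
by apply: (@le_trans _ _ (Sm * (Dm + L))); rewrite ?lerDr// ler_wpM2r// addr_ge0.
Qed.

Let X (x : E) := \sum_k `|x k|.

Let Err_lip e x t t' : 0 < e <= 1 -> `|t| <= 1 -> `|t'| <= 1 ->
  `|Err e x t - Err e x t'| <= C0 * e * X x * `|t - t'|.
Proof.
move=> e01 t1 t'1; have /andP[e0 e1] := e01; apply: rV_norm_le.
  have X0 : 0 <= X x by exact: sumr_ge0.
  by rewrite mulr_ge0// mulr_ge0// mulr_ge0// ltW.
move=> j; rewrite !mxE -sumrB (le_trans (ler_norm_sum _ _ _))//.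
have -> : C0 * e * X x * `|t - t'| = \sum_k `|x k| * (C0 * e * `|t - t'|).
  by rewrite -mulr_suml -/(X x); ring.
by apply: ler_sum => k _; rewrite -mulrBr normrM ler_wpM2l// errk_lip.
Qed.

Let norm1 (t : 'rV[R]_N) : (forall j, 0 <= t 0 j <= 1) -> `|t| <= 1.
Proof.
by move=> t01; apply: rV_norm_le => // j; have /andP[? ?] := t01 j; rewrite ger0_norm.
Qed.

Let scaled_event e := [set x : E | small_event e (fun k => vv e k * x k)].

Let scaled_eventP e x : 0 < e -> scaled_event e x <->
  exists2 t : 'rV[R]_N, (forall j, 0 <= t 0 j < 1) &
    etaV iota x + t *m linM iota B x + Err e x t = 0.
Proof.
move=> e0; split=> [[t [t01 F0]]|[t t01 H0]].
  exists t => //; apply/rowP => j; have := F0 j; rewrite field_scale// => /eqP.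
  by rewrite mulf_eq0 gt_eqF/= ?mulr_gt0// => /eqP ->; rewrite mxE.
exists t; split=> // j; rewrite field_scale// H0 mxE mulr0//.
Qed.

Variable eps : nat -> R.
Hypotheses (eps0 : forall m, 0 < eps m) (epsc : eps m @[m --> \oo] --> 0).

Let eps_small (c : R) (y : R) : 0 < c -> 0 <= y -> \forall m \near \oo, C0 * eps m * y <= c.
Proof.
move=> c0 y0; have h0 : 0 <= C0 * y by exact: mulr_ge0.
have h1 : 0 < C0 * y + 1 by rewrite ltr_wpDl.
have q0 : 0 < c / (C0 * y + 1) by rewrite divr_gt0.
move/cvgrPdist_le : epsc => /(_ _ q0); apply: filterS => m.
rewrite sub0r normrN gtr0_norm// ler_pdivlMr// => h; apply: le_trans h.
have -> : C0 * eps m * y = eps m * (C0 * y) by ring.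
by rewrite mulrDr mulr1 lerDl ltW.
Qed.

Let eps1 : \forall m \near \oo, 0 < eps m <= 1.
Proof.
move/cvgrPdist_le : epsc => /(_ _ ltr01); apply: filterS => m.
by rewrite sub0r normrN gtr0_norm// eps0.
Qed.

(** Off [degenerate] either the linear model has a zero in the open cube with invertible derivative,
    which persists, or it has no zero in the closed cube, which persists too. *)
Let scaled_event_cvg x : ~ degenerate iota B x ->
  \forall m \near \oo, (x \in scaled_event (eps m)) = (x \in cone_event iota B).
Proof.
move=> ndx; have X0 : 0 <= X x by exact: sumr_ge0.
have [[t [t01 Ft]]|no] := pselect (exists t : 'rV[R]_N,
    (forall j, 0 <= t 0 j <= 1) /\ forall j, Flin iota B x t j = 0).
  have Ft0 : etaV iota x + t *m linM iota B x = 0 by apply/rowP => j; rewrite [LHS]Ft mxE.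
  have dA : \det (linM iota B x) != 0.
    by apply/eqP => d0; apply: ndx; exists t; split=> //; left.
  have t01' j : 0 < t 0 j < 1.
    have /andP[a b] := t01 j; rewrite !lt_neqAle a b !andbT eq_sym.
    by apply/andP; split; apply/eqP => tj; apply: ndx; exists t; split=> //; right; exists j; [left|right].
  have [|c c0 cP] := zero_persist _ Ft0 t01'; first by rewrite unitmxE unitfE.
  near=> m; rewrite [RHS]mem_set; last first.
    by exists t; split=> // j; have /andP[/ltW -> ->] := t01' j.
  apply/mem_set/scaled_eventP => //; apply: cP => [|u u' u1 u'1]; first exact: Err0.
  apply: (le_trans (Err_lip _ _ u1 u'1)); first by near: m; exact: eps1.
  by rewrite ler_wpM2r//; near: m; exact: eps_small.
have nz (t : 'rV[R]_N) : (forall j, 0 <= t 0 j <= 1) -> etaV iota x + t *m linM iota B x != 0.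
  move=> t01; apply/eqP => F0; apply: no; exists t; split=> // j.
  by rewrite /Flin F0 mxE.
have [c c0 cP] := zero_absent nz.
near=> m; rewrite [RHS]memNset; last first.
  by move=> [t [t01 Ft]]; apply: no; exists t; split=> // j; have /andP[-> /ltW ->] := t01 j.
apply/memNset => /scaled_eventP => /(_ (eps0 m))[t t01 H0].
have t01' j : 0 <= t 0 j <= 1 by have /andP[-> /ltW ->] := t01 j.
have : etaV iota x + t *m linM iota B x + Err (eps m) x t != 0.
  apply: cP => // u u01; rewrite -[Err _ _ _]subr0 -(Err0 (eps m) x).
  apply: (le_trans (Err_lip _ _ _ _)); [by near: m; exact: eps1|exact: norm1|by rewrite normr0|].
  rewrite subr0 (@le_trans _ _ (C0 * eps m * X x))//.
    have h0 : 0 <= C0 * eps m * X x by rewrite mulr_ge0// mulr_ge0// ltW.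
    by rewrite ler_piMr ?norm1.
  by near: m; exact: eps_small.
by rewrite H0 eqxx.
Unshelve. all: by end_near. Qed.

Let Xr (x : E) := \sum_(k | rest k) `|x k|.

(** The inequality $2ab \le a^2+b^2$ summed over all pairs. *)
Let cauchy (I : finType) (P : pred I) (f : I -> R) : (forall i, 0 <= f i) ->
  (\sum_(i | P i) f i) ^+ 2 <= #|I|%:R * \sum_(i | P i) f i ^+ 2.
Proof.
move=> f0; rewrite expr2 mulr_suml.
apply: (@le_trans _ _ (\sum_(i | P i) \sum_(j | P j) (f i ^+ 2 + f j ^+ 2) / 2)).
  apply: ler_sum => i _; rewrite mulr_sumr; apply: ler_sum => j _.
  by rewrite ler_pdivlMr//; have := sqr_ge0 (f i - f j); rewrite sqrrB; lra.
have S0 : 0 <= \sum_(i | P i) f i ^+ 2 by apply: sumr_ge0 => i _; exact: sqr_ge0.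
have c1 : #|[pred i | P i]|%:R <= #|I|%:R :> R by rewrite ler_nat max_card.
set S := \sum_(i | P i) f i ^+ 2 in S0 *.
have -> : \sum_(i | P i) \sum_(j | P j) (f i ^+ 2 + f j ^+ 2) / 2
    = #|[pred i | P i]|%:R * S.
  transitivity (\sum_(i | P i) (#|[pred i | P i]|%:R * f i ^+ 2 + S) / 2).
    apply: eq_bigr => i _; rewrite -mulr_suml; congr (_ / 2).
    by rewrite big_split /= sumr_const mulr_natl.
  rewrite -mulr_suml big_split /= -mulr_sumr sumr_const -/S -[S *+ _]mulr_natl.
  by set c := _%:R; move: (c) (S) => u v; field.
by rewrite ler_wpM2r.
Qed.

Let sum_rest (f : 'I_K -> R) :
  \sum_k f k = \sum_(k | rest k) f k + \sum_j f (iota j).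
Proof.
rewrite (bigID rest) /=; congr (_ + _).
rewrite [RHS](partition_big iota xpredT)//= [LHS]big_mkcond /=.
apply: eq_bigr => k _; case: ifPn => [/not_rest[j ->]|].
  by rewrite (big_pred1 j)// => i; rewrite (inj_eq iota_inj).
rewrite negbK => /forallP rk; rewrite big_pred0// => j.
exact/negbTE.
Qed.

(** A zero expresses the coordinates [iota j] through the rest and the error. The error involves
    them again, but with a coefficient tending to 0, and is absorbed. This replaces the decay lost
    when their Gaussian weight is flattened. *)
Let dominated : exists2 C3 : R, 0 < C3 & \forall m \near \oo, forall x,
  scaled_event (eps m) x ->
  \sum_j x (iota j) ^+ 2 <= C3 * \sum_(k | rest k) x k ^+ 2.
Proof.
pose C1 := \sum_j \sum_k \sum_l `|B j k l|.
have C10 : 0 <= C1.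
  by apply: sumr_ge0 => j _; apply: sumr_ge0 => k _; exact: sumr_ge0.
(* The factor 2 comes from absorbing half of [Xi] into the left-hand side. *)
pose C2 := 2 * (N%:R * C1 + 1).
have C20 : 0 < C2 by rewrite mulr_gt0// ltr_wpDl// mulr_ge0.
exists (C2 ^+ 2 * K%:R + 1); first by rewrite ltr_wpDl// mulr_ge0// sqr_ge0.
near=> m => x /scaled_eventP => /(_ (eps0 m))[t t01 H0].
have e01 : 0 < eps m <= 1 by near: m; exact: eps1.
have small : N%:R * (C0 * eps m) <= 2^-1.
  rewrite mulrC; near: m; apply: eps_small => //.
have t1 : `|t| <= 1 by apply: norm1 => j; have /andP[-> /ltW ->] := t01 j.
have Xr0 : 0 <= Xr x by exact: sumr_ge0.
pose Xi := \sum_j `|x (iota j)|.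
have Xi0 : 0 <= Xi by exact: sumr_ge0.
have XE : X x = Xi + Xr x by rewrite /X sum_rest addrC.
have X0 : 0 <= X x by exact: sumr_ge0.
have xj j : `|x (iota j)| <= C1 * Xr x + C0 * eps m * X x.
  have := congr1 (fun v : 'rV[R]_N => v 0 j) H0.
  rewrite [LHS]mxE [X in X + _]mxE [X in X + _ + _]mxE [RHS]mxE -addrA.
  move/eqP; rewrite addr_eq0 => /eqP ->; rewrite normrN.
  apply: (le_trans (ler_normD _ _)); apply: lerD; last first.
    apply: (le_trans (rV_norm_coord _ _)).
    rewrite -[Err _ _ _]subr0 -(Err0 (eps m) x).
    apply: (le_trans (Err_lip _ _ t1 _)); rewrite ?normr0//.
    by rewrite subr0 ler_piMr// mulr_ge0// mulr_ge0// ltW//; case/andP: e01.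
  rewrite mxE (le_trans (ler_norm_sum _ _ _))//.
  apply: (@le_trans _ _ (\sum_l \sum_k `|B j k l| * Xr x)).
    apply: ler_sum => l _; rewrite normrM -[leRHS]mul1r ler_pM//.
      exact: (le_trans (rV_norm_coord _ _)).
    rewrite mxE (le_trans (ler_norm_sum _ _ _))// big_mkcond /=.
    apply: ler_sum => k _; case: ifPn => rk; last by rewrite mulr_ge0.
    by rewrite normrM mulrC ler_wpM2l// /Xr (bigD1 k)//= lerDl sumr_ge0.
  under eq_bigr do rewrite -mulr_suml.
  rewrite -mulr_suml ler_wpM2r// exchange_big /= /C1 [leRHS](bigD1 j)//= lerDl.
  by apply: sumr_ge0 => i _; apply: sumr_ge0 => k _; exact: sumr_ge0.
have XiXr : Xi <= C2 * Xr x.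
  have : Xi <= N%:R * (C1 * Xr x + C0 * eps m * X x).
    apply: (le_trans (ler_sum _ (fun j _ => xj j))).
    by rewrite [leLHS]sumr_const card_ord [leRHS]mulr_natl.
  have : N%:R * (C0 * eps m) * X x <= 2^-1 * X x by rewrite ler_wpM2r.
  rewrite /C2 XE => h1 h2.
  have {}h2 : Xi <= N%:R * C1 * Xr x + 2^-1 * (Xi + Xr x).
    apply: (le_trans h2); rewrite mulrDr mulrA lerD2l.
    by move: h1; rewrite !mulrA.
  have -> : 2 * (N%:R * C1 + 1) * Xr x = 2 * (N%:R * C1 * Xr x) + 2 * Xr x by ring.
  by move: h2; set q := N%:R * C1 * Xr x => h2; lra.
apply: (@le_trans _ _ (Xi ^+ 2)).
  rewrite expr2 {1}/Xi mulr_suml; apply: ler_sum => j _.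
  rewrite -real_normK ?num_real// expr2 ler_wpM2l// /Xi (bigD1 j)//= lerDl.
  exact: sumr_ge0.
apply: (@le_trans _ _ ((C2 * Xr x) ^+ 2)).
  by rewrite lerXn2r// ?nnegrE// mulr_ge0// ltW.
have S0 : 0 <= \sum_(k | rest k) x k ^+ 2 by apply: sumr_ge0 => k _; exact: sqr_ge0.
have Xr2 : Xr x ^+ 2 <= K%:R * \sum_(k | rest k) x k ^+ 2.
  apply: (le_trans (cauchy rest (fun k => normr_ge0 (x k)))); rewrite card_ord.
  rewrite ler_wpM2l//; apply: ler_sum => k _.
  by rewrite real_normK ?num_real.
rewrite exprMn [leRHS]mulrDl mul1r -[_ * K%:R * _]mulrA.
apply: (@le_trans _ _ (C2 ^+ 2 * (K%:R * \sum_(k | rest k) x k ^+ 2))).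
  by rewrite ler_wpM2l// sqr_ge0.
by rewrite lerDl.
Unshelve. all: by end_near. Qed.

Let densE_vv e (x : E) : densE (fun k => vv e k * x k) =
  Num.sqrt pi ^- K * expR (- (\sum_(k | rest k) x k ^+ 2
     + e * (e * \sum_j (s j * x (iota j)) ^+ 2))).
Proof.
rewrite [LHS]densE_expR; congr (_ * expR (- _)); rewrite [LHS]sum_rest; congr (_ + _).
  by apply: eq_bigr => k rk; rewrite vv_rest// mul1r.
rewrite [RHS]mulrA [RHS]mulr_sumr; apply: eq_bigr => j _; rewrite vv_iota.
by rewrite -expr2 -exprMn; congr (_ ^+ 2); rewrite mulrA.
Qed.

Let fm m (x : E) : R := \1_(scaled_event (eps m)) x * densE (fun k => vv (eps m) k * x k).

Let fm_ge0 m x : 0 <= fm m x.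
Proof. by rewrite mulr_ge0// densE_ge0. Qed.

Let mfm m : measurable_fun setT (fm m).
Proof.
apply: measurable_funM; last first.
  exact: (measurableT_comp (@measurable_densE R K) (measurable_scaleE (vv (eps m)))).
apply: measurable_indic; rewrite -[X in measurable X]setTI.
by apply: measurable_scaleE => //; exact: measurable_small_event.
Qed.

Let fm_cvg x : ~ degenerate iota B x ->
  fm m x @[m --> \oo] --> \1_(cone_event iota B) x * rest_density iota x.
Proof.
move=> ndx.
have h : \1_(cone_event iota B) x * densE (fun k => vv (eps m) k * x k) @[m --> \oo] -->
    \1_(cone_event iota B) x * rest_density iota x.
  apply: cvgM; first exact: cvg_cst.
  under eq_fun do rewrite densE_vv.
  apply: cvgM; first exact: cvg_cst.
  apply: (@cvg_comp _ _ _ _ expR _ (nbhs (- \sum_(k | rest k) x k ^+ 2))); last exact: continuous_expR.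
  apply: cvgN; rewrite -[X in _ --> X]addr0; apply: cvgD; first exact: cvg_cst.
  set q := \sum_j _.
  have q0 : eps m * (eps m * q) @[m --> \oo] --> 0 * (0 * q).
    by apply: cvgM => //; apply: cvgM => //; exact: cvg_cst.
  by rewrite mul0r in q0.
apply: cvg_trans h; apply: near_eq_cvg; near=> m.
rewrite /fm !indicE; congr (_%:R * _).
by near: m; apply: filterS (scaled_event_cvg ndx) => k ->.
Unshelve. all: by end_near. Qed.

Let dominating (c : 'I_K -> R) (x : E) : R :=
  Num.sqrt pi ^- K * expR (- \sum_k c k * x k ^+ 2).

(** Scaling each coordinate by the square root of [c k] turns the function into [densE], whose
    integral is 1. *)
Let integrable_dominating (c : 'I_K -> R) : (forall k, 0 < c k) ->
  (lebE : {measure set E -> \bar R}).-integrable setT (EFin \o dominating c).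
Proof.
move=> c0; pose v : E := fun k => Num.sqrt (c k).
have v0 k : 0 < v k by rewrite sqrtr_gt0.
have dE : dominating c = fun x => densE (fun k => v k * x k).
  apply: funext => x; rewrite densE_expR /dominating; congr (_ * expR (- _)).
  by apply: eq_bigr => k _; rewrite exprMn sqr_sqrtr// ltW.
have md := @measurable_densE R K.
have mdv : measurable_fun setT (EFin \o dominating c).
  by rewrite dE; apply/measurable_EFinP; exact: (measurableT_comp md (measurable_scaleE v)).
apply/integrableP; split => //.
have := @integral_densE R K.
rewrite (ge0_integral_scaleE (f := fun x => (densE x)%:E) v0); last 2 first.
- by apply/measurable_EFinP; exact: md.
- by move=> x; rewrite lee_fin densE_ge0.
- rewrite (_ : (\int[lebE]_x `|(EFin \o dominating c) x|)%E =
      (\int[lebE]_x (densE (fun i => v i * x i))%:E)%E); last first.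
    by rewrite dE; apply: eq_integral => x _ /=; rewrite ger0_norm// densE_ge0.
  move=> h; rewrite ltey; apply/eqP => hoo; move: h; rewrite hoo gt0_muley//.
  by rewrite lte_fin; apply: prodr_gt0.
Qed.

Let integral_fm_cvg : (\int[lebE]_x (fm m x)%:E @[m --> \oo] --> local_const iota B)%E.
Proof.
have [C3 C30 [M0 _ M0P]] := dominated.
(* Half of the exponent in the rest coordinates is kept; the other half bounds the exponent $1/(2
   C_3)$ in the coordinates [iota j], by [dominated]. *)
pose c k := if rest k then 2^-1 else (2 * C3)^-1.
have c0 k : 0 < c k by rewrite /c; case: ifPn; rewrite invr_gt0// mulr_gt0.
(* The bound holds only from index [M0] on, while the convergence theorem asks for it at every
   index. *)
rewrite -(cvg_shiftn M0).
pose f_ n x := (fm (n + M0) x)%:E.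
pose f x := (\1_(cone_event iota B) x * rest_density iota x)%:E.
have [] := @dominated_convergence _ _ _ (lebE : {measure set E -> \bar R}) setT
  measurableT f_ f (EFin \o dominating c).
- by move=> n; apply/measurable_EFinP; exact: mfm.
- apply/measurable_EFinP; apply: measurable_funM; last exact: measurable_rest_density.
  by apply: measurable_indic; exact: measurable_cone_event.
- exists (degenerate iota B); split.
  + exact: measurable_degenerate.
  + exact: degenerate_null.
  + move=> x /=; apply: contra_notP => ndx _.
    apply: cvg_EFin; first exact: nearW.
    rewrite (_ : fine \o _ = fun n => fm (n + M0) x)//.
    by rewrite (cvg_shiftn M0 (fun m => fm m x)); exact: fm_cvg.
- exact: integrable_dominating.
- apply: aeW => x n _ /=; rewrite lee_fin ger0_norm ?fm_ge0// /dominating /fm indicE.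
  have [/set_mem xE|_] := boolP (_ \in _); last first.
    by rewrite mul0r mulr_ge0 ?expR_ge0// invr_ge0 exprn_ge0.
  rewrite mul1r densE_vv ler_wpM2l ?invr_ge0 ?exprn_ge0// ler_expR lerN2.
  have := M0P (n + M0)%N (leq_addl _ _) x xE; rewrite sum_rest.
  have -> : \sum_(k | rest k) c k * x k ^+ 2 = 2^-1 * \sum_(k | rest k) x k ^+ 2.
    by rewrite mulr_sumr; apply: eq_bigr => k rk; rewrite /c rk.
  have -> : \sum_j c (iota j) * x (iota j) ^+ 2 = (2 * C3)^-1 * \sum_j x (iota j) ^+ 2.
    rewrite mulr_sumr; apply: eq_bigr => j _; rewrite /c ifN//.
    by apply/forallPn; exists j; rewrite eqxx.
  set Si := \sum_j _; set Sr := \sum_(k | _) _ => SiSr.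
  have : (2 * C3)^-1 * Si <= 2^-1 * Sr.
    by rewrite invfM -mulrA ler_pM2l// mulrC ler_pdivrMr// mulrC.
  have : 0 <= eps (n + M0) * (eps (n + M0) * \sum_j (s j * x (iota j)) ^+ 2).
    rewrite mulr_ge0 ?(ltW (eps0 _))// mulr_ge0 ?(ltW (eps0 _))// sumr_ge0// => j _.
    exact: sqr_ge0.
  lra.
by move=> _ _.
Qed.

(** Of the Jacobian $e^N \prod_j s_j$ of the blow-up, the power of [e] cancels the prefactor and the
    product remains. *)
Theorem local_limit :
  ((eps m ^- N)%:E * @gaussE R K (small_event (eps m)) @[m --> \oo] -->
    (\prod_j s j)%:E * local_const iota B)%E.
Proof.
rewrite (_ : (fun m => _) = (fun m => (\prod_j s j)%:E * \int[lebE]_x (fm m x)%:E)%E).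
  by apply: cvgeZl.
apply: funext => m; rewrite gaussE_dens; last exact: measurable_small_event.
rewrite (ge0_integral_scaleE (v := vv (eps m))); last 3 first.
- by move=> k; exact: vv_gt0.
- apply/measurable_EFinP; apply: measurable_funM; last exact: measurable_densE.
  by apply: measurable_indic; exact: measurable_small_event.
- by move=> x; rewrite lee_fin mulr_ge0// densE_ge0.
rewrite muleA -EFinM prod_vv mulrA mulVf ?mul1r//.
by rewrite expf_neq0// gt_eqF.
Qed.

End LocalLimit.

(** * Gram matrices *)

Section Gram.
Variable R : rcfType.

Definition posdef k (S : 'M[R]_k) :=
  S^T = S /\ forall v : 'rV_k, v != 0 -> 0 < (v *m S *m v^T) 0 0.

Lemma sqr_norm_gt0 k (v : 'rV[R]_k) : v != 0 -> 0 < (v *m v^T) 0 0.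
Proof.
have vE : (v *m v^T) 0 0 = \sum_j v 0 j ^+ 2.
  by rewrite mxE; apply: eq_bigr => j _; rewrite mxE expr2.
rewrite vE lt_def sumr_ge0 ?andbT; last by move=> j _; exact: sqr_ge0.
apply: contra_neq => /psumr_eq0P v0; apply/rowP => j; rewrite mxE.
by apply/eqP; rewrite -sqrf_eq0 v0// => i _; exact: sqr_ge0.
Qed.

Lemma gram_posdef k l (T : 'M[R]_(k, l)) : row_free T -> posdef (T *m T^T).
Proof.
move=> Tf; split=> [|v v0]; first by rewrite trmx_mul trmxK.
rewrite mulmxA -(mulmxA _ T^T) -trmx_mul; apply: sqr_norm_gt0.
by rewrite mulmx_free_eq0.
Qed.

(** Induction on the size: the Schur complement of the first diagonal entry is again positive
    definite. *)
Lemma cholesky k (S : 'M[R]_k) : posdef S -> exists2 B, B \in unitmx & S = B *m B^T.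
Proof.
elim: k S => [S _|k IH].
  by exists 1%:M; rewrite ?unitmx1//; apply/matrixP => -[].
rewrite -[k.+1]/(1 + k)%N => S [Ssym Spos].
pose a := S 0 0; pose u := ursubmx S; pose C := drsubmx S.
have SE : S = block_mx a%:M u u^T C.
  rewrite -[LHS]submxK; congr block_mx; last first.
    by rewrite -[in LHS]Ssym trmx_ursub.
  by apply/matrixP => i j; rewrite !ord1 !mxE !eqxx mulr1n; congr (S _ _); apply: val_inj.
have Csym : C^T = C by rewrite /C -[in RHS]Ssym trmx_drsub.
have a0 : 0 < a.
  have /Spos : (delta_mx 0 0 : 'rV[R]_(1 + k)) != 0.
    by apply/eqP => /rowP/(_ 0); rewrite !mxE !eqxx => /eqP; rewrite oner_eq0.
  by rewrite -rowE trmx_delta -colE !mxE.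
pose S' := C - a^-1 *: (u^T *m u).
have S'pos : posdef S'.
  split=> [|v v0].
    by rewrite /S' linearB linearZ /= trmx_mul trmxK Csym.
  (* For fixed [v] this first coordinate minimises the quadratic form, and the minimum is the Schur
     complement evaluated at [v]. *)
  have /Spos : row_mx (- a^-1 *: (v *m u^T)) v != 0.
    by apply: contra_neq v0 => /(congr1 rsubmx); rewrite row_mxKr linear0.
  congr (0 < _); rewrite [in LHS]SE tr_row_mx mul_row_block mul_row_col.
  congr (fun_of_matrix _ 0 0).
  rewrite mul_mx_scalar scalerA mulrN mulfV ?gt_eqF// scaleN1r addNr mul0mx add0r.
  by rewrite mulmxDl /S' mulmxBr mulmxBl addrC -!scalemxAl -scalemxAr -scalemxAl !scaleNr !mulmxA.
have [L Lu S'E] := IH _ S'pos.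
pose s := Num.sqrt a; have s0 : 0 < s by rewrite sqrtr_gt0.
have ss : s * s = a by rewrite -expr2 sqr_sqrtr// ltW.
exists (block_mx s%:M 0 (s^-1 *: u^T) L).
  by rewrite unitmxE det_lblock det_scalar1 unitrM unitfE gt_eqF//= -unitmxE.
rewrite SE tr_block_mx mulmx_block !trmx0 !mul0mx !mulmx0 !addr0 tr_scalar_mx.
rewrite -scalar_mxM ss linearZ /= trmxK mul_scalar_mx mul_mx_scalar !scalerA.
rewrite mulfV ?gt_eqF// !scale1r -S'E; congr block_mx.
by rewrite -scalemxAl -scalemxAr scalerA -invfM ss /S' addrC subrK.
Qed.

(** A basis of the orthogonal complement of the rows is made orthonormal by the inverse Cholesky
    factor of its Gram matrix. *)
Lemma orthonormal_completion k r (Q : 'M[R]_(k, k + r)) : Q *m Q^T = 1%:M ->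
  exists Q' : 'M[R]_(r, k + r), col_mx Q Q' *m (col_mx Q Q')^T = 1%:M.
Proof.
move=> QQ; pose A := kermx Q^T.
have rkQ : \rank Q = k.
  apply/eqP; rewrite eqn_leq rank_leq_row -[X in (X <= _)%N](@mxrank1 R k) -QQ.
  exact: mxrankM_maxl.
have rkA : \rank A = r by rewrite mxrank_ker mxrank_tr rkQ addKn.
have : row_base A *m Q^T = 0 by apply/sub_kermxP; rewrite eq_row_base.
have : row_free (row_base A) by exact: row_base_free.
move: (row_base A); rewrite rkA => K Kf KQ.
have [B Bu BE] := cholesky (gram_posdef Kf).
exists (invmx B *m K).
have QK : Q *m K^T = 0 by rewrite -[LHS]trmxK trmx_mul trmxK KQ trmx0.
rewrite tr_col_mx mul_col_row QQ trmx_mul -mulmxA KQ mulmx0 mulmxA QK mul0mx.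
rewrite mulmxA -(mulmxA (invmx B)) BE mulmxA mulVmx// mul1mx trmx_inv.
by rewrite mulmxV ?unitmx_tr// scalar_mx_block.
Qed.

End Gram.

(** * Lipschitz bounds for sine and cosine *)

Section Trig.
Variable R : realType.
Implicit Types a b rho : R.

Lemma derive_lip (f df : R -> R) (c rho : R) :
  (forall x : R, is_derive x (1 : R) f (df x)) -> (forall x, `|x| <= rho -> `|df x| <= c) ->
  forall a b, `|a| <= rho -> `|b| <= rho -> `|f a - f b| <= c * `|a - b|.
Proof.
move=> fdf dfc a b; wlog ab : a b / b <= a.
  move=> h ar br; have [ab|/ltW ab] := leP b a; first exact: h.
  by rewrite distrC [in leRHS]distrC h.
move=> ar br; have [|x xab ->] := @MVT_segment R f df b a ab.
  apply: continuous_subspaceT => x.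
  by apply/differentiable_continuous/derivable1_diffP; have [] := fdf x.
rewrite normrM ler_wpM2r// dfc//.
move: xab ar br; rewrite in_itv /= !ler_norml => /andP[? ?] /andP[? ?] /andP[? ?].
by apply/andP; split; lra.
Qed.

Lemma sin_le a : `|sin a| <= `|a|.
Proof.
have := @derive_lip sin cos 1 `|a| (@is_derive_sin R) (fun x _ => cos_max x) a 0 (lexx _).
by rewrite normr0 normr_ge0 sin0 !subr0 mul1r; apply.
Qed.

Lemma cos_lip rho a b : `|a| <= rho -> `|b| <= rho ->
  `|cos a - cos b| <= rho * `|a - b|.
Proof.
apply: (@derive_lip cos (fun x => - sin x) rho rho (@is_derive_cos R)) => x.
by rewrite normrN; exact: le_trans (sin_le x).
Qed.

Lemma sin_lip rho a b : `|a| <= rho -> `|b| <= rho ->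
  `|(sin a - a) - (sin b - b)| <= rho * `|a - b|.
Proof.
apply: (@derive_lip (fun x => sin x - x) (fun x => cos x - 1)) => x.
apply: le_trans.
have := @derive_lip cos (fun x => - sin x) 1 `|x| (@is_derive_cos R) _ x 0 (lexx _).
rewrite normr0 normr_ge0 cos0 !subr0 mul1r; apply => // y _.
by rewrite normrN sin_max.
Qed.

End Trig.

(** * Random trigonometric systems *)

Section OrthogonalMatrix.
Context {R : realType} {K : nat}.
Notation E := (euclidean R K).
Variable V : 'M[R]_K.
Hypothesis VV : V *m V^T = 1%:M.

Let VtV : V^T *m V = 1%:M.
Proof. exact: mulmx1C. Qed.

Definition mx_action (x : E) : E := fun k => \sum_k' V k k' * x k'.

Let col_of (x : E) : 'cV[R]_K := \col_k x k.

Let mx_actionE x k : mx_action x k = (V *m col_of x) k 0.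
Proof. by rewrite mxE; apply: eq_bigr => j _; rewrite mxE. Qed.

Let norm_col x : \sum_k x k ^+ 2 = ((col_of x)^T *m col_of x) 0 0.
Proof. by rewrite mxE; apply: eq_bigr => k _; rewrite !mxE expr2. Qed.

Lemma measurable_mx_action : measurable_fun setT mx_action.
Proof.
apply: measurable_prodP => k; apply: measurable_bigsum => k'.
by apply: measurable_funM => //; exact: measurable_proj.
Qed.

Lemma gaussE_mx_action (A : set E) : measurable A ->
  gaussE K A = gaussE K (mx_action @^-1` A).
Proof.
move=> mA.
pose O' (y : E) : E := fun k' => \sum_k V k k' * y k.
rewrite (@gaussE_orthogonal R K mx_action O')//.
- move=> x y i; rewrite -big_split /=; apply: eq_bigr => k _; ring.
- move=> y; apply: funext => k; rewrite mx_actionE.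
  rewrite (_ : col_of (O' y) = V^T *m col_of y); first by rewrite mulmxA VV mul1mx mxE.
  by apply/colP => i; rewrite !mxE; apply: eq_bigr => j _; rewrite !mxE.
- exact: measurable_mx_action.
- move=> x; rewrite !norm_col; congr (fun_of_matrix _ 0 0).
  have -> : col_of (mx_action x) = V *m col_of x by apply/colP => i; rewrite mxE mx_actionE.
  by rewrite trmx_mul -mulmxA (mulmxA V^T) VtV mul1mx.
Qed.

(** Rotating the coordinates and the basis functions by the same orthogonal matrix does not change
    the field. *)
Lemma field_mx_action N (H : 'I_N -> 'I_K -> 'rV[R]_N -> R) x t j :
  field (fun j k t => \sum_k' V k k' * H j k' t) (mx_action x) t j = field H x t j.
Proof.
rewrite /field /mx_action.
transitivity (\sum_k' \sum_k'' x k' * H j k'' t * (V^T *m V) k' k'').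
  under eq_bigr do rewrite mulr_suml; rewrite exchange_big /=.
  apply: eq_bigr => k' _.
  under eq_bigr do rewrite mulr_sumr; rewrite exchange_big /=.
  apply: eq_bigr => k'' _; rewrite !mxE mulr_sumr; apply: eq_bigr => k _.
  by rewrite !mxE; ring.
apply: eq_bigr => k _; rewrite VtV (bigD1 k)//= big1 ?addr0 ?mxE ?eqxx ?mulr1// => i.
by rewrite mxE eq_sym => /negbTE ->; rewrite mulr0.
Qed.

End OrthogonalMatrix.

Lemma sum_enum_val (R : realType) (I : finType) (F : I -> R) :
  \sum_(k < #|{: I}|) F (enum_val k) = \sum_c F c.
Proof. by rewrite [RHS](reindex _ (onW_bij _ (@enum_val_bij I))). Qed.

Lemma sum_pair (R : realType) (I J : finType) (F : I * J -> R) :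
  \sum_c F c = \sum_a \sum_b F (a, b).
Proof. by rewrite pair_bigA; apply: eq_bigr => -[]. Qed.

Definition kernel_mx (R : realType) (I : finType) (v : I -> I -> R) : 'M[R]_#|{: I}| :=
  \matrix_(k, k') v (enum_val k) (enum_val k').

Lemma kernel_mx_orthogonal (R : realType) (I : finType) (v : I -> I -> R) :
  (forall a b, \sum_c v a c * v b c = (a == b)%:R) ->
  kernel_mx v *m (kernel_mx v)^T = 1%:M.
Proof.
move=> vv; apply/matrixP => k k'; rewrite !mxE.
transitivity (\sum_c v (enum_val k) c * v (enum_val k') c).
  by rewrite -[RHS]sum_enum_val; apply: eq_bigr => i _; rewrite !mxE.
by rewrite vv (inj_eq enum_val_inj).
Qed.

Section TrigSystem.
Context {R : realType} {n M N : nat} (e : 'I_N -> 'I_n * bool).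
Hypothesis eb : bijective e.
Notation I := ('I_n * 'I_M * bool)%type.
Notation K := #|{: I}|.
Notation E := (euclidean R K).

(** Multiplication by $e^{ia}$ as a real matrix, with [false] for the real part and [true] for the
    imaginary part. *)
Definition rot2 (a : R) (b b' : bool) : R :=
  if b == b' then cos a else if b then sin a else - sin a.

(* The derivative of [rot2 a b b'] at [a = 0]. *)
Definition drot2 (b b' : bool) : R := if b == b' then 0 else if b then 1 else -1.

Lemma rotD a a' b b' : rot2 (a + a') b b' = \sum_c rot2 a b c * rot2 a' c b'.
Proof.
by rewrite big_bool /rot2; case: b b' => -[]/=; rewrite ?sinD ?cosD; ring.
Qed.

Lemma rot_orthogonal a b b' : \sum_c rot2 a b c * rot2 a b' c = (b == b')%:R.
Proof.
have := cos2Dsin2 a; rewrite !expr2 => cs.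
by rewrite big_bool /rot2; case: b b' => -[]/=; rewrite -?cs; ring.
Qed.

(** What remains after removing the linear term has derivative at most [rho] on $[-\rho,\rho]$. This
    is second-order smallness in the form used by the local limit. *)
Lemma rot_lip rho (a a' : R) b b' : `|a| <= rho -> `|a'| <= rho ->
  `|(rot2 a b b' - drot2 b b' * a) - (rot2 a' b b' - drot2 b b' * a')| <= rho * `|a - a'|.
Proof.
rewrite /rot2 /drot2 => ha ha'; case: eqP => _.
  by rewrite !mul0r !subr0; exact: cos_lip.
case: b; first by rewrite !mul1r; exact: sin_lip.
rewrite !mulN1r !opprK -normrN.
have -> : - (- sin a + a - (- sin a' + a')) = (sin a - a) - (sin a' - a') by ring.
exact: sin_lip.
Qed.

Variables (w : 'I_n -> 'I_M -> R) (q : 'I_n -> 'I_M -> 'I_N -> R).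

Definition phase (p : 'I_N -> R) (t : 'rV[R]_N) : R := \sum_l t 0 l * p l.

Lemma phaseD p t t' : phase p (t + t') = phase p t + phase p t'.
Proof. by rewrite -big_split /=; apply: eq_bigr => l _; rewrite mxE mulrDl. Qed.

Lemma phaseB p t t' : phase p t - phase p t' = phase p (t - t').
Proof. by rewrite -sumrB; apply: eq_bigr => l _; rewrite !mxE mulrBl. Qed.

Lemma phase0 p : phase p 0 = 0.
Proof. by rewrite /phase big1// => l _; rewrite mxE mul0r. Qed.

Lemma phase_le p t : `|phase p t| <= (\sum_l `|p l|) * `|t|.
Proof.
rewrite (le_trans (ler_norm_sum _ _ _))// mulr_suml; apply: ler_sum => l _.
by rewrite normrM mulrC ler_wpM2l// rV_norm_coord.
Qed.

(* The real equation [j] is the real ([b = false]) or imaginary ([b = true]) part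
   of the complex equation [i], where [e j = (i, b)]; likewise a flat coordinate
   [((i, m), b)] is the real or imaginary part of the [m]-th coefficient of [f_i]. *)
Definition trig_basis (j : 'I_N) (c : I) (t : 'rV[R]_N) : R :=
  ((e j).1 == c.1.1)%:R * Num.sqrt (w c.1.1 c.1.2)
    * rot2 (phase (q c.1.1 c.1.2) t) (e j).2 c.2.

Definition trig_H j (k : 'I_K) t := trig_basis j (enum_val k) t.

Lemma continuous_phase p : continuous (phase p).
Proof.
apply: continuous_bigsum => l t.
apply: (@continuousM _ _ (fun t : 'rV[R]_N => t 0 l) (cst (p l))); last exact: cst_continuous.
exact: coord_continuous.
Qed.

Lemma continuous_rot b b' : continuous (fun a => rot2 a b b').
Proof.
rewrite /rot2 => a; case: (b == b'); first exact: continuous_cos.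
by case: b; [|apply: continuousN]; exact: continuous_sin.
Qed.

Lemma continuous_trig_H j k : continuous (trig_H j k).
Proof.
move=> t.
apply: (@continuousM _ _ (cst _) (fun t => rot2 (phase (q (enum_val k).1.1 (enum_val k).1.2) t) (e j).2 (enum_val k).2)).
  exact: cst_continuous.
apply: (continuous_comp (f := phase _) (g := fun a => rot2 a _ _)).
  exact: continuous_phase.
exact: continuous_rot.
Qed.

Definition trig_zeros (x : E) : set 'rV[R]_N :=
  [set t | unit_cube t /\ forall j, field trig_H x t j = 0].

Section Stationarity.
Variable t0 : 'rV[R]_N.

(** Each complex coefficient is rotated by its own phase at [t0]. *)
Let v (c c' : I) :=
  (c.1 == c'.1)%:R * rot2 (phase (q c.1.1 c.1.2) t0) c.2 c'.2.

Let vv a b : \sum_c v a c * v b c = (a == b)%:R.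
Proof.
rewrite sum_pair (bigD1 a.1)//= [X in _ + X]big1 ?addr0; last first.
  by move=> c1 ac; apply: big1 => b' _; rewrite /v /= eq_sym (negbTE ac) !mul0r.
case: (eqVneq b.1 a.1) => [ba|ba]; last first.
  rewrite big1 => [|c _]; last by rewrite /v /= (negbTE ba) mul0r mulr0.
  by case: eqP => // ab; rewrite ab eqxx in ba.
under eq_bigr do rewrite /v /= ba eqxx !mul1r; rewrite rot_orthogonal.
by case: a b ba => a1 a2 [b1 b2]/= <-; rewrite xpair_eqE eqxx.
Qed.

(** By the addition formulas a translation of [t] by [t0] multiplies each coefficient by a unit
    complex number, an orthogonal change of the Gaussian coordinates. *)
Lemma trig_shift x t j :
  field trig_H x (t + t0) j = field trig_H (mx_action (kernel_mx v) x) t j.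
Proof.
rewrite /field /mx_action.
transitivity (\sum_c' \sum_c x (enum_rank c') * (v c c' * trig_basis j c t)).
  rewrite -[RHS]sum_enum_val; apply: eq_bigr => k _; rewrite enum_valK -mulr_sumr; congr (_ * _).
  set c' := enum_val k; rewrite [RHS]sum_pair [RHS](bigD1 c'.1)//= [X in _ = _ + X]big1 ?addr0; last first.
    by move=> c1 ac; apply: big1 => b' _; rewrite /v /= (negbTE ac) !mul0r.
  rewrite /trig_H -/c' /trig_basis phaseD rotD mulr_sumr; apply: eq_bigr => b _.
  by rewrite /v /= eqxx mul1r; ring.
rewrite exchange_big /= -[LHS]sum_enum_val; apply: eq_bigr => k _.
rewrite mulr_suml -[LHS]sum_enum_val; apply: eq_bigr => k' _.
by rewrite enum_valK mxE /trig_H; ring.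
Qed.

Lemma trig_cell_probability (a : R) :
  gaussE K [set x | exists t : 'rV[R]_N, (forall j, 0 <= t 0 j < 1) /\
    forall j, field trig_H x (a *: t + t0) j = 0] =
  gaussE K (small_event trig_H a).
Proof.
rewrite [RHS](gaussE_mx_action (kernel_mx_orthogonal vv)); last first.
  by apply: measurable_small_event; exact: continuous_trig_H.
by congr (gaussE K _); apply/seteqP; split=> x [t [t01 h]]; exists t; split=> // j;
  have := h j; rewrite trig_shift.
Qed.

End Stationarity.

Section Rotation.
Variables (k0 : 'I_M) (U : 'I_n -> 'M[R]_M) (Bt : 'I_n -> 'I_M -> 'I_N -> R) (c : 'I_n -> R).
Hypotheses (c0 : forall i, 0 < c i) (UU : forall i, U i *m (U i)^T = 1%:M)
  (U0 : forall i k, \sum_m U i k m * Num.sqrt (w i m) = (k == k0)%:R)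
  (U1 : forall i k l, \sum_m U i k m * Num.sqrt (w i m) * q i m l = c i * Bt i k l).

(** [U i] acts alike on real and imaginary parts of the coefficients of the [i]-th equation. By [U0]
    it sends the vector of square roots of the weights to the basis vector [k0], so at the origin
    each equation reads a single coordinate; [U1] gives the derivatives in the new coordinates. *)
Let u (a b : I) := (a.1.1 == b.1.1)%:R * (a.2 == b.2)%:R * U a.1.1 a.1.2 b.1.2.

Let sum_block (a : I) (F : I -> R) :
  \sum_b (a.1.1 == b.1.1)%:R * (a.2 == b.2)%:R * F b = \sum_m F ((a.1.1, m), a.2).
Proof.
rewrite sum_pair sum_pair (bigD1 a.1.1)//= [X in _ + X]big1 ?addr0; last first.
  move=> i ia; apply: big1 => m _; apply: big1 => b _ /=.
  by rewrite eq_sym (negbTE ia) !mul0r.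
apply: eq_bigr => m _; rewrite (bigD1 a.2)//= [X in _ + X]big1 ?addr0; last first.
  by move=> b ba; rewrite [a.2 == b]eq_sym (negbTE ba) mulr0 mul0r.
by rewrite !eqxx !mul1r.
Qed.

Let uu a b : \sum_c u a c * u b c = (a == b)%:R.
Proof.
under eq_bigr do rewrite /u -!mulrA mulrA.
rewrite sum_block /= [_ == a.1.1]eq_sym [_ == a.2]eq_sym.
case: a b => -[i k] b [[i' k'] b']; rewrite /= !xpair_eqE.
case: eqP => [<-|_]; last by rewrite big1// => m _; rewrite mul0r mulr0.
case: (b == b'); last by rewrite andbF big1// => m _; rewrite mul0r !mulr0.
rewrite andbT /= -[RHS](_ : (1%:M : 'M[R]_M) k k' = _); last by rewrite mxE.
by rewrite -(UU i) mxE; apply: eq_bigr => m _; rewrite !mxE !mul1r.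
Qed.

Let G j k t := \sum_k' kernel_mx u k k' * trig_H j k' t.

Let GE' j k t : let a := enum_val k in G j k t = ((e j).1 == a.1.1)%:R *
  \sum_m U a.1.1 a.1.2 m * Num.sqrt (w a.1.1 m) * rot2 (phase (q a.1.1 m) t) (e j).2 a.2.
Proof.
move=> a.
transitivity (\sum_b (a.1.1 == b.1.1)%:R * (a.2 == b.2)%:R *
    (U a.1.1 a.1.2 b.1.2 * trig_basis j b t)).
  rewrite -[RHS]sum_enum_val; apply: eq_bigr => k' _; rewrite mxE -/a /u.
  by rewrite /trig_H; ring.
rewrite sum_block mulr_sumr; apply: eq_bigr => m _; rewrite /trig_basis /=; ring.
Qed.

Let iota j : 'I_K := enum_rank ((e j).1, k0, (e j).2).

Let iota_inj : injective iota.
Proof.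
move=> j j' /enum_rank_inj[h1 h2]; apply: (bij_inj eb).
by rewrite (surjective_pairing (e j)) h1 h2 -surjective_pairing.
Qed.

Let D j k l := let a := enum_val (k : 'I_K) in
  ((e j).1 == a.1.1)%:R * drot2 (e j).2 a.2 * (c a.1.1 * Bt a.1.1 a.1.2 l).

(** The derivative with the scale [c] divided out: weights and frequencies no longer appear, which
    makes the limit constant common to different systems. *)
Definition flat_matrix j k l := let a := enum_val (k : 'I_K) in
  ((e j).1 == a.1.1)%:R * drot2 (e j).2 a.2 * Bt a.1.1 a.1.2 l.

Let rem b b' (x : R) := rot2 x b b' - (b == b')%:R - drot2 b b' * x.

Let r j k t := let a := enum_val (k : 'I_K) in ((e j).1 == a.1.1)%:R *
  \sum_m U a.1.1 a.1.2 m * Num.sqrt (w a.1.1 m) * rem (e j).2 a.2 (phase (q a.1.1 m) t).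

Let Q i m := \sum_l `|q i m l|.

(** One factor [Q] bounds the size of the phase, the other its Lipschitz constant. *)
Let L := \sum_i \sum_k \sum_m `|U i k m| * Num.sqrt (w i m) * (Q i m) ^+ 2.

Let Q0 i m : 0 <= Q i m. Proof. exact: sumr_ge0. Qed.

Let term0 i k m : 0 <= `|U i k m| * Num.sqrt (w i m) * (Q i m) ^+ 2.
Proof. by rewrite !mulr_ge0// sqrtr_ge0. Qed.

Let L0 : 0 <= L.
Proof. by do 3!apply: sumr_ge0 => ? _. Qed.

Let GE j k t : G j k t = (k == iota j)%:R + \sum_l t 0 l * D j k l + r j k t.
Proof.
rewrite GE' /r /D; set a := enum_val k.
have -> : (k == iota j) = [&& (e j).1 == a.1.1, (e j).2 == a.2 & a.1.2 == k0].
  rewrite -(inj_eq enum_val_inj) enum_rankK -/a; case: a => -[i m] b /=.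
  rewrite !xpair_eqE [i == _]eq_sym [b == _]eq_sym.
  by case: eqP => //= _; rewrite andbC.
have -> : \sum_l t 0 l * (((e j).1 == a.1.1)%:R * drot2 (e j).2 a.2 *
    (c a.1.1 * Bt a.1.1 a.1.2 l)) = ((e j).1 == a.1.1)%:R * (drot2 (e j).2 a.2 *
    \sum_m U a.1.1 a.1.2 m * Num.sqrt (w a.1.1 m) * phase (q a.1.1 m) t).
  under eq_bigr do rewrite -U1 mulrCA -mulrA.
  rewrite -mulr_sumr -[in LHS]mulr_sumr; congr (_ * (_ * _)).
  under eq_bigr do rewrite mulr_sumr; rewrite exchange_big /=.
  by apply: eq_bigr => m _; rewrite mulr_sumr; apply: eq_bigr => l _; ring.
case: (_ == a.1.1) => /=; last by rewrite !mul0r !addr0.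
have -> : (((e j).2 == a.2) && (a.1.2 == k0))%:R = ((e j).2 == a.2)%:R *
    \sum_m U a.1.1 a.1.2 m * Num.sqrt (w a.1.1 m) :> R.
  by rewrite U0 -natrM mulnb.
rewrite !mul1r !mulr_sumr -!big_split /=; apply: eq_bigr => m _; rewrite /rem; ring.
Qed.

Let r0 j k : r j k 0 = 0.
Proof.
rewrite /r big1 ?mulr0// => m _; rewrite phase0 /rem mulr0 subr0 /rot2.
by case: eqP => _; [rewrite cos0 subrr mulr0|rewrite sin0 oppr0 if_same addr0 mulr0].
Qed.

Let rL j k (rho : R) t t' : `|t| <= rho -> `|t'| <= rho ->
  `|r j k t - r j k t'| <= L * rho * `|t - t'|.
Proof.
move=> tr tr'; rewrite /r; set a := enum_val k.
have rho0 : 0 <= rho := le_trans (normr_ge0 t) tr.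
rewrite -mulrBr normrM -sumrB.
apply: (@le_trans _ _ (1 * \sum_m `|U a.1.1 a.1.2 m| * Num.sqrt (w a.1.1 m) *
    (Q a.1.1 m) ^+ 2 * (rho * `|t - t'|))).
  apply: ler_pM => //; first by rewrite normr_nat lern1 leq_b1.
  rewrite (le_trans (ler_norm_sum _ _ _))//; apply: ler_sum => m _.
  rewrite -mulrBr normrM normrM (ger0_norm (sqrtr_ge0 _)) -[leRHS]mulrA.
  apply: ler_wpM2l; first by rewrite mulr_ge0// sqrtr_ge0.
  set f := phase _; have fQ s : `|s| <= rho -> `|f s| <= Q a.1.1 m * rho.
    by move=> sr; apply: (le_trans (phase_le _ _)); apply: ler_wpM2l => //; exact: Q0.
  have -> : rem (e j).2 a.2 (f t) - rem (e j).2 a.2 (f t') =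
      (rot2 (f t) (e j).2 a.2 - drot2 (e j).2 a.2 * f t) -
      (rot2 (f t') (e j).2 a.2 - drot2 (e j).2 a.2 * f t') by rewrite /rem; ring.
  apply: (le_trans (rot_lip _ _ (fQ _ tr) (fQ _ tr'))).
  have -> : Q a.1.1 m ^+ 2 * (rho * `|t - t'|) = Q a.1.1 m * rho * (Q a.1.1 m * `|t - t'|).
    by ring.
  by apply: ler_wpM2l; [rewrite mulr_ge0|rewrite phaseB; exact: phase_le].
rewrite mul1r -mulr_suml -mulrA ler_wpM2r ?mulr_ge0//.
rewrite /L [leRHS](bigD1 a.1.1)//= [X in _ <= X + _](bigD1 a.1.2)//= -addrA lerDl.
by rewrite addr_ge0//; do !apply: sumr_ge0 => ? _.
Qed.

Let DB j k l : rest iota k -> D j k l = c (e j).1 * flat_matrix j k l.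
Proof.
by move=> _; rewrite /D /flat_matrix /=; case: eqP => [->|_]; [ring|rewrite !mul0r mulr0].
Qed.

Let cG j k : continuous (G j k).
Proof.
apply: continuous_bigsum => k' t.
apply: (@continuousM _ _ (cst (kernel_mx u k k')) (trig_H j k')).
  exact: cst_continuous.
exact: continuous_trig_H.
Qed.

Lemma trig_local_limit (eps : nat -> R) :
  (forall m, 0 < eps m) -> eps m @[m --> \oo] --> 0 ->
  ((eps m ^- N)%:E * gaussE K (small_event trig_H (eps m)) @[m --> \oo] -->
    (\prod_j c (e j).1)%:E * local_const iota flat_matrix)%E.
Proof.
move=> eps0 epsc.
rewrite (_ : (fun m => _) = fun m => ((eps m ^- N)%:E * gaussE K (small_event G (eps m)))%E).
  apply: (local_limit iota_inj L0 _ GE r0 rL DB cG eps0 epsc) => j; exact: c0.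
apply: funext => m; congr (_ * _)%E.
rewrite [RHS](gaussE_mx_action (kernel_mx_orthogonal uu)); last first.
  by apply: measurable_small_event; exact: cG.
have fG x t j : field G (mx_action (kernel_mx u) x) t j = field trig_H x t j.
  exact: (field_mx_action (kernel_mx_orthogonal uu) trig_H x t j).
by congr (gaussE K _); apply/seteqP; split=> x [t [t01 h]]; exists t; split=> // j;
  have := h j; rewrite fG.
Qed.

End Rotation.

End TrigSystem.

(** * Expected number of zeros in the unit cube *)

Section CountZeros.
Context {R : realType} {N J : nat} d (P : measurableType d).
Variable F : P -> 'rV[R]_N -> 'I_J -> R.
Hypotheses (mF : forall t j, measurable_fun setT (fun p => F p t j))
  (cF : forall p j, continuous (fun t => F p t j)).

Definition zeros_in_cube p : set 'rV[R]_N :=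
  [set t | unit_cube t /\ forall j, F p t j = 0].

Definition cell_event k (c : @cell_type N k) : set P :=
  [set p | exists t : 'rV[R]_N, cell c t /\ forall j, F p t j = 0].

Lemma measurable_cell_event k (c : @cell_type N k) : measurable (cell_event c).
Proof. exact: measurable_zero_cell. Qed.

Lemma occupied_event k (c : @cell_type N k) p :
  (c \in occupied k (zeros_in_cube p)) = (p \in cell_event c).
Proof.
rewrite inE; apply/asboolP/idP => [[t [tu Ht] /(cell_indexP _ tu) tc]|/set_mem[t [tc Ht]]].
  by apply/mem_set; exists t.
have tu := cell_sub tc.
by exists t => //; apply/(cell_indexP _ tu).
Qed.

Definition cell_count k p : \bar R := #|occupied k (zeros_in_cube p)|%:R%:E.

Lemma cell_countE k p :
  cell_count k p = (\sum_(c : @cell_type N k) (\1_(cell_event c) p)%:E)%E.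
Proof.
rewrite /cell_count -sum1_card natr_sum big_mkcond /= sumEFin; congr EFin.
by apply: eq_bigr => c _; rewrite occupied_event indicE; case: (_ \in _).
Qed.

Lemma measurable_cell_count k : measurable_fun setT (cell_count k).
Proof.
rewrite (_ : cell_count k = fun p => (\sum_(c : @cell_type N k) (\1_(cell_event c) p)%:E)%E).
  by apply: emeasurable_sum => c; apply/measurable_EFinP; apply: measurable_indic;
    exact: measurable_cell_event.
by apply: funext => p; exact: cell_countE.
Qed.

Lemma cell_count_nondecreasing p : nondecreasing_seq (cell_count ^~ p).
Proof.
by apply/nondecreasing_seqP => k; rewrite lee_fin ler_nat card_occupiedS// => t [].
Qed.

Lemma counting_zeros_in_cube p : counting (zeros_in_cube p) = limn (cell_count ^~ p).
Proof. by apply: counting_occupied => t []. Qed.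

(** A pointwise limit of finite sums of indicators of cell events. *)
Lemma measurable_counting_zeros :
  measurable_fun setT (fun p => counting (zeros_in_cube p) : \bar R).
Proof.
rewrite (_ : (fun p => _) = fun p => limn_esup (cell_count ^~ p)).
  apply: measurable_fun_limn_esup => k; exact: measurable_cell_count.
apply: funext => p; rewrite counting_zeros_in_cube is_cvg_limn_esupE//.
by apply: ereal_nondecreasing_is_cvgn; exact: cell_count_nondecreasing.
Qed.

End CountZeros.

Section ExpectedCount.
Context {R : realType} {n M N : nat} (e : 'I_N -> 'I_n * bool).
Hypothesis eb : bijective e.
Notation I := ('I_n * 'I_M * bool)%type.
Notation K := #|{: I}|.
Notation E := (euclidean R K).
Variables (w : 'I_n -> 'I_M -> R) (q : 'I_n -> 'I_M -> 'I_N -> R).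
Notation H := (trig_H e w q).

Notation F := (fun x t j => field H x t j).

Let mF t j : measurable_fun setT (fun x => F x t j).
Proof. exact: measurable_field. Qed.

Let cF x j : continuous (fun t => F x t j).
Proof. by apply: continuous_field; exact: continuous_trig_H. Qed.

Lemma cell_event_probability k (c : @cell_type N k) :
  gaussE K (cell_event F c) = gaussE K (small_event H (2 ^- k)).
Proof.
have k0 : 0 < 2 ^+ k :> R by rewrite exprn_gt0.
pose t0 : 'rV[R]_N := \row_j ((c j)%:R / 2 ^+ k).
rewrite -(trig_cell_probability e w q t0); congr (gaussE K _).
apply/seteqP; split=> x [t [tc Ht]].
  exists (2 ^+ k *: (t - t0)); split=> j.
    rewrite !mxE; have /andP[h1 h2] := tc j.
    rewrite mulrC -ler_pdivrMr// mul0r subr_ge0 h1 /= -ltr_pdivlMr// mul1r.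
    rewrite ltrBlDl; move: h2; rewrite -natr1 mulrDl mul1r addrC//.
  by rewrite scalerA mulVf ?gt_eqF// scale1r subrK.
exists (2 ^- k *: t + t0); split=> // j.
rewrite !mxE; have /andP[h1 h2] := tc j.
rewrite lerDr mulr_ge0 ?invr_ge0 ?(ltW k0)//=.
have -> : (c j).+1%:R = (c j)%:R + 1 :> R by rewrite natr1.
by rewrite mulrDl mul1r addrC ltrD2l gtr_pMr ?invr_gt0.
Qed.

(** All $2^{kN}$ cells are translates of one cube and have the same probability. *)
Lemma integral_occupied k :
  (\int[gaussE K]_x cell_count F k x =
    ((2 ^- k) ^- N)%:E * gaussE K (small_event H (2 ^- k)))%E.
Proof.
under eq_integral do rewrite cell_countE.
rewrite ge0_integral_sum//; last first.
  by move=> c; apply/measurable_EFinP; apply: measurable_indic; exact: measurable_cell_event.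
transitivity (\sum_(c : @cell_type N k) gaussE K (small_event H (2 ^- k)))%E.
  apply: eq_bigr => c _; rewrite integral_indic// ?setIT; last exact: measurable_cell_event.
  exact: cell_event_probability.
rewrite sumr_const card_ffun !card_ord prednK ?expn_gt0//.
have -> : (2 ^- k) ^- N = ((2 ^ k) ^ N)%N%:R :> R by rewrite !natrX -exprVn invrK.
by rewrite mule_natl.
Qed.

Lemma expected_count k0 (U : 'I_n -> 'M[R]_M) Bt (c : 'I_n -> R) :
  (forall i, 0 < c i) -> (forall i, U i *m (U i)^T = 1%:M) ->
  (forall i k, \sum_m U i k m * Num.sqrt (w i m) = (k == k0)%:R) ->
  (forall i k l, \sum_m U i k m * Num.sqrt (w i m) * q i m l = c i * Bt i k l) ->
  (\int[gaussE K]_x counting (trig_zeros e w q x) =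
    (\prod_j c (e j).1)%:E * local_const (fun j => enum_rank ((e j).1, k0, (e j).2))
      (flat_matrix e Bt))%E.
Proof.
move=> c0 UU U0 U1.
transitivity (\int[gaussE K]_x limn (cell_count F ^~ x))%E.
  by apply: eq_integral => x _; rewrite -counting_zeros_in_cube.
rewrite monotone_convergence//; last 3 first.
- by move=> k; exact: measurable_cell_count.
- by move=> k x _; rewrite lee_fin.
- by move=> x _; exact: cell_count_nondecreasing.
under eq_fun do rewrite integral_occupied.
apply/cvg_lim => //; apply: (trig_local_limit eb c0 UU U0 U1 (eps := fun k => 2 ^- k)) => [k|].
  by rewrite invr_gt0 exprn_gt0.
rewrite (_ : (fun k => _) = fun k => (2^-1) ^+ k); last first.
  by apply: funext => k; rewrite exprVn.
by apply: cvg_expr; rewrite ger0_norm ?invr_ge0// invf_lt1// ltr1n.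
Qed.

End ExpectedCount.

Section CountRatio.
Context {R : realType} {n N M' : nat} (e : 'I_N -> 'I_n * bool).
Hypothesis eb : bijective e.
Notation M := (1 + N + M')%N.
Notation I := ('I_n * 'I_M * bool)%type.
Notation K := #|{: I}|.

(** Each [i] is reached twice, once for each of the two parts of a complex equation. *)
Lemma prod_sqrt_pairs (d : 'I_n -> R) : (forall i, 0 <= d i) ->
  \prod_j Num.sqrt (d (e j).1) = \prod_i d i.
Proof.
move=> d0; have [e' eK e'K] := eb.
rewrite (reindex e'); last by exists e => x _; [exact: e'K|exact: eK].
under eq_bigr do rewrite e'K.
rewrite -(pair_bigA _ (fun i (_ : bool) => Num.sqrt (d i))) /=; apply: eq_bigr => i _.
by rewrite big_bool /= -expr2 sqr_sqrtr.
Qed.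

(** The constant is built from Cholesky factors of [S], chosen before the scales, weights and
    frequencies. Orthonormality of the rows below comes from total weight 1, zero mean and the
    prescribed covariance. *)
Lemma expected_count_cov (S : 'I_n -> 'M[R]_N) : (forall i, posdef (S i)) ->
  exists C : \bar R, forall (d : 'I_n -> R) (w : 'I_n -> 'I_M -> R)
    (q : 'I_n -> 'I_M -> 'I_N -> R),
  (forall i, 0 < d i) -> (forall i m, 0 <= w i m) -> (forall i, \sum_m w i m = 1) ->
  (forall i l, \sum_m w i m * q i m l = 0) ->
  (forall i l l', \sum_m w i m * q i m l * q i m l' = d i * S i l l') ->
  (\int[gaussE K]_x counting (trig_zeros e w q x) = (\prod_i d i)%:E * C)%E.
Proof.
move=> Spos.
have /choice[B BP] : forall i, exists B, B \in unitmx /\ S i = B *m B^T.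
  by move=> i; have [B ? ?] := cholesky (Spos i); exists B.
(* Row 0 of the orthogonal matrix holds the square roots of the weights, the next $N$ rows the
   normalised derivatives, the last $M'$ rows the completion. *)
pose k0 : 'I_M := lshift M' (lshift N ord0).
pose row2 l : 'I_M := lshift M' (rshift 1 l).
pose Bt i (k : 'I_M) l := \sum_l' (k == row2 l')%:R * B i l l'.
exists (local_const (fun j => enum_rank ((e j).1, k0, (e j).2)) (flat_matrix e Bt)).
move=> d w q d0 w0 w1 q0 qq.
pose W i : 'rV[R]_M := \row_m Num.sqrt (w i m).
pose T i : 'M[R]_(N, M) := \matrix_(l, m) (Num.sqrt (w i m) * q i m l).
pose c i := Num.sqrt (d i); have c0 i : 0 < c i by rewrite sqrtr_gt0.
have WW i : W i *m (W i)^T = 1%:M.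
  apply/matrixP => a b; rewrite !ord1 !mxE eqxx -(w1 i); apply: eq_bigr => m _.
  by rewrite !mxE -expr2 sqr_sqrtr.
have WT i : W i *m (T i)^T = 0.
  apply/matrixP => a l; rewrite mxE [RHS]mxE -[RHS](q0 i l); apply: eq_bigr => m _.
  by rewrite !mxE mulrA -expr2 sqr_sqrtr.
have TT i : T i *m (T i)^T = d i *: S i.
  apply/matrixP => l l'; rewrite !mxE -qq; apply: eq_bigr => m _.
  rewrite !mxE -[w i m in RHS]sqr_sqrtr//; ring.
have Bu i : B i \in unitmx by have [] := BP i.
(* Since $T_i T_i^T = d_i S_i = (c_i B_i)(c_i B_i)^T$, multiplying by the inverse of $c_i B_i$ makes
   the rows orthonormal. *)
pose Q2 i := (c i)^-1 *: (invmx (B i) *m T i).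
have TE i : T i = c i *: (B i *m Q2 i).
  by rewrite /Q2 -scalemxAr scalerA mulfV ?gt_eqF// scale1r mulmxA mulmxV// mul1mx.
have WQ2 i : W i *m (Q2 i)^T = 0.
  by rewrite /Q2 linearZ /= trmx_mul -scalemxAr mulmxA WT mul0mx scaler0.
have QQ i : col_mx (W i) (Q2 i) *m (col_mx (W i) (Q2 i))^T = 1%:M.
  rewrite tr_col_mx mul_col_row WW WQ2 (_ : Q2 i *m (W i)^T = 0); last first.
    by rewrite -[LHS]trmxK trmx_mul trmxK WQ2 trmx0.
  rewrite (_ : Q2 i *m (Q2 i)^T = 1%:M) -?scalar_mx_block//.
  rewrite /Q2 linearZ /= -scalemxAl -scalemxAr scalerA trmx_mul !mulmxA.
  rewrite -(mulmxA _ (T i)) TT -scalemxAr -scalemxAl scalerA.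
  have -> : (c i)^-1 * (c i)^-1 * d i = 1.
    by rewrite -invfM -expr2 sqr_sqrtr ?(ltW (d0 i))// mulVf// gt_eqF.
  rewrite scale1r; have [_ ->] := BP i.
  by rewrite mulmxA mulVmx// mul1mx -trmx_mul mulVmx// trmx1.
have /choice[Q' Q'P] := fun i => orthonormal_completion (QQ i).
pose U i := col_mx (col_mx (W i) (Q2 i)) (Q' i).
rewrite (expected_count eb (U := U) (k0 := k0) (c := c) (Bt := Bt))//.
- by rewrite prod_sqrt_pairs// => i; exact: ltW.
- move=> i k; rewrite -[RHS](_ : (1%:M : 'M[R]_M) k k0 = _); last by rewrite mxE.
  have UW m : U i k0 m = Num.sqrt (w i m) by rewrite /U /k0 !col_mxEu mxE.
  rewrite -(Q'P i) mxE; apply: eq_bigr => m _.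
  by rewrite [X in _ = _ * X]mxE -/(U i) UW.
- move=> i k l.
  have Q2U m l' : Q2 i l' m = U i (row2 l') m by rewrite /U /row2 col_mxEu col_mxEd.
  transitivity (\sum_m U i k m * T i l m); first by apply: eq_bigr => m _; rewrite [X in _ = _ * X]mxE mulrA.
  transitivity (\sum_m c i * \sum_l' B i l l' * (U i k m * U i (row2 l') m)).
    apply: eq_bigr => m _; rewrite TE [X in _ * X = _]mxE mulrCA; congr (_ * _).
    rewrite [X in _ * X = _]mxE mulr_sumr; apply: eq_bigr => l' _; rewrite Q2U; ring.
  rewrite -mulr_sumr exchange_big /=; congr (_ * _); apply: eq_bigr => l' _.
  rewrite -mulr_sumr mulrC; congr (_ * _).
  rewrite -[RHS](_ : (1%:M : 'M[R]_M) k (row2 l') = _); last by rewrite mxE.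
  by rewrite -(Q'P i) mxE; apply: eq_bigr => m _; rewrite [X in _ = _ * X]mxE.
Qed.

End CountRatio.

(** * Moments of the coefficients of the kernel *)

Section ProductMoments.
Context {R : comPzRingType} {L : finType}.
Variables (w : L -> R) (d : nat).
Hypothesis w1 : \sum_m w m = 1.
Implicit Types a b : L -> R.

Let sum_prod (F : 'I_d -> L -> R) :
  \sum_(s : {ffun 'I_d -> L}) \prod_i F i (s i) = \prod_i \sum_m F i m.
Proof. by rewrite bigA_distr_bigA. Qed.

Lemma product_weight_sum : \sum_(s : {ffun 'I_d -> L}) \prod_i w (s i) = 1.
Proof. by rewrite (sum_prod (fun=> w)) big1. Qed.

(** The factors at the other indices sum to 1. *)
Let sum_prod_at a i0 :
  \sum_(s : {ffun 'I_d -> L}) (\prod_i w (s i)) * a (s i0) = \sum_m w m * a m.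
Proof.
transitivity (\sum_(s : {ffun 'I_d -> L})
    \prod_i (w (s i) * if i == i0 then a (s i) else 1)).
  by apply: eq_bigr => s _; rewrite big_split /= -big_mkcond big_pred1_eq.
rewrite (sum_prod (fun i m => w m * if i == i0 then a m else 1)) (bigD1 i0)//= eqxx.
by rewrite [X in _ * X]big1 ?mulr1// => i /negbTE ->; under eq_bigr do rewrite mulr1.
Qed.

Lemma product_mean a : \sum_m w m * a m = 0 ->
  \sum_(s : {ffun 'I_d -> L}) (\prod_i w (s i)) * \sum_i a (s i) = 0.
Proof.
move=> a0; under eq_bigr do rewrite mulr_sumr.
by rewrite exchange_big big1// => i _; rewrite sum_prod_at.
Qed.

Let sum_prod_at2 a b i0 j0 : i0 != j0 ->
  \sum_(s : {ffun 'I_d -> L}) (\prod_i w (s i)) * (a (s i0) * b (s j0)) =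
  (\sum_m w m * a m) * (\sum_m w m * b m).
Proof.
move=> ij; transitivity (\sum_(s : {ffun 'I_d -> L})
    \prod_i (w (s i) * ((if i == i0 then a (s i) else 1) * if i == j0 then b (s i) else 1))).
  apply: eq_bigr => s _; rewrite big_split /= big_split /=.
  by rewrite -!big_mkcond !big_pred1_eq.
rewrite (sum_prod (fun i m => w m * ((if i == i0 then a m else 1) *
  if i == j0 then b m else 1))) (bigD1 i0)//= (bigD1 j0) 1?eq_sym//= !eqxx.
have ji : (j0 == i0) = false by rewrite eq_sym; exact/negbTE.
rewrite ?(negbTE ij) ?ji [X in _ * (_ * X)]big1 => [|i].
  rewrite mulr1; congr (_ * _); apply: eq_bigr => m _; first by rewrite mulr1.
  by rewrite mul1r.
by move=> /andP[/negbTE -> /negbTE ->]; under eq_bigr do rewrite !mulr1.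
Qed.

(** Off-diagonal terms factor into a product containing a zero mean; the [d] diagonal terms are
    equal. *)
Lemma product_covariance a b : \sum_m w m * a m = 0 -> \sum_m w m * b m = 0 ->
  \sum_(s : {ffun 'I_d -> L}) (\prod_i w (s i)) * ((\sum_i a (s i)) * \sum_i b (s i)) =
  d%:R * \sum_m w m * (a m * b m).
Proof.
move=> a0 b0.
transitivity (\sum_i \sum_j \sum_(s : {ffun 'I_d -> L}) (\prod_i w (s i)) * (a (s i) * b (s j))).
  under eq_bigr do rewrite mulr_suml mulr_sumr.
  rewrite exchange_big /=; apply: eq_bigr => i _.
  under eq_bigr do rewrite 2!mulr_sumr.
  by rewrite exchange_big.
transitivity (\sum_(i < d) \sum_m w m * (a m * b m)).
  apply: eq_bigr => i _; rewrite (bigD1 i)//= [X in _ + X]big1 ?addr0.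
    by rewrite (sum_prod_at (fun m => a m * b m)).
  by move=> j ij; rewrite sum_prod_at2 1?eq_sym// a0 mul0r.
by rewrite sumr_const card_ord mulr_natl.
Qed.

End ProductMoments.

Section KernelMoments.
Context {R : realType} {N : nat} (A : set 'rV[R]_N) (h : {dot (W A) for conjC}).
Hypotheses (Al : lattice_polytope A) (Af : full_dimensional A).
Variable x : 'I_N -> R.
Notation L := (lattice_points A).

Definition kernel_coef (d : nat) (m : 'rV[int]_N) : R := complex.Re (kernel_pow_coef h d m).

Let c1 (m : L) : R := complex.Re ((h (character m) (character m))^-1).

Let c1_gt0 m : 0 < c1 m.
Proof.
have : 0 < (h (character m) (character m))^-1.
  rewrite invr_gt0 dnorm_gt0; apply/negP => /eqP/ffunP/(_ m).
  by rewrite !ffunE eqxx => /eqP; rewrite oner_eq0.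
by rewrite ltcE => /andP[_].
Qed.

Let c1E m : (h (character m) (character m))^-1 = (c1 m)%:C.
Proof.
have : 0 <= (h (character m) (character m))^-1 by rewrite invr_ge0 dnorm_ge0.
by rewrite /c1 lecE /=; case: (_^-1) => a b /= /andP[/eqP ->].
Qed.

Lemma kernel_pow_coefE d m : kernel_pow_coef h d m = (kernel_coef d m)%:C.
Proof.
rewrite /kernel_coef; suff [r ->] : exists r, kernel_pow_coef h d m = r%:C by [].
exists (\sum_(s : {ffun 'I_d -> L} | \sum_i val (s i) == m) \prod_i c1 (s i)).
rewrite raddf_sum; apply: eq_bigr => s _; rewrite [RHS](rmorph_prod (real_complex R)).
by apply: eq_bigr => i _; exact: c1E.
Qed.

Let kernel_coefE d m : kernel_coef d m =
  \sum_(s : {ffun 'I_d -> L} | \sum_i val (s i) == m) \prod_i c1 (s i).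
Proof.
apply: complexI; rewrite -kernel_pow_coefE raddf_sum; apply: eq_bigr => s _.
by rewrite [RHS](rmorph_prod (real_complex R)); apply: eq_bigr => i _; exact: c1E.
Qed.

Definition expo (m : 'rV[int]_N) : R := \sum_l (m 0 l)%:~R * x l.

Lemma expo_sum (I : Type) (r : seq I) (m : I -> 'rV[int]_N) :
  expo (\sum_(i <- r) m i) = \sum_(i <- r) expo (m i).
Proof.
rewrite /expo exchange_big; apply: eq_bigr => l _.
by rewrite summxE rmorph_sum mulr_suml.
Qed.

(** On the fibre of [Log] over [x] one has $|\chi^m|^2 = e^{2 m\cdot x}$, so these are the terms of
    $K(z,z)$ there, and [kernel_mass] is its value. *)
Let v (m : L) := c1 m * expR (2 * expo (val m)).
Definition kernel_mass := \sum_m v m.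
Let w m := v m / kernel_mass.
Let mu l := \sum_m w m * (val m 0 l)%:~R.

Let v_gt0 m : 0 < v m. Proof. by rewrite mulr_gt0// expR_gt0. Qed.

Let lattice_generators : exists s : seq 'rV[int]_N,
  A = convex_hull [set real_point m | m in [set` s]] /\ forall m, m \in s -> m \in L.
Proof.
have [s sA] := Al; exists s; split=> // m ms; apply/in_lattice_points1 => //.
rewrite /lattice_set /= sA; exists 1%N, (fun=> 1), (fun=> real_point m).
by split=> //; rewrite ?big_ord1 ?scale1r// => i; exists m.
Qed.

(** The terms are positive, so one lattice point suffices. Full dimension writes 0 as an affine
    combination of points of [A]; the combination is nonempty, and each of its points is a convex
    combination of lattice points of [A]. *)
Lemma kernel_mass_gt0 : 0 < kernel_mass.
Proof.
have [m] : exists m : L, true.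
  have [s [sA sL]] := lattice_generators.
  have : affine_hull A 0 by rewrite (Af : _ = _).
  move=> [[|k] [u [p [pA u1 _]]]]; first by move: u1; rewrite big_ord0 => /esym/eqP; rewrite oner_eq0.
  have : convex_hull [set real_point m | m in [set` s]] (p ord0) by rewrite -sA.
  move=> [[|k'] [u' [p' [p'A _ u'1 _]]]].
    by move: u'1; rewrite big_ord0 => /esym/eqP; rewrite oner_eq0.
  by have [m /sL mL _] := p'A ord0; exists [` mL]%fset.
move=> _; rewrite /kernel_mass (bigD1 m)//= ltr_pwDl// sumr_ge0// => i _; exact: ltW.
Qed.

Definition kernel_weight d (m : 'rV[int]_N) :=
  kernel_coef d m * expR (2 * expo m) / kernel_mass ^+ d.

Let Z0 : kernel_mass != 0. Proof. by rewrite gt_eqF// kernel_mass_gt0. Qed.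

Let w1 : \sum_m w m = 1. Proof. by rewrite -mulr_suml mulfV. Qed.

(** Tuples of exponents are grouped by their sum. The exponential factor and the normalisation are
    both multiplicative along a tuple. *)
Let sum_dilate d (f : 'rV[int]_N -> R) :
  \sum_(m : lattice_points (dilate d A)) kernel_weight d (val m) * f (val m) =
  \sum_(s : {ffun 'I_d -> L}) (\prod_i w (s i)) * f (\sum_i val (s i)).
Proof.
pose g (s : {ffun 'I_d -> L}) : lattice_points (dilate d A) :=
  [` lattice_points_sum s Al]%fset.
rewrite [RHS](partition_big g xpredT)//=; apply: eq_bigr => m _.
rewrite /kernel_weight kernel_coefE !mulr_suml.
rewrite [RHS](eq_bigl (fun s : {ffun 'I_d -> L} => \sum_i val (s i) == val m)); last first.
  by move=> s; rewrite -val_eqE.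
apply: eq_bigr => s /eqP sm; rewrite sm; congr (_ * _).
rewrite -sm expo_sum mulr_sumr expR_sum -big_split /=.
by rewrite [RHS]big_split /= prodr_const card_ord exprVn.
Qed.

Let a l (m : L) : R := pi *+ 2 * ((val m 0 l)%:~R - mu l).

Let a0 l : \sum_m w m * a l m = 0.
Proof.
under eq_bigr do rewrite /a mulrCA mulrBr; rewrite -mulr_sumr sumrB -/(mu l).
by rewrite -mulr_suml w1 mul1r subrr mulr0.
Qed.

Definition kernel_mean l := mu l.
Definition kernel_cov : 'M[R]_N := \matrix_(l, l') \sum_m w m * (a l m * a l' m).

Definition kernel_freq (d : nat) (m : 'rV[int]_N) (l : 'I_N) : R :=
  pi *+ 2 * ((m 0 l)%:~R - d%:R * kernel_mean l).

Let kernel_freq_sum d (s : {ffun 'I_d -> L}) l :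
  kernel_freq d (\sum_i val (s i)) l = \sum_i a l (s i).
Proof.
rewrite -mulr_sumr sumrB; congr (_ * (_ - _)); first by rewrite summxE rmorph_sum.
by rewrite sumr_const card_ord mulr_natl.
Qed.

Lemma kernel_weight_sum d :
  \sum_(m : lattice_points (dilate d A)) kernel_weight d (val m) = 1.
Proof.
have := sum_dilate d (fun=> 1).
under eq_bigr do rewrite mulr1; move=> ->.
by under eq_bigr do rewrite mulr1; exact: product_weight_sum.
Qed.

Lemma kernel_weight_mean d l :
  \sum_(m : lattice_points (dilate d A))
    kernel_weight d (val m) * kernel_freq d (val m) l = 0.
Proof.
rewrite (sum_dilate d (fun m => kernel_freq d m l)).
by under eq_bigr do rewrite kernel_freq_sum; exact: product_mean.
Qed.

Lemma kernel_weight_cov d l l' :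
  \sum_(m : lattice_points (dilate d A))
    kernel_weight d (val m) * (kernel_freq d (val m) l * kernel_freq d (val m) l') =
  d%:R * kernel_cov l l'.
Proof.
rewrite (sum_dilate d (fun m => kernel_freq d m l * kernel_freq d m l')).
under eq_bigr do rewrite !kernel_freq_sum.
by rewrite product_covariance// mxE.
Qed.

Lemma kernel_weight_gt0 d m : normal_polytope A -> (0 < d)%N ->
  m \in lattice_points (dilate d A) -> 0 < kernel_weight d m.
Proof.
move=> An d0 mA; rewrite divr_gt0 ?exprn_gt0 ?kernel_mass_gt0// mulr_gt0 ?expR_gt0//.
have : 0 < kernel_pow_coef h d m.
  by apply: kernel_pow_coef_gt0 => //; exact/in_lattice_points.
by rewrite kernel_pow_coefE ltcR.
Qed.

(** The covariance is a Gram matrix. A vector in its kernel gives an affine function that vanishes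
    at every lattice point of [A], hence on the polytope, hence on its affine hull, which is the
    whole space. *)
Lemma kernel_cov_posdef : posdef kernel_cov.
Proof.
pose T : 'M[R]_(N, #|{: L}|) :=
  \matrix_(l, k) (Num.sqrt (w (enum_val k)) * a l (enum_val k)).
have w_gt0 m : 0 < w m by rewrite divr_gt0// kernel_mass_gt0.
suff -> : kernel_cov = T *m T^T.
  apply: gram_posdef; apply: inj_row_free => u uT.
  have ua (m : L) : \sum_l u 0 l * ((val m 0 l)%:~R - mu l) = 0.
    have /rowP/(_ (enum_rank m)) := uT; rewrite !mxE => u0.
    have : Num.sqrt (w m) * (pi *+ 2) * (\sum_l u 0 l * ((val m 0 l)%:~R - mu l)) = 0.
      rewrite -[RHS]u0 mulr_sumr; apply: eq_bigr => l _.
      by rewrite !mxE enum_rankK /a; ring.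
    have c0 : Num.sqrt (w m) * (pi *+ 2) != 0.
      by rewrite gt_eqF// mulr_gt0//; [rewrite sqrtr_gt0; exact: w_gt0|rewrite pmulrn_lgt0// pi_gt0].
    by move/eqP; rewrite mulf_eq0 (negbTE c0) => /eqP.
  pose f (y : 'rV[R]_N) := \sum_l u 0 l * (y 0 l - mu l).
  have fcomb k (c : 'I_k -> R) (p : 'I_k -> 'rV[R]_N) : \sum_i c i = 1 ->
      (forall i, f (p i) = 0) -> f (\sum_i c i *: p i) = 0.
    move=> c1' fp; rewrite /f.
    transitivity (\sum_i c i * f (p i)); last by rewrite big1// => i _; rewrite fp mulr0.
    under [RHS]eq_bigr do rewrite mulr_sumr; rewrite [RHS]exchange_big /=.
    apply: eq_bigr => l _; rewrite summxE -[mu l in LHS]mul1r -c1' mulr_suml -sumrB mulr_sumr.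
    by apply: eq_bigr => i _; rewrite mxE; ring.
  have fA y : A y -> f y = 0.
    have [s [sA sL]] := lattice_generators.
    rewrite sA => -[k [c [p [pA _ c1' ->]]]]; apply: fcomb => // i.
    have [m /sL mL <-] := pA i; rewrite -[RHS](ua [` mL]%fset) /f.
    by apply: eq_bigr => l _; rewrite mxE.
  have fT y : f y = 0.
    have : affine_hull A y by rewrite (Af : _ = _).
    by move=> [k [c [p [pA c1' ->]]]]; apply: fcomb => // i; exact/fA/pA.
  apply/rowP => l; rewrite mxE.
  (* The difference cancels the mean and isolates [u 0 l]. *)
  have : f (delta_mx 0 l) - f 0 = 0 by rewrite !fT subrr.
  rewrite /f -sumrB (bigD1 l)//= big1 ?addr0 => [<-|l' ll]; last first.
    by rewrite [delta_mx _ _ _ _]mxE (negbTE ll) andbF [X in _ - _ * (X - _)]mxE subrr.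
  by rewrite [delta_mx _ _ _ _]mxE !eqxx /= [X in _ - _ * (X - _)]mxE; ring.
apply/matrixP => l l'; rewrite !mxE.
rewrite -[LHS]sum_enum_val; apply: eq_bigr => k _; rewrite !mxE.
by rewrite -[w _ in LHS]sqr_sqrtr ?ltW//; ring.
Qed.

End KernelMoments.

(** * The Gaussian measures on Laurent polynomials *)

Section LebesguePlane.
Variable R : realType.

Definition plane_measure :
    {measure set (measurableTypeR R * measurableTypeR R)%type -> \bar R} :=
  (@lebesgue_measure R \x @lebesgue_measure R)%E.

Lemma plane_measureX (B C : set R) : measurable B -> measurable C ->
  plane_measure (B `*` C) = (lebesgue_measure B * lebesgue_measure C)%E.
Proof. by move=> mB mC; rewrite [LHS]product_measure1E. Qed.

Lemma plane_measure_sigma_finite : sigma_finite setT plane_measure.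
Proof.
pose I k : set R := `[- k%:R, k%:R]%classic.
have mI k : measurable (I k) by exact: measurable_itv.
exists (fun k => I k `*` I k) => [|k].
  apply/seteqP; split=> // -[a b] _.
  exists (Num.truncn (Num.max `|a| `|b|)).+1 => //.
  have : Num.max `|a| `|b| < (Num.truncn (Num.max `|a| `|b|)).+1%:R by exact: truncnS_gt.
  by rewrite gt_max => /andP[/ltW h1 /ltW h2]; split; rewrite /I /= in_itv /= -ler_norml.
split; first by apply: (@measurableX _ _ (measurableTypeR R) (measurableTypeR R)); exact: mI.
have Ioo : (lebesgue_measure (I k) < +oo)%E.
  by rewrite [X in (X < _)%E](lebesgue_measure_itv `[- k%:R, k%:R]) /=; case: ifP => _; rewrite ltry.
rewrite plane_measureX//; apply: lte_mul_pinfty => //.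
by rewrite ge0_fin_numE.
Qed.

Definition leb2 := sigma_finite_measure_of plane_measure_sigma_finite.
HB.instance Definition _ := SigmaFiniteMeasure.on leb2.

End LebesguePlane.

Section GaussianLaw.
Context {R : realType} {N : nat} (A : set 'rV[R]_N).
Notation L := (lattice_points A).
Notation J := (L * bool)%type.
Notation K := #|{: J}|.
Notation E := (euclidean R K).

Definition coef_measure : {sigma_finite_measure set (coef_type A) -> \bar R} :=
  prod_sfm (fun _ => @leb2 R).

Definition flatten_coef (x : coef_type A) : E := fun k =>
  if (enum_val k).2 then (x (enum_rank (enum_val k).1)).2
  else (x (enum_rank (enum_val k).1)).1.

Definition unflatten_coef (y : E) : coef_type A := fun k =>
  (y (enum_rank (enum_val k, false)), y (enum_rank (enum_val k, true))).

Lemma flatten_coefK : cancel flatten_coef unflatten_coef.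
Proof.
move=> x; apply: funext => k; rewrite /unflatten_coef /flatten_coef !enum_rankK /= enum_valK.
by case: (x k).
Qed.

Lemma measurable_flatten_coef : measurable_fun setT flatten_coef.
Proof.
apply: measurable_prodP => k; rewrite /flatten_coef; case: (enum_val k).2.
  exact: (@measurable_comp_proj _ _ (fun=> (R * R)%type) _ _ _ _ measurable_snd).
exact: (@measurable_comp_proj _ _ (fun=> (R * R)%type) _ _ _ _ measurable_fst).
Qed.

Lemma measurable_unflatten_coef : measurable_fun setT unflatten_coef.
Proof.
apply: measurable_prodP => k; rewrite /unflatten_coef.
by apply: measurable_fun_pair; exact: measurable_proj.
Qed.

Lemma measurable_of_coef : measurable_fun setT (@of_coef R N A).
Proof. by move=> _ B mB; rewrite setTI. Qed.

Lemma lebE_flatten_coef (B : set E) : measurable B ->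
  lebE B = coef_measure (flatten_coef @^-1` B).
Proof.
move=> mB; rewrite -[RHS]/(image_measure coef_measure measurable_flatten_coef B).
rewrite lebEE; apply/esym.
apply: (@prod_measure_unique R K _ _ (fun=> @lebesgue_measure R)) => // C mC.
rewrite -[LHS]/(coef_measure (flatten_coef @^-1` (box C))).
pose D : 'I_#|{: L}| -> set (R * R)%type := fun k => C (enum_rank (enum_val k : L, false)) `*` C (enum_rank (enum_val k, true)).
rewrite (_ : _ @^-1` _ = box D); last first.
  apply/seteqP; split=> x h; rewrite /box /=.
    move=> k; split; [have := h (enum_rank (enum_val k : L, false))|have := h (enum_rank (enum_val k : L, true))];
    by rewrite /flatten_coef !enum_rankK /= enum_valK.
  move=> k; rewrite /flatten_coef; have := h (enum_rank (enum_val k).1).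
  rewrite /D /= enum_rankK; move: (enum_valK k); case: (enum_val k) => m [] /= <- [] //.
rewrite [LHS](_ : _ = prod_measure (fun=> @leb2 R) (box D)); last by rewrite /coef_measure prod_sfmE.
rewrite prod_measure_box; last by move=> k; apply: measurableX; exact: mC.
transitivity (\big[*%E/1%E]_(k < #|{: L}|) (lebesgue_measure (C (enum_rank (enum_val k : L, false)))
    * lebesgue_measure (C (enum_rank (enum_val k : L, true)))))%E.
  by apply: eq_bigr => k _; rewrite [LHS]plane_measureX//; exact: mC.
transitivity (\big[*%E/1%E]_(m : L) \big[*%E/1%E]_(b : bool) lebesgue_measure (C (enum_rank (m, b))))%E.
  rewrite [RHS](reindex _ (onW_bij _ (@enum_val_bij L))) /=; apply: eq_bigr => k _.
  by rewrite big_bool muleC.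
rewrite pair_bigA /= [LHS](reindex _ (onW_bij _ (@enum_val_bij J))) /=.
by apply: eq_bigr => k _; rewrite -surjective_pairing enum_valK.
Qed.

Definition coef_of (v : L -> R) (y : E) : W A := [ffun m =>
  (v m * y (enum_rank (m, false))) +i* (v m * y (enum_rank (m, true)))].

Lemma measurable_coef_of v : measurable_fun setT (coef_of v).
Proof.
pose s : E := fun k => v (enum_val k).1.
rewrite (_ : coef_of v = @of_coef R N A \o (unflatten_coef \o (fun y k => s k * y k))).
  apply: measurableT_comp; first exact: measurable_of_coef.
  apply: measurableT_comp; first exact: measurable_unflatten_coef.
  exact: measurable_scaleE.
by apply: funext => y; apply/ffunP => m; rewrite !ffunE /unflatten_coef /s /= !enum_rankK.
Qed.

Let mW : {measure set (W A) -> \bar R} := image_measure coef_measure measurable_of_coef.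

Let lebesgue_WE : @lebesgue_W R N A = (mW : set (W A) -> \bar R).
Proof.
exact: (congr1 (fun mu => pushforward mu (@of_coef R N A)) (esym (prod_sfmE (fun _ => @leb2 R)))).
Qed.

Lemma integral_lebesgue_W (v : L -> R) (g : W A -> \bar R) : (forall m, 0 < v m) ->
  measurable_fun setT g -> (forall f, 0 <= g f)%E ->
  (\int[@lebesgue_W R N A]_f g f =
   (\prod_(k < K) v (enum_val k).1)%:E * \int[lebE]_y g (coef_of v y))%E.
Proof.
move=> v0 mg g0.
pose s : E := fun k => v (enum_val k).1.
rewrite lebesgue_WE.
rewrite (@ge0_integral_image R _ _ _ _ coef_measure mW (@of_coef R N A))//; last first.
  exact: measurable_of_coef.
pose G y := g (of_coef (unflatten_coef y)).
have mG : measurable_fun setT G.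
  apply: (measurableT_comp mg); apply: measurableT_comp; first exact: measurable_of_coef.
  exact: measurable_unflatten_coef.
transitivity (\int[coef_measure]_x G (flatten_coef x))%E.
  by apply: eq_integral => x _; rewrite /G flatten_coefK.
rewrite -(@ge0_integral_image R _ _ _ _ coef_measure lebE flatten_coef G measurable_flatten_coef
  lebE_flatten_coef mG (fun y => g0 _)).
rewrite (ge0_integral_scaleE (v := s) (f := G) (fun k => v0 _) mG (fun y => g0 _)).
congr (_ * _)%E; apply: eq_integral => y _; rewrite /G; congr g.
by apply/ffunP => n; rewrite !ffunE /unflatten_coef /s /= !enum_rankK.
Qed.

Section Law.
Variables (h : W A -> W A -> R[i]) (c : L -> R).
Hypotheses (c0 : forall m, 0 < c m)
  (hc : forall f, complex.Re (h f f) =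
     \sum_m (c m)^-1 * (complex.Re (f m) ^+ 2 + complex.Im (f m) ^+ 2)).

Let v m := Num.sqrt (c m).

Let v0 m : 0 < v m. Proof. by rewrite sqrtr_gt0. Qed.

Let density_coef_of y : gaussian_density h (coef_of v y) = Num.sqrt pi ^+ K * densE y.
Proof.
rewrite densE_expR mulrA mulfV ?mul1r; last by rewrite expf_neq0// gt_eqF// sqrtr_gt0 pi_gt0.
rewrite /gaussian_density hc; congr (expR (- _)).
rewrite -(eq_bigr _ (fun k _ => congr1 (fun k => y k ^+ 2) (enum_valK k))).
rewrite [RHS](sum_enum_val (fun a : J => y (enum_rank a) ^+ 2)) sum_pair.
apply: eq_bigr => m _; rewrite big_bool ffunE /=.
rewrite !exprMn sqr_sqrtr ?(ltW (c0 m))// -mulrDr mulrA mulVf ?gt_eqF// mul1r addrC.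
by [].
Qed.

Let measurable_density : measurable_fun setT (gaussian_density h).
Proof.
suff mg : measurable_fun setT (gaussian_density h \o @of_coef R N A).
  by move=> _ B mB; rewrite setTI; rewrite -[X in measurable X]setTI; exact: mg.
rewrite (_ : _ \o _ = fun x => expR (- \sum_m (c m)^-1 *
    ((x (enum_rank m)).1 ^+ 2 + (x (enum_rank m)).2 ^+ 2))); last first.
  by apply: funext => x; rewrite /= /gaussian_density hc; congr (expR (- _));
    apply: eq_bigr => m _; rewrite ffunE.
apply: measurableT_comp => //; apply: measurable_funN.
apply: measurable_bigsum => m; apply: measurable_funM => //.
apply: measurable_funD; apply: measurable_funX.
  exact: (@measurable_comp_proj _ _ (fun=> (R * R)%type) _ _ _ _ measurable_fst).
exact: (@measurable_comp_proj _ _ (fun=> (R * R)%type) _ _ _ _ measurable_snd).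
Qed.

Let const := (\prod_(k < K) v (enum_val k).1) * Num.sqrt pi ^+ K.

Let const0 : 0 < const.
Proof. by rewrite mulr_gt0 ?exprn_gt0 ?sqrtr_gt0 ?pi_gt0// prodr_gt0. Qed.

Let integral_density B : measurable B ->
  (\int[@lebesgue_W R N A]_(f in B) (gaussian_density h f)%:E =
   const%:E * gaussE K (coef_of v @^-1` B))%E.
Proof.
move=> mB; rewrite lebesgue_WE integral_mkcond.
rewrite (eq_integral (fun f => (\1_B f * gaussian_density h f)%:E)); last first.
  by move=> f _; rewrite patchE indicE; case: ifPn => _; rewrite ?mul1r ?mul0r.
have mBc : measurable (coef_of v @^-1` B).
  by rewrite -[X in measurable X]setTI; exact: measurable_coef_of.
rewrite -lebesgue_WE.
have := @integral_lebesgue_W v (fun f => (\1_B f * gaussian_density h f)%:E) v0.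
move=> ->; last 2 first.
- apply/measurable_EFinP; apply: measurable_funM; [exact: measurable_indic|exact: measurable_density].
- by move=> f; rewrite lee_fin mulr_ge0// expR_ge0.
rewrite (gaussE_dens mBc) [in RHS]EFinM -[RHS]muleA; congr (_ * _)%E.
rewrite -[RHS]ge0_integralZl//.
- by apply: eq_integral => y _; rewrite density_coef_of -EFinM; congr EFin; rewrite mulrCA.
- apply/measurable_EFinP; apply: measurable_funM; last exact: measurable_densE.
  exact: measurable_indic.
- by move=> y _; rewrite lee_fin mulr_ge0// densE_ge0.
Qed.

(** Scaling the [m]-th coefficient by $\sqrt{c_m}$ turns the squared norm into the Euclidean one;
    the resulting constant is the same in the numerator and in the normalisation. *)
Lemma gaussian_law : exists mu : {sigma_finite_measure set (W A) -> \bar R},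
  (mu : set (W A) -> \bar R) = gaussian h /\
  forall B, measurable B -> mu B = gaussE K (coef_of v @^-1` B).
Proof.
have d0 f : 0 <= gaussian_density h f by exact: expR_ge0.
pose nu := density_measure mW measurable_density d0.
have c1 : 0 <= const^-1 by rewrite invr_ge0 ltW.
pose mu : {measure set (W A) -> \bar R} := mscale (NngNum c1) nu.
(* Equality on all sets, measurable or not: [prod_measure] is later applied to the set function
   itself. *)
have muE : (mu : set (W A) -> \bar R) = gaussian h.
  apply: funext => B; rewrite /mu /mscale /gaussian /= integral_density//.
  rewrite preimage_setT gaussE_setT mule1 inver gt_eqF//.
  by rewrite lebesgue_WE.
have law B : measurable B -> mu B = gaussE K (coef_of v @^-1` B).
  move=> mB; rewrite muE /gaussian !integral_density// preimage_setT gaussE_setT mule1.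
  by rewrite inver gt_eqF// muleA -EFinM mulVf ?gt_eqF// mul1e.
have sf : sigma_finite setT mu.
  exists (fun=> setT) => [|k]; first by rewrite bigcup_const.
  by split=> //; rewrite law// preimage_setT gaussE_setT ltry.
by exists (sigma_finite_measure_of sf).
Qed.

End Law.

End GaussianLaw.

(** * Marginals and blocks of the standard Gaussian measure *)

Section Regroup.
Context {R : realType}.
Local Open Scope ereal_scope.

Lemma prode_partition (I J : finType) (f : I -> J) (F : I -> \bar R) :
  \big[*%E/1]_i F i = \big[*%E/1]_j \big[*%E/1]_(i | f i == j) F i.
Proof. by rewrite (partition_big f xpredT). Qed.

Section Restrict.
Context {k K : nat} (f : 'I_k -> 'I_K).
Hypothesis f_inj : injective f.

Definition restrict (y : euclidean R K) : euclidean R k := fun i => y (f i).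

Lemma measurable_restrict : measurable_fun setT restrict.
Proof. by apply: measurable_prodP => i; exact: measurable_proj. Qed.

(** A box in the selected coordinates pulls back to a box whose other sides are full, and these have
    mass 1. *)
Lemma gaussE_restrict (A : set (euclidean R k)) : measurable A ->
  gaussE k A = gaussE K (restrict @^-1` A).
Proof.
move=> mA; rewrite -[RHS]/(image_measure (gaussE K) measurable_restrict A) gaussEE.
apply/esym; apply: (@prod_measure_unique R k _ _ (fun=> gauss1)) => // B mB.
rewrite -[LHS]/(gaussE K (restrict @^-1` (box B))).
pose C j : set R := if [pick i | f i == j] is Some i then B i else setT.
have -> : restrict @^-1` (box B) = box C.
  apply/seteqP; split=> y h.
    move=> j; rewrite /C; case: pickP => // i /eqP <-; exact: h.
  move=> i; have := h (f i); rewrite /C; case: pickP => [i' /eqP/f_inj -> //|/(_ i)].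
  by rewrite eqxx.
rewrite gaussE_box; last first.
  by move=> j; rewrite /C; case: pickP => [i _|_]; [exact: mB|exact: measurableT].
rewrite [RHS](prode_partition f); apply: eq_bigr => j _; rewrite /C.
case: pickP => [i /eqP <-|fj]; last first.
  by rewrite big_pred0 ?probability_setT// => i; exact: fj.
by rewrite (big_pred1 i)// => i'; rewrite (inj_eq f_inj).
Qed.

End Restrict.

Section Blocks.
Context {n M : nat}.
Notation J := ('I_M * bool)%type.
Notation I := ('I_n * 'I_M * bool)%type.
Notation P := (prod_type (fun _ : 'I_n => euclidean R #|{: J}|)).

Definition block_measure : {sigma_finite_measure set P -> \bar R} :=
  prod_sfm (fun _ : 'I_n => @gaussE R #|{: J}|).

Definition flatten_blocks (y : P) : euclidean R #|{: I}| := fun k =>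
  y (enum_val k).1.1 (enum_rank ((enum_val k).1.2, (enum_val k).2)).

Lemma measurable_flatten_blocks : measurable_fun setT flatten_blocks.
Proof.
apply: measurable_prodP => k.
apply: (@measurable_coordE R _ _ P (fun y : P => y (enum_val k).1.1)).
exact: (@measurable_proj n _ (fun=> euclidean R #|{: J}|)).
Qed.

Lemma gaussE_flatten_blocks (A : set (euclidean R #|{: I}|)) : measurable A ->
  gaussE _ A = block_measure (flatten_blocks @^-1` A).
Proof.
move=> mA; rewrite -[RHS]/(image_measure block_measure measurable_flatten_blocks A) gaussEE.
apply/esym; apply: (@prod_measure_unique R _ _ _ (fun=> gauss1)) => // B mB.
rewrite -[LHS]/(block_measure (flatten_blocks @^-1` (box B))).
pose C i : 'I_#|{: J}| -> set R :=
  fun k => B (enum_rank (i, (enum_val k).1, (enum_val k).2)).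
have -> : flatten_blocks @^-1` (box B) = box (fun i => box (C i)).
  apply/seteqP; split=> y h.
    move=> i k; have := h (enum_rank (i, (enum_val k).1, (enum_val k).2)).
    by rewrite /flatten_blocks enum_rankK /= -surjective_pairing enum_valK.
  move=> k; have := h (enum_val k).1.1 (enum_rank ((enum_val k).1.2, (enum_val k).2)).
  by rewrite /flatten_blocks /C enum_rankK /= -!surjective_pairing enum_valK.
rewrite [LHS](_ : _ = prod_measure (fun=> @gaussE R #|{: J}|) (box (fun i => box (C i)))); last first.
  by rewrite /block_measure prod_sfmE.
rewrite prod_measure_box; last by move=> i; apply: measurable_box => k; exact: mB.
transitivity (\big[*%E/1]_(i < n) \big[*%E/1]_(k < #|{: J}|) gauss1 (C i k)).
  by apply: eq_bigr => i _; apply: (@gaussE_box R _ (C i)) => k; exact: mB.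
transitivity (\big[*%E/1]_(i < n) \big[*%E/1]_(c : J) gauss1 (B (enum_rank (i, c.1, c.2)))).
  by apply: eq_bigr => i _; rewrite [RHS](reindex _ (onW_bij _ (@enum_val_bij J))).
rewrite pair_bigA /=.
rewrite [RHS](reindex (fun c : 'I_n * J => enum_rank (c.1, c.2.1, c.2.2))) //=.
exists (fun k => ((enum_val k).1.1, ((enum_val k).1.2, (enum_val k).2))) => [c _|k _].
  by rewrite enum_rankK /= -!surjective_pairing.
by rewrite /= -!surjective_pairing enum_valK.
Qed.

End Blocks.

Section System.
Context {n N M : nat} (A : 'I_n -> set 'rV[R]_N) (h : forall i, W (A i) -> W (A i) -> R[i])
  (c : forall i, lattice_points (A i) -> R) (emb : forall i, lattice_points (A i) -> 'I_M).
Hypotheses (c0 : forall i (m : lattice_points (A i)), (0 < @c i m)%R)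
  (hc : forall i (f : W (A i)), complex.Re (h f f) =
     (\sum_m (c m)^-1 * (complex.Re (f m) ^+ 2 + complex.Im (f m) ^+ 2))%R)
  (emb_inj : forall i, injective (@emb i)).
Notation I := ('I_n * 'I_M * bool)%type.
Notation J := ('I_M * bool)%type.

(** All coefficients are read from one flat Gaussian vector, with [emb i] selecting those of the
    [i]-th polynomial; systems with different exponent sets can thus be driven by vectors of one
    common dimension. *)
Definition coef_system (y : euclidean R #|{: I}|) : prod_type (fun i => W (A i)) :=
  fun i => [ffun m : lattice_points (A i) => (Num.sqrt (c m) * y (enum_rank (i, emb m, false)))
                   +i* (Num.sqrt (c m) * y (enum_rank (i, emb m, true)))]%R.

Let restr i (k : 'I_#|{: (lattice_points (A i) * bool)%type}|) : 'I_#|{: J}| :=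
  enum_rank (emb (enum_val k).1, (enum_val k).2).

Let restr_inj i : injective (@restr i).
Proof.
move=> k k' /enum_rank_inj[/emb_inj h1 h2]; apply: enum_val_inj.
by rewrite (surjective_pairing (enum_val k)) h1 h2 -surjective_pairing.
Qed.

Let phi i (y : euclidean R #|{: J}|) : W (A i) :=
  coef_of (fun m : lattice_points (A i) => Num.sqrt (c m)) (restrict (@restr i) y).

Let mphi i : measurable_fun setT (phi i).
Proof.
apply: measurableT_comp; first exact: measurable_coef_of.
exact: measurable_restrict.
Qed.

Let coef_systemE (y : prod_type (fun _ : 'I_n => euclidean R #|{: J}|)) i :
  coef_system (flatten_blocks y) i = phi i (y i).
Proof.
by apply/ffunP => m; rewrite !ffunE /flatten_blocks /restrict /restr !enum_rankK.
Qed.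

Lemma measurable_coef_system : measurable_fun setT coef_system.
Proof.
apply: measurable_prodP => i.
pose r (k : 'I_#|{: J}|) : 'I_#|{: I}| := enum_rank (i, (enum_val k).1, (enum_val k).2).
rewrite (_ : (fun y => _) = phi i \o restrict r).
  by apply: measurableT_comp; [exact: mphi|exact: measurable_restrict].
by apply: funext => y; apply/ffunP => m; rewrite !ffunE /restrict /restr /r !enum_rankK.
Qed.

Lemma gaussian_system : exists mu : {sigma_finite_measure set (prod_type (fun i => W (A i))) -> \bar R},
  (mu : set _ -> \bar R) = prod_measure (fun i => gaussian (@h i)) /\
  forall B, measurable B -> mu B = gaussE _ (coef_system @^-1` B).
Proof.
pose L i := cid (gaussian_law (@c0 i) (@hc i)).
pose mu i : {sigma_finite_measure set (W (A i)) -> \bar R} := sval (L i).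
have muE i : (mu i : set _ -> \bar R) = gaussian (@h i) := (svalP (L i)).1.
have mulaw i B : measurable B -> mu i B = gaussE _ (phi i @^-1` B).
  move=> mB; rewrite [LHS](svalP (L i)).2//.
  rewrite (gaussE_restrict (@restr_inj i))//.
  by rewrite -[X in measurable X]setTI; exact: measurable_coef_of.
exists (prod_sfm mu); split.
  rewrite prod_sfmE; congr prod_measure.
  by apply: functional_extensionality_dep => i; exact: muE.
move=> B mB; rewrite [LHS](_ : _ = prod_measure mu B); last by rewrite prod_sfmE.
rewrite (@prod_measure_image _ _ _ _ _ _ (fun=> @gaussE R #|{: J}|) mu phi mphi mulaw B mB).
rewrite gaussE_flatten_blocks; last first.
  by rewrite -[X in measurable X]setTI; exact: measurable_coef_system.
rewrite [RHS](_ : _ = prod_measure (fun=> @gaussE R #|{: J}|)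
    (flatten_blocks @^-1` (coef_system @^-1` B))); last first.
  by rewrite /block_measure prod_sfmE.
congr (prod_measure _ _); apply/seteqP; split=> y /=;
  by rewrite (_ : coef_system (flatten_blocks y) = fun i => phi i (y i))//;
    apply: functional_extensionality_dep => i; exact: coef_systemE.
Qed.

End System.

End Regroup.

(** * Polar coordinates *)

Section Polar.
Context {R : realType}.
Implicit Types x a b : R.

Definition cis a : R[i] := cos a +i* sin a.

Definition polar1 x a : R[i] := (expR x)%:C * cis a.

Lemma polar1E x a : polar1 x a = (expR x * cos a) +i* (expR x * sin a).
Proof. by rewrite /polar1 /cis; apply/eqP; rewrite eq_complex /= !mul0r subr0 addr0 !eqxx. Qed.

Lemma polar1D x y a b : polar1 (x + y) (a + b) = polar1 x a * polar1 y b.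
Proof.
rewrite !polar1E; apply/eqP; rewrite eq_complex /= expRD cosD sinD.
by apply/andP; split; apply/eqP; ring.
Qed.

Lemma polar10 : polar1 0 0 = 1.
Proof. by rewrite polar1E expR0 cos0 sin0 mulr1 mulr0. Qed.

Lemma polar1_neq0 x a : polar1 x a != 0.
Proof.
apply/eqP => h; have := polar1D x (- x) a (- a); rewrite h mul0r !subrr polar10.
by move/eqP; rewrite oner_eq0.
Qed.

Lemma polar1V x a : (polar1 x a)^-1 = polar1 (- x) (- a).
Proof.
apply: (mulfI (polar1_neq0 x a)); rewrite divff ?polar1_neq0//.
by rewrite -polar1D !subrr polar10.
Qed.

Lemma polar1X n x a : polar1 x a ^+ n = polar1 (n%:R * x) (n%:R * a).
Proof.
elim: n => [|n IH]; first by rewrite expr0 !mul0r polar10.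
by rewrite exprS IH -polar1D -natr1 !mulrDl !mul1r [x + _]addrC [a + _]addrC.
Qed.

Lemma polar1Xz (k : int) x a : polar1 x a ^ k = polar1 (k%:~R * x) (k%:~R * a).
Proof.
case: k => n; first by rewrite -exprnP polar1X.
by rewrite NegzE -exprnN polar1X polar1V -!mulNr !mulrNz.
Qed.

Lemma polar1_prod (I : Type) (r : seq I) (f g : I -> R) :
  \prod_(i <- r) polar1 (f i) (g i) = polar1 (\sum_(i <- r) f i) (\sum_(i <- r) g i).
Proof.
elim/big_rec3: _ => [|i x y z _ ->]; first by rewrite polar10.
by rewrite polar1D.
Qed.

Lemma norm_polar1 x a : complex.Re `|polar1 x a| = expR x.
Proof.
rewrite normc_def polar1E /= !exprMn -mulrDr cos2Dsin2 mulr1 sqrtr_sqr.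
by rewrite gtr0_norm// expR_gt0.
Qed.

(** Half-angle formula: the sine of $|a|/2$ vanishes, whereas sine is positive on $(0,\pi)$. *)
Lemma cos_eq1 a : `|a| < pi *+ 2 -> cos a = 1 -> a = 0.
Proof.
move=> api ca; apply/eqP; rewrite -normr_eq0; apply/negPn/negP => a0.
pose b := `|a| / 2; have ab : `|a| = b *+ 2 by rewrite -mulr_natr divfK.
have b0 : 0 < b < pi.
  apply/andP; split; first by rewrite divr_gt0// lt_def a0 normr_ge0.
  by rewrite ltr_pdivrMr// mulr_natr.
have sb : sin b = 0.
  have : cos (b *+ 2) = 1 by rewrite -ab cos_norm.
  rewrite cos_mulr2n cos2sin2; move: (sin b) => s h; apply/eqP; rewrite -sqrf_eq0.
  by apply/eqP; move: (s ^+ 2) h => y; rewrite mulr2n => h; lra.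
by have := sin_gt0_pi b0; rewrite sb ltxx.
Qed.

Lemma cis_inj a b : 0 <= a < pi *+ 2 -> 0 <= b < pi *+ 2 ->
  cos a = cos b -> sin a = sin b -> a = b.
Proof.
move=> /andP[a0 a2] /andP[b0 b2] cab sab; apply/eqP; rewrite -subr_eq0; apply/eqP.
apply: cos_eq1; first by rewrite ltr_norml; apply/andP; split; lra.
by rewrite cosB cab sab -!expr2 cos2Dsin2.
Qed.

(** [acos u] covers the upper half circle and $2\pi$ minus it the lower one, where strict negativity
    of [v] excludes the angle $2\pi$. *)
Lemma angle_exists (u v : R) : u ^+ 2 + v ^+ 2 = 1 ->
  exists2 a, 0 <= a < pi *+ 2 & cos a = u /\ sin a = v.
Proof.
move=> uv; have pi0 := pi_gt0 R.
have u2 : u ^+ 2 <= 1 by rewrite -uv lerDl sqr_ge0.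
have u1 : -1 <= u <= 1 by rewrite -ler_norml -(@expr_le1 _ 2)// -normrX ger0_norm ?sqr_ge0.
have su : sin (acos u) = `|v|.
  by rewrite sin_acos// -sqrtr_sqr -uv addrAC subrr add0r.
have [v0|v0] := leP 0 v.
  exists (acos u); last by rewrite acosK// su ger0_norm.
  by rewrite acos_ge0//= (le_lt_trans (acos_lepi u1))// mulr2n ltrDl.
exists (pi *+ 2 - acos u); last first.
  rewrite cosB sinB cos2pi sin2pi acosK// su ltr0_norm// !mul1r !mul0r addr0.
  by rewrite sub0r opprK.
rewrite subr_ge0 (le_trans (acos_lepi u1)) ?mulr2n ?lerDl ?(ltW pi0)//=.
rewrite gtrBl lt_neqAle acos_ge0// andbT; apply/eqP => a0.
by move: su; rewrite -a0 sin0 ltr0_norm// => /eqP; rewrite eq_sym oppr_eq0 lt_eqF.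
Qed.

End Polar.

Lemma counting_image (T U : choiceType) (R : realType) (f : T -> U) (A : set T) :
  {in A &, injective f} -> counting (f @` A) = counting A :> \bar R.
Proof.
move=> fA; rewrite /counting; case: asboolP => Ff; case: asboolP => F.
- rewrite fset_set_image// card_in_imfset// => x y; rewrite !in_fset_set// => xA yA.
  exact: fA.
- by exfalso; apply: F; move: Ff; rewrite (eq_finite_set (inj_card_eq fA)).
- by exfalso; apply: Ff; exact: finite_image.
- by [].
Qed.

Section PolarTorus.
Context {R : realType} {N : nat}.
Implicit Types (x : euclidean R N) (t : 'rV[R]_N) (m : 'rV[int]_N).

(** Angles are measured in turns, so that the half-open unit cube parametrises the fibre of [Log]
    over [x] bijectively. *)
Definition polar x t : 'rV[R[i]]_N := \row_j polar1 (x j) (pi *+ 2 * t 0 j).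

Definition angle m t : R := phase (fun l => pi *+ 2 * (m 0 l)%:~R) t.

Lemma chi_polar m x t : chi m (polar x t) = polar1 (expo x m) (angle m t).
Proof.
rewrite /chi; under eq_bigr do rewrite mxE polar1Xz.
rewrite polar1_prod; congr polar1; apply: eq_bigr => l _; ring.
Qed.

Lemma polar_torus x t : torus (polar x t).
Proof. by move=> j; rewrite mxE polar1_neq0. Qed.

Lemma Log_polar x t : Log (polar x t) = x.
Proof. by apply: funext => j; rewrite /Log mxE norm_polar1 expRK. Qed.

Lemma polar_inj x : {in @unit_cube R N &, injective (polar x)}.
Proof.
move=> t t' /set_mem tu /set_mem t'u /rowP tt'; apply/rowP => j.
have := tt' j; rewrite !mxE !polar1E => /eqP; rewrite eq_complex /= => /andP[/eqP h1 /eqP h2].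
have ex0 : expR (x j) != 0 by rewrite gt_eqF// expR_gt0.
have pi0 : 0 < pi *+ 2 :> R by rewrite pmulrn_lgt0// pi_gt0.
have bound (s : 'rV[R]_N) : unit_cube s -> 0 <= pi *+ 2 * s 0 j < pi *+ 2.
  by move=> /(_ j)/andP[h3 h4]; rewrite mulr_ge0 ?(ltW pi0)//= gtr_pMr.
apply: (mulfI (lt0r_neq0 pi0)); apply: cis_inj; try exact: bound.
  exact: (mulfI ex0).
exact: (mulfI ex0).
Qed.

Lemma polar_surj (z : 'rV[R[i]]_N) : torus z ->
  exists2 t, unit_cube t & polar (Log z) t = z.
Proof.
move=> zT; have pi0 : 0 < pi *+ 2 :> R by rewrite pmulrn_lgt0// pi_gt0.
suff /choice[f fP] : forall j, exists s : R, 0 <= s < 1 /\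
    polar1 (Log z j) (pi *+ 2 * s) = z 0 j.
  exists (\row_j f j) => [j|]; first by rewrite mxE; exact: (fP j).1.
  by apply/rowP => j; rewrite !mxE; exact: (fP j).2.
move=> j; rewrite /Log normc_def /=; move: (zT j); case: (z 0 j) => a b ab0 /=.
set r := Num.sqrt _.
have r2 : r ^+ 2 = a ^+ 2 + b ^+ 2 by rewrite sqr_sqrtr// addr_ge0 ?sqr_ge0.
have r0 : 0 < r.
  rewrite sqrtr_gt0 lt_def addr_ge0 ?sqr_ge0// andbT paddr_eq0 ?sqr_ge0// !sqrf_eq0.
  by move: ab0; rewrite eq_complex.
have [|s /andP[s0 s1] [cs sn]] := @angle_exists R (a / r) (b / r).
  by rewrite !expr_div_n -mulrDl -r2 mulfV// expf_neq0// gt_eqF.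
exists (s / (pi *+ 2)); split.
  by rewrite divr_ge0 ?(ltW pi0)//= ltr_pdivrMr// mul1r.
rewrite mulrCA mulfV ?gt_eqF// mulr1 polar1E cs sn lnK ?posrE//.
by congr (_ +i* _); rewrite mulrCA mulfV ?gt_eqF// mulr1.
Qed.

End PolarTorus.

(** * Expected multivolume *)

Section Padding.
Context {R : realType} {L : finType} {M : nat} (emb : L -> 'I_M).
Hypothesis emb_inj : injective emb.
Implicit Types (f : L -> R).

(** Extension by zero along the injection [emb]; the sum over a fibre avoids choosing an inverse. *)
Definition pad f (k : 'I_M) : R := \sum_(m | emb m == k) f m.

Lemma pad_emb f m : pad f (emb m) = f m.
Proof. by rewrite /pad (big_pred1 m)// => i; rewrite (inj_eq emb_inj). Qed.

Lemma pad_ge0 f k : (forall m, 0 <= f m) -> 0 <= pad f k.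
Proof. by move=> f0; apply: sumr_ge0. Qed.

Lemma sum_pad f (G : 'I_M -> R) : \sum_k pad f k * G k = \sum_m f m * G (emb m).
Proof.
rewrite [RHS](partition_big emb xpredT)//=; apply: eq_bigr => k _.
by rewrite mulr_suml; apply: eq_bigr => m /eqP ->.
Qed.

Lemma sqrt_pad f k : Num.sqrt (pad f k) = pad (fun m => Num.sqrt (f m)) k.
Proof.
have [m /eqP <-|no] := pickP (fun m => emb m == k); first by rewrite !pad_emb.
by rewrite /pad !big_pred0// sqrtr0.
Qed.

End Padding.

Section Fibre.
Context {R : realType} {n N : nat} (e : 'I_N -> 'I_n * bool).
Hypothesis eb : bijective e.
Variable A : 'I_n -> set 'rV[R]_N.
Notation P := (prod_type (fun i => W (A i))).

Definition part (b : bool) (z : R[i]) : R := if b then complex.Im z else complex.Re z.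

Lemma part0P z : (forall b, part b z = 0) <-> z = 0.
Proof.
split=> [h|->]; last by case.
by apply/eqP; rewrite eq_complex (h false : complex.Re z = 0) (h true : complex.Im z = 0) !eqxx.
Qed.

Lemma part_sum (I : Type) (r : seq I) (z : I -> R[i]) b :
  part b (\sum_(i <- r) z i) = \sum_(i <- r) part b (z i).
Proof. by case: b; rewrite /part raddf_sum. Qed.

Lemma part_mul b z x a : part b (z * polar1 x a) = expR x * \sum_b' part b' z * rot2 a b b'.
Proof. by rewrite polar1E big_bool /rot2; case: b z => -[u v] /=; ring. Qed.

Definition laurent_part (p : P * euclidean R N) (t : 'rV[R]_N) (j : 'I_N) : R :=
  part (e j).2 (laurent_eval (p.1 (e j).1) (polar p.2 t)).

Lemma laurent_partE p t j : laurent_part p t j =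
  \sum_(m : lattice_points (A (e j).1)) expR (expo p.2 (val m)) *
    \sum_b part b (p.1 (e j).1 m) * rot2 (angle (val m) t) (e j).2 b.
Proof.
rewrite /laurent_part /laurent_eval part_sum; apply: eq_bigr => m _.
by rewrite chi_polar part_mul.
Qed.

Lemma measurable_part i (m : lattice_points (A i)) b :
  measurable_fun setT (fun p : P => part b (p i m)).
Proof.
have mW : measurable_fun setT (fun f : W (A i) => part b (f m)).
  suff mg : measurable_fun setT ((fun f : W (A i) => part b (f m)) \o @of_coef R N (A i)).
    by move=> _ B mB; rewrite setTI; rewrite -[X in measurable X]setTI; exact: mg.
  rewrite (_ : _ \o _ = fun x : coef_type (A i) =>
      if b then (x (enum_rank m)).2 else (x (enum_rank m)).1); last first.
    by apply: funext => x; rewrite /= ffunE; case: b.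
  case: b.
    exact: (@measurable_comp_proj _ _ (fun=> (R * R)%type) _ _ _ _ measurable_snd).
  exact: (@measurable_comp_proj _ _ (fun=> (R * R)%type) _ _ _ _ measurable_fst).
exact: (@measurable_comp_proj _ _ (fun i => W (A i)) i _ _ _ mW).
Qed.

Lemma measurable_laurent_part t j : measurable_fun setT (fun p => laurent_part p t j).
Proof.
rewrite (_ : (fun p => _) = fun p : P * euclidean R N =>
  \sum_(m : lattice_points (A (e j).1)) expR (expo p.2 (val m)) *
    \sum_b part b (p.1 (e j).1 m) * rot2 (angle (val m) t) (e j).2 b); last first.
  by apply: funext => p; exact: laurent_partE.
apply: measurable_bigsum => m; apply: measurable_funM.
  apply: measurableT_comp => //; apply: measurable_bigsum => l.
  apply: measurable_funM => //.
  by apply: measurable_coordE; exact: measurable_snd.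
apply: measurable_bigsum => b; apply: measurable_funM => //.
exact: (measurableT_comp (measurable_part m b) measurable_fst).
Qed.

Lemma continuous_laurent_part p j : continuous (fun t => laurent_part p t j).
Proof.
rewrite (_ : (fun t => _) = fun t : 'rV[R]_N =>
  \sum_(m : lattice_points (A (e j).1)) expR (expo p.2 (val m)) *
    \sum_b part b (p.1 (e j).1 m) * rot2 (angle (val m) t) (e j).2 b); last first.
  by apply: funext => t; exact: laurent_partE.
apply: continuous_bigsum => m t.
apply: (@continuousM _ _ (cst _) (fun t => \sum_b part b (p.1 (e j).1 m) * rot2 (angle (val m) t) (e j).2 b)).
  exact: cst_continuous.
apply: continuous_bigsum => b {}t.
apply: (@continuousM _ _ (cst _) (fun t => rot2 (angle (val m) t) (e j).2 b)).
  exact: cst_continuous.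
apply: (continuous_comp (f := angle (val m)) (g := fun a => rot2 a _ _)).
  exact: continuous_phase.
exact: continuous_rot.
Qed.

Lemma fibre_polar (f : P) x : zero_locus f `&` [set z | Log z = x] =
  polar x @` zeros_in_cube laurent_part (f, x).
Proof.
have [e' eK e'K] := eb.
apply/seteqP; split=> [z [[zT fz] /= zx]|_ [t [tu ft] <-]].
  have [t tu tz] := polar_surj zT; rewrite zx in tz; exists t => //; split=> // j.
  by rewrite /laurent_part /= tz fz; case: (_.2).
split; last exact: Log_polar.
split=> [|i]; first exact: polar_torus.
by apply/part0P => b; have := ft (e' (i, b)); rewrite /laurent_part e'K.
Qed.

Lemma counting_fibre (f : P) x : counting (zero_locus f `&` [set z | Log z = x]) =
  counting (zeros_in_cube laurent_part (f, x)) :> \bar R.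
Proof.
rewrite fibre_polar counting_image// => t t' /set_mem[tu _] /set_mem[t'u _].
by apply: polar_inj; exact: mem_set.
Qed.

Definition fibre_count (p : P * euclidean R N) : \bar R :=
  counting (zeros_in_cube laurent_part p).

Lemma measurable_fibre_count : measurable_fun setT fibre_count.
Proof.
apply: measurable_counting_zeros.
  exact: measurable_laurent_part.
exact: continuous_laurent_part.
Qed.

Lemma counting_ge0 (T : choiceType) (Z : set T) : (0 <= counting Z :> \bar R)%E.
Proof. by rewrite /counting; case: asboolP => _; rewrite ?lee_fin// leey. Qed.

(** The count of zeros in a fibre is jointly measurable in the system and in [x], and equals the
    count in the cube for every [x], without exceptional points. *)
Lemma multivolume_tonelli (mu : {sigma_finite_measure set P -> \bar R}) :
  (\int[mu]_f multivolume (zero_locus f) =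
   \int[lebE]_x \int[mu]_f fibre_count (f, x))%E.
Proof.
rewrite -(@fubini_tonelli _ _ _ _ _ mu (@lebE R N) fibre_count measurable_fibre_count); last first.
  by move=> p; exact: counting_ge0.
apply: eq_integral => f _; rewrite /multivolume -lebEE.
by apply: eq_integral => x _; rewrite counting_fibre.
Qed.

End Fibre.

Section Slice.
Context {R : realType} {n N M' : nat} (e : 'I_N -> 'I_n * bool).
Hypothesis eb : bijective e.
Variable Delta : 'I_n -> set 'rV[R]_N.
Hypotheses (Dl : forall i, lattice_polytope (Delta i))
  (Df : forall i, full_dimensional (Delta i))
  (Dn : forall i, normal_polytope (Delta i)).
Variable h : forall i, {dot W (Delta i) for conjC}.
Notation M := (1 + N + M')%N.
Notation I := ('I_n * 'I_M * bool)%type.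
Notation K := #|{: I}|.
Notation E := (euclidean R K).

Lemma kernel_coef_gt0 a i (m : lattice_points (dilate a (Delta i))) : (0 < a)%N ->
  0 < kernel_coef (h i) a (val m).
Proof.
move=> a0; have : 0 < kernel_pow_coef (h i) a (val m).
  by apply: kernel_pow_coef_gt0 => //; apply/in_lattice_points => //; exact: valP.
by rewrite kernel_pow_coefE ltcR.
Qed.

Lemma induced_metric_Re a i (f : W (dilate a (Delta i))) :
  complex.Re (induced_metric (h i) f f) =
  \sum_m (kernel_coef (h i) a (val m))^-1 * (complex.Re (f m) ^+ 2 + complex.Im (f m) ^+ 2).
Proof.
rewrite /induced_metric raddf_sum; apply: eq_bigr => m _.
rewrite kernel_pow_coefE -[X in X * _ * _](fmorphV (real_complex R)) -mulrA.
by case: (f m) => u v /=; ring.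
Qed.

Section System.
Variables (a : 'I_n -> nat) (a_gt0 : forall i, (0 < a i)%N).
Notation A := (fun i => dilate (a i) (Delta i)).
Variable emb : forall i, lattice_points (A i) -> 'I_M.
Hypothesis emb_inj : forall i, injective (@emb i).
Variable x : euclidean R N.

Definition slice_weight i := pad (@emb i)
  (fun m : lattice_points (A i) => kernel_weight (h i) x (a i) (val m)).

Definition slice_freq i k l := pad (@emb i)
  (fun m : lattice_points (A i) => kernel_freq (h i) x (a i) (val m) l) k.

Definition slice_coef i (m : lattice_points (A i)) := kernel_coef (h i) (a i) (val m).

Notation kw := (fun i (m : lattice_points (A i)) => kernel_weight (h i) x (a i) (val m)).

Let kw_ge0 i m : 0 <= kw i m.
Proof. by apply/ltW; apply: kernel_weight_gt0 => //; exact: valP. Qed.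

(** The system on the fibre with total weight 1 and centred frequencies, the form to which the
    covariance argument applies. *)
Let reduced (y : E) t i : R[i] := \sum_(m : lattice_points (A i))
  ((y (enum_rank (i, emb m, false)) * Num.sqrt (kw i m)) +i*
   (y (enum_rank (i, emb m, true)) * Num.sqrt (kw i m))) *
  polar1 0 (phase (kernel_freq (h i) x (a i) (val m)) t).

Let field_reduced y t j :
  field (trig_H e slice_weight slice_freq) y t j = part (e j).2 (reduced y t (e j).1).
Proof.
set i := (e j).1; set b := (e j).2.
transitivity (\sum_k Num.sqrt (slice_weight i k) *
    \sum_b' y (enum_rank (i, k, b')) * rot2 (phase (slice_freq i k) t) b b').
  rewrite /field; transitivity (\sum_c y (enum_rank c) *
      trig_basis e slice_weight slice_freq j c t).
    by rewrite -[RHS]sum_enum_val; apply: eq_bigr => k _; rewrite enum_valK.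
  rewrite sum_pair sum_pair (bigD1 i)//= [X in _ + X]big1 ?addr0; last first.
    move=> i' ii; apply: big1 => k _; apply: big1 => b' _.
    by rewrite /trig_basis /= -/i eq_sym (negbTE ii) !mul0r mulr0.
  apply: eq_bigr => k _; rewrite mulr_sumr; apply: eq_bigr => b' _.
  by rewrite /trig_basis /= -/i eqxx mul1r; ring.
rewrite /slice_weight; under eq_bigr do rewrite (sqrt_pad (@emb_inj i)).
rewrite (sum_pad (@emb i) (fun m => Num.sqrt (kw i m))
  (fun k => \sum_b' y (enum_rank (i, k, b')) * rot2 (phase (slice_freq i k) t) b b')).
rewrite /reduced part_sum; apply: eq_bigr => m _; rewrite part_mul expR0 mul1r mulr_sumr.
apply: eq_bigr => b' _.
rewrite (_ : slice_freq i (emb m) = kernel_freq (h i) x (a i) (val m)); last first.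
  by apply: funext => l; rewrite /slice_freq (pad_emb (@emb_inj i)).
by rewrite mulrCA mulrA; case: b'.
Qed.

Let laurent_reduced y t i : exists2 c : R[i], c != 0 &
  laurent_eval (coef_system slice_coef emb y i) (polar x t) = c * reduced y t i.
Proof.
(* The common factor has modulus $\sqrt{K(z,z)^{a_i}}$ and the phase of $a_i$ times the mean
   exponent, which removes the mean from the frequencies. *)
pose s := ln (Num.sqrt (kernel_mass (h i) x ^+ a i)).
have Z0 : 0 < kernel_mass (h i) x ^+ a i by rewrite exprn_gt0// kernel_mass_gt0.
exists (polar1 s (phase (fun l => pi *+ 2 * ((a i)%:R * kernel_mean (h i) x l)) t)).
  exact: polar1_neq0.
rewrite /laurent_eval /reduced mulr_sumr; apply: eq_bigr => m _.
rewrite chi_polar ffunE [RHS]mulrCA -[X in _ = _ * X]polar1D addr0.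
have -> : phase (fun l => pi *+ 2 * ((a i)%:R * kernel_mean (h i) x l)) t +
    phase (kernel_freq (h i) x (a i) (val m)) t = angle (val m) t.
  rewrite -big_split /=; apply: eq_bigr => l _; rewrite /kernel_freq; ring.
have c0 := kernel_coef_gt0 m (a_gt0 i).
have E0 : Num.sqrt (slice_coef m) * expR (expo x (val m)) = Num.sqrt (kw i m) * expR s.
  rewrite /s lnK ?posrE ?sqrtr_gt0// -sqrtrM ?kw_ge0// /kernel_weight divfK ?gt_eqF//.
  by rewrite sqrtrM ?(ltW c0)// expRM_natl sqrtr_sqr ger0_norm// expR_ge0.
rewrite !polar1E; apply/eqP; rewrite eq_complex /=.
move: E0; move: (Num.sqrt _) (expR _) (Num.sqrt _) (expR _) => u v u' v' E0.
by apply/andP; split; apply/eqP; ring: E0.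
Qed.

Lemma fibre_count_system y :
  fibre_count e (coef_system slice_coef emb y, x) =
  counting (trig_zeros e slice_weight slice_freq y).
Proof.
have [e' eK e'K] := eb.
rewrite /fibre_count; congr counting; apply/seteqP; split=> t [tu Ht]; split=> // j.
  have [c c0 lc] := laurent_reduced y t (e j).1.
  rewrite field_reduced; suff -> : reduced y t (e j).1 = 0 by case: (_.2).
  apply: (mulfI c0); rewrite mulr0 -lc; apply/part0P => b.
  by have := Ht (e' ((e j).1, b)); rewrite /laurent_part e'K.
have [c c0 lc] := laurent_reduced y t (e j).1.
rewrite /laurent_part /= lc; suff -> : reduced y t (e j).1 = 0 by rewrite mulr0; case: (_.2).
apply/part0P => b; have := Ht (e' ((e j).1, b)).
by rewrite field_reduced e'K.
Qed.

Lemma slice_integral (mu : {sigma_finite_measure set (prod_type (fun i => W (A i))) -> \bar R}) :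
  (forall B, measurable B -> mu B = gaussE K (coef_system slice_coef emb @^-1` B)) ->
  (\int[mu]_f fibre_count e (f, x) =
   \int[gaussE K]_y counting (trig_zeros e slice_weight slice_freq y))%E.
Proof.
move=> mulaw.
rewrite (@ge0_integral_image R _ _ _ _ (gaussE K) mu (coef_system slice_coef emb)
  (fun f => fibre_count e (f, x)) (measurable_coef_system _ _) mulaw).
- by apply: eq_integral => y _; exact: fibre_count_system.
- have mx : measurable_fun setT
      (fun f : prod_type (fun i => W (A i)) => (f, x) : prod_type (fun i => W (A i)) * euclidean R N).
    exact: measurable_fun_pair.
  exact: (measurableT_comp (@measurable_fibre_count R n N e A) mx).
- by move=> f; exact: counting_ge0.
Qed.

End System.

(** The order of quantifiers is the point: [C] depends on the covariances of the kernels over [x]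
    and is fixed before the multiples [a], so it is shared by both sides of the theorem. *)
Lemma slice_expectation x : exists C : \bar R, forall (a : 'I_n -> nat)
    (emb : forall i, lattice_points (dilate (a i) (Delta i)) -> 'I_M)
    (mu : {sigma_finite_measure set (prod_type (fun i => W (dilate (a i) (Delta i)))) -> \bar R}),
  (forall i, (0 < a i)%N) -> (forall i, injective (@emb i)) ->
  (forall B, measurable B -> mu B = gaussE K (coef_system (@slice_coef a) emb @^-1` B)) ->
  (\int[mu]_f fibre_count e (f, x) = (\prod_i (a i)%:R)%:E * C)%E.
Proof.
have [C CP] := @expected_count_cov R n N M' e eb (fun i => kernel_cov (h i) x)
  (fun i => kernel_cov_posdef _ (Dl i) (Df i) x).
exists C => a emb mu a0 emb_inj mulaw.
rewrite (@slice_integral a a0 emb emb_inj x mu mulaw); apply: CP.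
- by move=> i; rewrite ltr0n.
- by move=> i k; apply: pad_ge0 => m; apply/ltW; apply: kernel_weight_gt0 => //; exact: valP.
- move=> i; have := sum_pad (@emb i) (fun m => kernel_weight (h i) x (a i) (val m)) (fun=> 1).
  under eq_bigr do rewrite mulr1; move=> ->.
  by under eq_bigr do rewrite mulr1; exact: kernel_weight_sum.
- move=> i l; rewrite sum_pad.
  rewrite -[RHS](kernel_weight_mean (h i) (Dl i) (Df i) x (a i) l).
  by apply: eq_bigr => m _; rewrite /slice_freq (pad_emb (@emb_inj i)).
- move=> i l l'; under eq_bigr do rewrite -mulrA; rewrite sum_pad.
  rewrite -(kernel_weight_cov (h i) (Dl i) (Df i) x (a i) l l').
  by apply: eq_bigr => m _; rewrite /slice_freq !(pad_emb (@emb_inj i)).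
Qed.

End Slice.

Definition re_im_index n (j : 'I_(2 * n)) : 'I_n * bool :=
  enum_val (cast_ord (esym (etrans (card_prod _ _)
    (etrans (congr2 muln (card_ord n) card_bool) (mulnC n 2)))) j).

Lemma re_im_index_bij n : bijective (@re_im_index n).
Proof. exact: bij_comp (@enum_val_bij _) (Bijective (cast_ordK _) (cast_ordKV _)). Qed.

Lemma embedding_exists (T : finType) M : (#|T| <= M)%N -> exists f : T -> 'I_M, injective f.
Proof.
move=> TM; exists (fun m => widen_ord TM (enum_rank m)) => m m' /(congr1 val) /= h.
by apply: enum_rank_inj; exact: val_inj.
Qed.

Theorem theorem5p1 (R : realType) (n : nat) (n_gt0 : (0 < n)%N)
  (Delta : 'I_n -> set 'rV[R]_(2 * n))
  (Delta_lattice : forall i, lattice_polytope (Delta i))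
  (Delta_full : forall i, full_dimensional (Delta i))
  (Delta_normal : forall i, normal_polytope (Delta i))
  (h : forall i, {dot W (Delta i) for conjC})
  (h_orthogonal : forall i, characters_orthogonal (h i))
  (d : 'I_n -> nat) (d_gt0 : forall i, (0 < d i)%N) :
  expected_multivolume h d =
    ((\prod_i d i)%N%:R%:E * expected_multivolume h (fun=> 1%N))%E.
Proof.
pose L (a : 'I_n -> nat) i : finType := lattice_points (dilate (a i) (Delta i)).
(* Large enough for the exponents of both families, so that one dimension, and hence one constant
   per fibre, serves both. *)
pose M' := (\sum_i #|L d i| + \sum_i #|L (fun=> 1%N) i|)%N.
have LM a i : (\sum_i #|L a i| <= M')%N -> (#|L a i| <= 1 + 2 * n + M')%N.
  by move=> aM; rewrite (leq_trans _ (leq_addl _ _))// (leq_trans _ aM)// (bigD1 i)//= leq_addr.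
have law a : (forall i, (0 < a i)%N) -> (\sum_i #|L a i| <= M')%N ->
    exists2 mu : {sigma_finite_measure set (prod_type (fun i => W (dilate (a i) (Delta i)))) -> \bar R},
      expected_multivolume h a = (\int[mu]_f multivolume (zero_locus f))%E &
      exists2 emb : forall i, L a i -> 'I_(1 + 2 * n + M'), (forall i, injective (emb i)) &
      forall B, measurable B -> mu B = gaussE _ (coef_system (@slice_coef _ _ _ Delta h a) emb @^-1` B).
  move=> a0 aM.
  pose em i := cid (embedding_exists (LM a i aM)).
  have [mu [muE mulaw]] := @gaussian_system R n _ _ _
    (fun i => @induced_metric _ _ _ (h i) (a i)) (@slice_coef _ _ _ Delta h a) (fun i => sval (em i))
    (fun i m => kernel_coef_gt0 Delta_lattice Delta_normal h m (a0 i))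
    (fun i f => induced_metric_Re h f) (fun i => svalP (em i)).
  exists mu; last by exists (fun i => sval (em i)) => // i; exact: (svalP (em i)).
  by rewrite /expected_multivolume muE.
have [mud dE [embd embd_inj mudlaw]] := law d d_gt0 (leq_addr _ _).
have [mu1 oneE [emb1 emb1_inj mu1law]] := law (fun=> 1%N) (fun=> isT) (leq_addl _ _).
have eb := re_im_index_bij n.
rewrite dE oneE !(multivolume_tonelli eb).
pose I1 x := (\int[mu1]_f fibre_count (@re_im_index n) (f, x))%E.
transitivity (\int[lebE]_x ((\prod_i d i)%N%:R%:E * I1 x))%E.
  apply: eq_integral => x _.
  have [C CP] := @slice_expectation R n (2 * n) M' _ eb Delta Delta_lattice Delta_full Delta_normal h x.
  rewrite (CP d embd mud d_gt0 embd_inj mudlaw) /I1.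
  rewrite (CP (fun=> 1%N) emb1 mu1 (fun=> isT) emb1_inj mu1law).
  by rewrite natr_prod; congr (_ * _)%E; rewrite big1 ?mul1e.
rewrite ge0_integralZl//.
- exact: (@measurable_fun_fubini_tonelli_G _ _ _ _ R mu1 _
    (@measurable_fibre_count R n (2 * n) (@re_im_index n) (fun i => dilate 1 (Delta i)))
    (fun p => counting_ge0 _)).
- by move=> x _; apply: integral_ge0 => f _; exact: counting_ge0.
Qed.
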